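(* Let $T\sim\{X_n\}_{n=1}^\infty$ be a random weighted shift on $\mathcal H$. Then (i) $$\mathbb P\big(C^*(T)\text{ is simple}\big)=\begin{cases}1,&\operatorname{essran}X_1=\{0\},\\0,&\text{otherwise};\end{cases}$$ (ii) $$\mathbb P\big(T\text{ is GCR}\big)=\begin{cases}1,&\operatorname{card}\big(\operatorname{essran}X_1\setminus\{0\}\big)\le1,\\0,&\text{otherwise}.\end{cases}$$
   Context: $\mathcal H$ is a complex separable infinite-dimensional Hilbert space with orthonormal basis $\{e_n\}_{n=1}^\infty$. $\{X_n\}_{n=1}^\infty$ are nonnegative, bounded, i.i.d. random variables on a probability space $(\Omega,\mathcal F,\mathbb P)$. Writing $T\sim\{X_n\}$ means that $T=T(\omega)$ is the random unilateral weighted shift $T(\omega)e_n=X_n(\omega)e_{n+1}$, $n\ge1$. $\operatorname{essran}X_1$ is the essential range of $X_1$ (closed support of its law). $C^*(A)$ is the $C^*$-algebra generated by $A$ and the identity. A $C^*$-algebra is simple if it has no proper nonzero closed two-sided ideal. A $C^*$-algebra $\mathcal A$ is CCR if $\rho(\mathcal A)$ consists of compact operators for every irreducible representation $\rho$ of $\mathcal A$; it is GCR if every nonzero quotient $C^*$-algebra of $\mathcal A$ possesses a nonzero CCR ideal. An operator $A$ is GCR if $C^*(A)$ is a GCR algebra. *)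

(* Defs.v *)
From HB Require Import structures.
From mathcomp Require Import all_boot all_order all_algebra.
From mathcomp Require Import finmap complex ring lra.
From mathcomp Require Import all_classical all_reals all_analysis.
Set Implicit Arguments.
Unset Strict Implicit.
Unset Printing Implicit Defensive.
Import Order.TTheory GRing.Theory Num.Theory numFieldNormedType.Exports.
Local Open Scope classical_set_scope.
Local Open Scope ring_scope.
Local Open Scope complex_scope.

(* Inner products are linear in the first variable.  Norms of complex normed
   modules take their values in R[i]. *)
HB.mixin Record isHilbert (R : realType) H & CompleteNormedModule R[i] H := {
  dotp : H -> H -> R[i];
  dotpDl : forall x y z, dotp (x + y) z = dotp x z + dotp y z;
  dotpZl : forall (c : R[i]) x y, dotp (c *: x) y = c * dotp x y;
  dotpC : forall x y, dotp x y = Num.conj (dotp y x);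
  dotpxx : forall x, dotp x x = `|x| ^+ 2 }.

#[short(type="hilbertType")]
HB.structure Definition Hilbert (R : realType) :=
  {H of CompleteNormedModule R[i] H & isHilbert R H}.

HB.mixin Record isCstarAlgebra (R : realType) A
    & CompleteNormedModule R[i] A := {
  cmul : A -> A -> A;
  cstar : A -> A;
  cmulA : associative cmul;
  cmulDl : left_distributive cmul +%R;
  cmulDr : right_distributive cmul +%R;
  cmulZl : forall (c : R[i]) a b, cmul (c *: a) b = c *: cmul a b;
  cmulZr : forall (c : R[i]) a b, cmul a (c *: b) = c *: cmul a b;
  cstarK : involutive cstar;
  cstarD : {morph cstar : a b / a + b};
  cstarZ : forall (c : R[i]) a, cstar (c *: a) = Num.conj c *: cstar a;
  cstarM : forall a b, cstar (cmul a b) = cmul (cstar b) (cstar a);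
  norm_cmul : forall a b, `|cmul a b| <= `|a| * `|b|;
  norm_cstar : forall a, `|cmul (cstar a) a| = `|a| ^+ 2 }.

(* Not necessarily unital, as closed ideals must be C*-algebras as well. *)
#[short(type="cstarAlgType")]
HB.structure Definition CstarAlgebra (R : realType) :=
  {A of CompleteNormedModule R[i] A & isCstarAlgebra R A}.

Definition cabs (R : realType) (c : R[i]) : R := Normc.normc c.

Lemma cabsE (R : realType) (c : R[i]) : `|c| = (cabs c)%:C.
Proof. by []. Qed.

Lemma cabs0 (R : realType) : cabs (0 : R[i]) = 0.
Proof. by apply: complexI; rewrite -cabsE normr0. Qed.

Lemma cabsJ (R : realType) (c : R[i]) : cabs (Num.conj c) = cabs c.
Proof. by apply: complexI; rewrite -!cabsE norm_conjC. Qed.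

Lemma cabs_ge0 (R : realType) (c : R[i]) : 0 <= cabs c :> R.
Proof. by rewrite -ler0c -cabsE. Qed.

Section RealNorm.
Variables (R : realType) (V : normedModType R[i]).
Implicit Types x y : V.

Definition rnorm x : R := complex.Re `|x|.

Lemma rnormE x : `|x| = (rnorm x)%:C.
Proof. by rewrite RRe_real// realE normr_ge0. Qed.

Lemma rnorm_ge0 x : 0 <= rnorm x.
Proof. by rewrite -ler0c -rnormE. Qed.

Lemma rnorm0 : rnorm (0 : V) = 0.
Proof. by rewrite /rnorm normr0. Qed.

Lemma rnorm0_eq0 x : rnorm x = 0 -> x = 0.
Proof. by move=> x0; apply/normr0_eq0; rewrite rnormE x0. Qed.

Lemma rnormD x y : rnorm (x + y) <= rnorm x + rnorm y.
Proof.
rewrite -lecR rmorphD/= -!rnormE; exact: ler_normD.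
Qed.

Lemma rnormZ (c : R[i]) x : rnorm (c *: x) = cabs c * rnorm x.
Proof.
apply: complexI; rewrite -[LHS]rnormE normrZ [X in X * _]cabsE.
by rewrite [X in _ * X]rnormE -rmorphM.
Qed.

Lemma rnormN x : rnorm (- x) = rnorm x.
Proof. by rewrite /rnorm normrN. Qed.

End RealNorm.

Lemma gtC0E (R : realType) (e : R[i]) : 0 < e -> exists2 r : R, 0 < r & e = r%:C.
Proof.
case: e => a b; rewrite ltcE/= => /andP[/eqP-> a0]; by exists a.
Qed.

Section Bop.
Variables (R : realType) (H : hilbertType R).

Record bop := Bop {
  bopf :> H -> H;
  bop_linear : linear bopf;
  bop_continuous : continuous bopf }.

Lemma bop_inj (S T : bop) : (forall x, S x = T x) -> S = T.
Proof.
case: S T => [f fl fc] [g gl gc] /= /funext fg.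
by move: fl fc gl gc; rewrite fg => *; congr Bop; apply: Prop_irrelevance.
Qed.

Lemma linear_bounded_cont (f : H -> H) : linear f ->
  continuous f <-> exists M : R, forall x, rnorm (f x) <= M * rnorm x.
Proof.
move=> lf.
pose F : {linear H -> H} := HB.pack f (GRing.isLinear.Build _ _ _ _ _ lf).
split.
  move=> /(@linear_bounded_continuous _ _ _ F)/linear_boundedP.
  case/pinfty_ex_gt0 => _/gtC0E[M M0 ->] fM; exists M => x.
  by have := fM x; rewrite !rnormE -rmorphM/= lecR.
case=> M fM; apply: (@bounded_linear_continuous _ _ _ F).
apply/linear_boundedP; exists (Num.max 0 M)%:C; split.
  by apply/complex_realP; exists (Num.max 0 M).
move=> r Mr x; apply: (@le_trans _ _ ((Num.max 0 M)%:C * `|x|)).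
  rewrite !rnormE -rmorphM/= lecR (le_trans (fM x))// ler_wpM2r ?rnorm_ge0//.
  by rewrite le_max lexx orbT.
by rewrite ler_wpM2r// ltW.
Qed.

Lemma bopD (T : bop) x y : T (x + y) = T x + T y.
Proof. by have := bop_linear T 1 x y; rewrite !scale1r. Qed.

Lemma bop0 (T : bop) : T 0 = 0.
Proof. by apply: (addrI (T 0)); rewrite -bopD !addr0. Qed.

Lemma bopZ (T : bop) c x : T (c *: x) = c *: T x.
Proof. by have := bop_linear T c x 0; rewrite bop0 !addr0. Qed.

Lemma bopN (T : bop) x : T (- x) = - T x.
Proof. by rewrite -scaleN1r bopZ scaleN1r. Qed.

HB.instance Definition _ := gen_eqMixin bop.
HB.instance Definition _ := gen_choiceMixin bop.

Definition mkbop (f : H -> H) (lf : linear f)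
    (bf : exists M : R, forall x, rnorm (f x) <= M * rnorm x) : bop :=
  Bop lf ((linear_bounded_cont lf).2 bf).

Lemma bop_bounded (T : bop) : exists M : R, forall x, rnorm (T x) <= M * rnorm x.
Proof. exact/(linear_bounded_cont (bop_linear T)).1/bop_continuous. Qed.

Definition bop_zero : bop.
Proof.
refine (@mkbop (fun=> 0) _ _).
  by move=> c x y; rewrite scaler0 addr0.
by exists 0 => x; rewrite rnorm0 mul0r.
Defined.

Definition bop_add (S T : bop) : bop.
Proof.
refine (@mkbop (fun x => S x + T x) _ _).
  by move=> c x y; rewrite !bop_linear scalerDr addrACA.
have [M SM] := bop_bounded S; have [N TN] := bop_bounded T.
by exists (M + N) => x; rewrite (le_trans (rnormD _ _))// mulrDl lerD.
Defined.

Definition bop_scale (c : R[i]) (T : bop) : bop.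
Proof.
refine (@mkbop (fun x => c *: T x) _ _).
  by move=> d x y; rewrite bop_linear scalerDr !scalerA mulrC.
have [M TM] := bop_bounded T; exists (cabs c * M) => x.
by rewrite rnormZ -mulrA ler_wpM2l ?cabs_ge0.
Defined.

Definition bop_opp (T : bop) : bop := bop_scale (-1) T.

Lemma bop_addA : associative bop_add.
Proof. by move=> S T U; apply: bop_inj => x; rewrite /= addrA. Qed.
Lemma bop_addC : commutative bop_add.
Proof. by move=> S T; apply: bop_inj => x; rewrite /= addrC. Qed.
Lemma bop_add0 : left_id bop_zero bop_add.
Proof. by move=> S; apply: bop_inj => x; rewrite /= add0r. Qed.
Lemma bop_addN : left_inverse bop_zero bop_opp bop_add.
Proof. by move=> S; apply: bop_inj => x; rewrite /= scaleN1r addNr. Qed.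

HB.instance Definition _ :=
  GRing.isZmodule.Build bop bop_addA bop_addC bop_add0 bop_addN.

Lemma bop_scaleA a b T : bop_scale a (bop_scale b T) = bop_scale (a * b) T.
Proof. by apply: bop_inj => x; rewrite /= scalerA. Qed.
Lemma bop_scale1 : left_id 1 bop_scale.
Proof. by move=> S; apply: bop_inj => x; rewrite /= scale1r. Qed.
Lemma bop_scaleDr : right_distributive bop_scale +%R.
Proof. by move=> c S T; apply: bop_inj => x; rewrite /= scalerDr. Qed.
Lemma bop_scaleDl T : {morph bop_scale^~ T : a b / a + b}.
Proof. by move=> a b; apply: bop_inj => x; rewrite /= scalerDl. Qed.

HB.instance Definition _ := GRing.Zmodule_isLmodule.Build R[i] bop
  bop_scaleA bop_scale1 bop_scaleDr bop_scaleDl.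

Lemma bop_addE (S T : bop) x : (S + T) x = S x + T x. Proof. by []. Qed.
Lemma bop_scaleE (c : R[i]) (T : bop) x : (c *: T) x = c *: T x.
Proof. by []. Qed.
Lemma bop_oppE (T : bop) x : (- T) x = - T x.
Proof. by rewrite -[RHS]scaleN1r. Qed.

Definition opnorm (T : bop) : R :=
  sup [set rnorm (T x) | x in [set x : H | rnorm x <= 1]].

Lemma opnorm_has_sup (T : bop) :
  has_sup [set rnorm (T x) | x in [set x : H | rnorm x <= 1]].
Proof.
split; first by exists (rnorm (T 0)), 0 => //=; rewrite rnorm0.
have [M TM] := bop_bounded T; exists (Num.max 0 M) => _ [x /= x1 <-].
apply: (le_trans (TM x)); apply: (@le_trans _ _ (Num.max 0 M * rnorm x)).
  by rewrite ler_wpM2r ?rnorm_ge0// le_max lexx orbT.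
by rewrite ler_piMr// le_max lexx.
Qed.

Lemma opnorm_ge0 T : 0 <= opnorm T.
Proof.
have -> : 0 = rnorm (T 0) by rewrite bop0 rnorm0.
apply: sup_upper_bound (opnorm_has_sup T) _ _ => /=.
by exists 0 => //=; rewrite rnorm0.
Qed.

Lemma opnormP (T : bop) x : rnorm (T x) <= opnorm T * rnorm x.
Proof.
have [/rnorm0_eq0->|x0] := eqVneq (rnorm x) 0; first by rewrite bop0 !rnorm0 mulr0.
have xp : 0 < rnorm x by rewrite lt_neqAle eq_sym x0 rnorm_ge0.
rewrite -ler_pdivrMr//.
have rV : cabs ((rnorm x)^-1)%:C = (rnorm x)^-1.
  by apply: complexI; rewrite -cabsE ger0_norm// ler0c invr_ge0 ltW.
apply: sup_upper_bound (opnorm_has_sup T) _ _ => /=.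
exists ((rnorm x)^-1%:C *: x) => /=; first by rewrite rnormZ rV mulVf.
by rewrite bopZ rnormZ rV mulrC.
Qed.

Lemma opnorm_le (T : bop) (M : R) : 0 <= M ->
  (forall x, rnorm (T x) <= M * rnorm x) -> opnorm T <= M.
Proof.
move=> M0 TM; apply: ge_sup; first exact: (opnorm_has_sup T).1.
move=> _ [x /= x1 <-]; apply: (le_trans (TM x)).
by rewrite ler_piMr.
Qed.

Lemma ler_opnormD (S T : bop) :
  (opnorm (S + T))%:C <= (opnorm S)%:C + (opnorm T)%:C.
Proof.
rewrite -rmorphD/= lecR; apply: opnorm_le => [|x].
  by rewrite addr_ge0 ?opnorm_ge0.
by rewrite bop_addE (le_trans (rnormD _ _))// mulrDl lerD ?opnormP.
Qed.

Lemma opnormZ_le c (T : bop) : opnorm (c *: T) <= cabs c * opnorm T.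
Proof.
have c0 := cabs_ge0 c.
apply: opnorm_le => [|x]; first by rewrite mulr_ge0 ?opnorm_ge0.
by rewrite bop_scaleE rnormZ -mulrA ler_wpM2l ?opnormP.
Qed.

Lemma opnormZ c (T : bop) : (opnorm (c *: T))%:C = `|c| * (opnorm T)%:C.
Proof.
have rc := @cabsE R.
rewrite [in RHS]rc -rmorphM/=; congr (_%:C); apply/eqP; rewrite eq_le opnormZ_le/=.
have [->|c0] := eqVneq c 0.
  by rewrite cabs0 mul0r opnorm_ge0.
have cp : 0 < cabs c :> R by rewrite -ltcR -rc normr_gt0.
rewrite mulrC -ler_pdivlMr// mulrC.
have {1}-> : T = c^-1 *: (c *: T) by rewrite scalerA mulVf// scale1r.
apply: (le_trans (opnormZ_le _ _)).
rewrite ler_wpM2r ?opnorm_ge0// -lecR fmorphV/=.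
by rewrite -[_%:C]rc normfV (rc c).
Qed.

Lemma opnorm0_eq0 (T : bop) : (opnorm T)%:C = 0 :> R[i] -> T = 0.
Proof.
move=> [T0]; apply: bop_inj => x; apply: rnorm0_eq0; apply/eqP.
rewrite eq_le rnorm_ge0 andbT (le_trans (opnormP _ _))//.
by rewrite T0 mul0r.
Qed.

HB.instance Definition _ := @Lmodule_isNormed.Build R[i] bop
  (fun T => (opnorm T)%:C) ler_opnormD opnormZ opnorm0_eq0.

Lemma bop_normE (T : bop) : `|T| = (opnorm T)%:C. Proof. by []. Qed.

Lemma bop_norm_le (T : bop) x : `|T x| <= `|T| * `|x|.
Proof. by rewrite bop_normE !rnormE -rmorphM/= lecR opnormP. Qed.

Lemma rball (V : normedModType R[i]) (x y : V) (e : R) :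
  ball x e%:C y <-> rnorm (x - y) < e.
Proof. by rewrite -ball_normE/= rnormE ltcR. Qed.

Lemma bop_complete (F : set_system bop) : ProperFilter F -> cauchy F -> cvg F.
Proof.
move=> FF /cauchyP Fc.
have Fball (e : R) : 0 < e -> exists T : bop, F (fun S => opnorm (T - S) < e).
  move=> e0; have /Fc[T FT] : 0 < e%:C :> R[i] by rewrite ltcR.
  by exists T; apply: filterS FT => S /rball.
have Fx (x : H) : cvg ((fun T : bop => T x) @ F).
  apply: cauchy_cvg; apply: cauchy_exP => _ /gtC0E[e e0 ->].
  have d0 : 0 < rnorm x + 1 by rewrite ltr_wpDl ?rnorm_ge0.
  have [T FT] := Fball (e / (rnorm x + 1)) (divr_gt0 e0 d0).
  exists (T x); change (F (fun S : bop => ball (T x) e%:C (S x))).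
  apply: filterS FT => S TS; apply/rball.
  have -> : T x - S x = (T - S) x by rewrite bop_addE bop_oppE.
  apply: (le_lt_trans (opnormP _ _)).
  apply: (@le_lt_trans _ _ (opnorm (T - S) * (rnorm x + 1))).
    by rewrite ler_wpM2l ?opnorm_ge0// lerDl.
  by rewrite -ltr_pdivlMr.
pose g (x : H) : H := lim ((fun T : bop => T x) @ F).
have gap (T : bop) (e : R) : F (fun S => opnorm (T - S) < e) ->
    forall x, rnorm (T x - g x) <= e * rnorm x.
  move=> FT x; apply/ler_addgt0Pr => d d0.
  have dC0 : 0 < d%:C :> R[i] by rewrite ltcR.
  have /cvgrPdist_lt/(_ _ dC0) Fg := Fx x.
  have [S [TS Sg]] := filter_ex (filterI FT Fg).
  have -> : T x - g x = (T - S) x - (g x - S x).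
    by rewrite bop_addE bop_oppE opprB addrA subrK.
  rewrite (le_trans (rnormD _ _))// lerD//; last first.
    by rewrite rnormN ltW// -ltcR -rnormE.
  rewrite (le_trans (opnormP _ _))//.
  by rewrite ler_wpM2r ?rnorm_ge0// ltW.
have glin : linear g.
  move=> c x y; apply/eqP; rewrite -subr_eq0; apply/eqP/rnorm0_eq0/eqP.
  rewrite eq_le rnorm_ge0 andbT.
  pose K := rnorm (c *: x + y) + (cabs c * rnorm x + rnorm y).
  have K0 : 0 <= K.
    by rewrite !addr_ge0 ?rnorm_ge0// mulr_ge0 ?cabs_ge0 ?rnorm_ge0.
  apply/ler_addgt0Pr => d d0; rewrite add0r.
  have K10 : 0 < K + 1 by rewrite ltr_wpDl.
  have [T /gap Tg] := Fball (d / (K + 1)) (divr_gt0 d0 K10).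
  have -> : g (c *: x + y) - (c *: g x + g y) =
      - (T (c *: x + y) - g (c *: x + y)) + (c *: (T x - g x) + (T y - g y)).
    rewrite bopD bopZ scalerBr opprB [c *: T x - _ + _]addrACA -opprD.
    by rewrite addrA subrK.
  apply: (@le_trans _ _ (d / (K + 1) * K)).
    rewrite (le_trans (rnormD _ _))// rnormN mulrDr lerD//.
    rewrite (le_trans (rnormD _ _))// mulrDr lerD// rnormZ mulrCA.
    by rewrite ler_wpM2l ?cabs_ge0.
  by rewrite mulrAC ler_pdivrMr// ler_wpM2l ?lerDl// ltW.
have gbnd : exists M : R, forall x, rnorm (g x) <= M * rnorm x.
  have [T /gap Tg] := Fball 1 ltr01.
  exists (opnorm T + 1) => x; rewrite mulrDl.
  have -> : g x = T x - (T x - g x) by rewrite subKr.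
  by rewrite (le_trans (rnormD _ _))// rnormN lerD// opnormP.
apply/cvg_ex; exists (mkbop glin gbnd).
apply/cvgrPdist_le => _/gtC0E[e e0 ->].
have [T FT] := Fball (e / 2) (divr_gt0 e0 (ltr0Sn _ 1)).
near=> S; rewrite bop_normE lecR.
have -> : mkbop glin gbnd - S = - (T - mkbop glin gbnd) + (T - S).
  by rewrite opprB addrA subrK.
apply: opnorm_le => [|x]; first exact: ltW.
rewrite bop_addE (le_trans (rnormD _ _))// [e]splitr mulrDl lerD//.
  by rewrite bop_oppE rnormN bop_addE bop_oppE/= gap.
rewrite (le_trans (opnormP _ _))// ler_wpM2r ?rnorm_ge0// ltW//.
by near: S; exact: FT.
Unshelve. all: by end_near. Qed.

HB.instance Definition _ := Uniform_isComplete.Build bop bop_complete.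

End Bop.

Section Riesz.
Variables (R : realType) (H : hilbertType R).
Implicit Types x y z : H.

Definition rdot x y : R := complex.Re (dotp x y).

Lemma rdotC x y : rdot x y = rdot y x.
Proof. by rewrite /rdot dotpC; case: (dotp y x). Qed.
Lemma rdotDl x y z : rdot (x + y) z = rdot x z + rdot y z.
Proof. by rewrite /rdot dotpDl raddfD. Qed.
Lemma rdotDr x y z : rdot x (y + z) = rdot x y + rdot x z.
Proof. by rewrite rdotC rdotDl !(rdotC _ x). Qed.
Lemma rdotZl (t : R) x y : rdot (t%:C *: x) y = t * rdot x y.
Proof. by rewrite /rdot dotpZl; case: (dotp x y) => a b /=; rewrite mul0r subr0. Qed.
Lemma rdotZr (t : R) x y : rdot x (t%:C *: y) = t * rdot x y.
Proof. by rewrite rdotC rdotZl rdotC. Qed.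
Lemma rdotxx x : rdot x x = rnorm x ^+ 2.
Proof. by rewrite /rdot dotpxx rnormE -rmorphXn. Qed.

Lemma rnormDsq x y : rnorm (x + y) ^+ 2 = rnorm x ^+ 2 + 2 * rdot x y + rnorm y ^+ 2.
Proof.
rewrite -!rdotxx rdotDl !rdotDr (rdotC y x); ring.
Qed.

Lemma rdot_le x y : rdot x y <= rnorm x * rnorm y.
Proof.
have : rnorm (x + y) ^+ 2 <= (rnorm x + rnorm y) ^+ 2.
  by rewrite lerXn2r ?nnegrE ?addr_ge0 ?rnorm_ge0 ?rnormD.
by rewrite rnormDsq; nra.
Qed.

Lemma dotpDr x y z : dotp x (y + z) = dotp x y + dotp x z.
Proof. by rewrite dotpC dotpDl [LHS]rmorphD (dotpC x y) (dotpC x z). Qed.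
Lemma dotpZr (c : R[i]) x y : dotp x (c *: y) = Num.conj c * dotp x y.
Proof. by rewrite dotpC dotpZl [LHS]rmorphM (dotpC x y). Qed.

Lemma dotp_le x y : cabs (dotp x y) <= rnorm x * rnorm y.
Proof.
set a := cabs _.
have a0 : 0 <= a := cabs_ge0 _.
have : rdot (Num.conj (dotp x y) *: x) y <= a * rnorm x * rnorm y.
  by rewrite (le_trans (rdot_le _ _))// rnormZ cabsJ.
rewrite /rdot dotpZl mulrC -normCK cabsE -rmorphXn/= -/a -mulrA expr2.
have [->|an0] := eqVneq a 0; first by rewrite mulr_ge0 ?rnorm_ge0.
by rewrite ler_pM2l// lt_neqAle eq_sym an0.
Qed.

Lemma dotp_inj x y : (forall z, dotp z x = dotp z y) -> x = y.
Proof.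
move=> xy; apply/eqP; rewrite -subr_eq0; apply/eqP/rnorm0_eq0.
have : rnorm (x - y) ^+ 2 = 0.
  rewrite -rdotxx /rdot dotpDr -scaleN1r dotpZr xy rmorphN1 mulN1r subrr//.
by move/eqP; rewrite expf_eq0 => /eqP.
Qed.

Lemma riesz (f : H -> R[i]) :
  (forall x y, f (x + y) = f x + f y) -> (forall c x, f (c *: x) = c * f x) ->
  (exists M : R, forall x, cabs (f x) <= M * rnorm x) ->
  exists u, forall x, f x = dotp x u.
Proof.
move=> fD fZ [M0 fM0].
pose M := Num.max 0 M0; have Mge0 : 0 <= M by rewrite le_max lexx.
pose r x := complex.Re (f x).
have rD x y : r (x + y) = r x + r y by rewrite /r fD raddfD.
have rZ (t : R) x : r (t%:C *: x) = t * r x.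
  by rewrite /r fZ; case: (f x) => a b /=; rewrite mul0r subr0.
have rM x : r x <= M * rnorm x.
  have : r x <= cabs (f x).
    rewrite -lecR -cabsE; apply: le_trans (normc_ge_Re _).
  by rewrite lecR ler_norm.
  move/le_trans; apply; apply: (le_trans (fM0 x)).
  by rewrite ler_wpM2r ?rnorm_ge0// le_max lexx orbT.
pose Q x := rnorm x ^+ 2 - 2 * r x.
have Qinf : has_inf (range Q).
  split; first by exists (Q 0), 0.
  exists (- M ^+ 2) => _ [x _ <-]; rewrite /Q.
  have := rM x; have := sqr_ge0 (rnorm x - M); nra.
pose m := inf (range Q).
have mQ x : m <= Q x by apply: (ge_inf Qinf.2); exists x.
have rh x : r ((2^-1)%:C *: x) = 2^-1 * r x by rewrite rZ.
have par x y : rnorm (x - y) ^+ 2 <= 2 * (Q x - m) + 2 * (Q y - m).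
  have := mQ ((2^-1)%:C *: (x + y)).
  rewrite /Q rh rD -rdotxx rdotZl rdotC rdotZl rdotxx !rnormDsq rnormN.
  have -> : rdot x (- y) = - rdot x y.
    rewrite rdotC -scaleN1r -[- 1]/(- (1%:C)) -rmorphN rdotZl mulN1r.
    by rewrite rdotC.
  by nra.
have ex n : exists x, Q x < m + n.+1%:R^-1.
  have n0 : 0 < n.+1%:R^-1 :> R by rewrite invr_gt0 ltr0Sn.
  by have [_ [x _ <-] xm] := inf_adherent n0 Qinf; exists x.
have [v vm] := choice ex.
have small (e : R) : 0 < e -> exists N, N.+1%:R^-1 < e.
  move=> e0; exists (Num.truncn e^-1).
  by rewrite -[ltRHS]invrK ltf_pV2 ?posrE ?invr_gt0// truncnS_gt.
have tail N n : (N <= n)%N -> Q (v n) - m < N.+1%:R^-1.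
  move=> Nn; rewrite ltrBlDl (lt_le_trans (vm n))// lerD2l.
  by rewrite lef_pV2 ?posrE ?ltr0Sn// ler_nat.
have vc : cvg (v @ \oo).
  apply: cauchy_cvg; apply: cauchy_exP => _ /gtC0E[e e0 ->].
  have [N Ne] := small (e ^+ 2 / 4) (divr_gt0 (exprn_gt0 2 e0) (ltr0Sn _ 3)).
  exists (v N), N => // n /= Nn; apply/rball.
  rewrite -(@ltr_pXn2r _ 2) ?nnegrE ?rnorm_ge0 ?ltW//.
  apply: (le_lt_trans (par _ _)).
  move: Ne (tail N N (leqnn N)) (tail N n Nn).
  move: (N.+1%:R^-1) (Q (v N) - m) (Q (v n) - m) (e ^+ 2) => q a b e2.
  lra.
pose u : H := lim (v @ \oo).
have Qu : Q u <= m.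
  pose K := 4 + 2 * rnorm u + 2 * M.
  have K0 : 0 < K.
    by rewrite /K -addrA ltr_pwDl// addr_ge0// mulr_ge0// rnorm_ge0.
  apply/ler_addgt0Pr => d d0.
  pose e := Num.min 1 (d / K).
  have e0 : 0 < e by rewrite lt_min ltr01 divr_gt0.
  have e1 : e <= 1 by rewrite ge_min lexx.
  have eK : e * K <= d by rewrite -ler_pdivlMr// ge_min lexx orbT.
  have eC0 : 0 < e%:C :> R[i] by rewrite ltcR.
  have /cvgrPdist_lt/(_ _ eC0)[N1 _ N1P] := vc.
  have [N2 N2P] := small e e0.
  pose n := maxn N1 N2.
  have w1 : rnorm (u - v n) < e.
    by rewrite -ltcR -rnormE; apply: N1P; rewrite /= leq_maxl.
  have w2 : Q (v n) - m < e.
    by apply: (lt_trans (tail N2 n (leq_maxr _ _))).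
  have uE : u = v n + (u - v n) by rewrite addrC subrK.
  have vE : v n = u - (u - v n) by rewrite subKr.
  set w := u - v n in w1 uE vE *.
  have vu : rnorm (v n) <= rnorm u + rnorm w.
    by rewrite vE (le_trans (rnormD _ _))// rnormN.
  have cs := rdot_le (v n) w.
  have rw := rM (- w).
  have rNw : r (- w) = - r w.
    rewrite -scaleN1r -[- 1]/(- (1%:C)) -rmorphN rZ; ring.
  rewrite rNw rnormN in rw.
  have w0 := rnorm_ge0 w; have u0 := rnorm_ge0 u; have v0 := rnorm_ge0 (v n).
  have Quv : Q u = Q (v n) + 2 * rdot (v n) w + rnorm w ^+ 2 - 2 * r w.
    by rewrite {1}uE /Q rnormDsq rD; ring.
  have p1 : rnorm (v n) * rnorm w <= (rnorm u + 1) * e.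
    by apply: ler_pM => //; [lra|exact: ltW].
  have p2 : M * rnorm w <= M * e by rewrite ler_wpM2l// ltW.
  have p3 : rnorm w ^+ 2 <= e.
    rewrite expr2 -[leRHS]mul1r ler_pM//; [lra|exact: ltW].
  rewrite Quv; move: eK; rewrite /K; lra.
have var z : rdot u z = r z.
  apply/eqP; rewrite -subr_eq0; apply/eqP.
  set b := _ - _; set c := rnorm z ^+ 2.
  have c0 : 0 <= c by rewrite sqr_ge0.
  have c10 : 0 < c + 1 by rewrite ltr_wpDl.
  have q (t : R) : 0 <= 2 * t * b + t ^+ 2 * c.
    have := le_trans Qu (mQ (u + t%:C *: z)).
    rewrite /Q rnormDsq rD rZ rdotZr -[rnorm (_ *: _) ^+ 2]rdotxx.
    rewrite rdotZl rdotZr rdotxx -/c /b; lra.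
  have := q (- b / (c + 1)).
  have -> : 2 * (- b / (c + 1)) * b + (- b / (c + 1)) ^+ 2 * c =
     - (b ^+ 2 * ((c + 2) / (c + 1) ^+ 2)).
    field; exact: lt0r_neq0.
  rewrite oppr_ge0 pmulr_lle0; last first.
    by rewrite divr_gt0 ?exprn_gt0// ltr_wpDl.
  by move=> b0; apply/eqP; rewrite -sqrf_eq0 eq_le b0 sqr_ge0.
exists u => x; have := var x; have := var ('i *: x).
rewrite /r fZ (rdotC u ('i *: x)) (rdotC u x) /rdot dotpZl.
case: (f x) (dotp x u) => [a b] [c d] /=.
rewrite !mul0r !mul1r !add0r => /oppr_inj -> ->.
by [].
Qed.

End Riesz.

Section Adjoint.
Variables (R : realType) (H : hilbertType R).
Implicit Types S T : bop H.

Lemma adjoint_exists T : exists S, forall x y, dotp (T x) y = dotp x (S y).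
Proof.
have /choice[s sP] : forall y, exists u, forall x, dotp (T x) y = dotp x u.
  move=> y; apply: (@riesz _ H (fun x => dotp (T x) y)).
  - by move=> x z; rewrite bopD dotpDl.
  - by move=> c x; rewrite bopZ dotpZl.
  - exists (opnorm T * rnorm y) => x; rewrite (le_trans (dotp_le _ _))//.
    by rewrite mulrAC ler_wpM2r ?rnorm_ge0 ?opnormP.
have slin : linear s.
  move=> c x y; apply: dotp_inj => z.
  by rewrite -sP !dotpDr !dotpZr !sP.
have sbnd : exists M : R, forall x, rnorm (s x) <= M * rnorm x.
  exists (opnorm T) => y.
  have : rnorm (s y) ^+ 2 <= opnorm T * rnorm (s y) * rnorm y.
    rewrite -rdotxx /rdot -sP.
    apply: (le_trans (rdot_le (T (s y)) y)).
    by rewrite ler_wpM2r ?rnorm_ge0 ?opnormP.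
  have [->|s0] := eqVneq (rnorm (s y)) 0.
    by move=> _; rewrite mulr_ge0 ?rnorm_ge0 ?opnorm_ge0.
  rewrite expr2 mulrAC ler_pM2r// lt_neqAle eq_sym s0 rnorm_ge0//.
by exists (mkbop slin sbnd).
Qed.

Definition adjoint T : bop H := sval (cid (adjoint_exists T)).

Lemma adjointP T x y : dotp (T x) y = dotp x (adjoint T y).
Proof. by rewrite /adjoint; case: cid. Qed.

Definition bop_comp S T : bop H.
Proof.
refine (@mkbop _ _ (fun x => S (T x)) _ _).
  by move=> c x y; rewrite !bop_linear.
exists (opnorm S * opnorm T) => x.
by rewrite (le_trans (opnormP _ _))// -mulrA ler_wpM2l ?opnorm_ge0 ?opnormP.
Defined.

Definition bop_id : bop H.
Proof.
refine (@mkbop _ _ (fun x => x) _ _) => //.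
by exists 1 => x; rewrite mul1r.
Defined.

Lemma adjoint_uniq T S : (forall x y, dotp (T x) y = dotp x (S y)) -> adjoint T = S.
Proof.
by move=> TS; apply: bop_inj => y; apply: dotp_inj => x; rewrite -adjointP.
Qed.

Lemma bop_compA : associative bop_comp.
Proof. by move=> S T U; apply: bop_inj. Qed.
Lemma bop_compDl : left_distributive bop_comp +%R.
Proof. by move=> S T U; apply: bop_inj. Qed.
Lemma bop_compDr : right_distributive bop_comp +%R.
Proof. by move=> S T U; apply: bop_inj => x /=; rewrite bopD. Qed.
Lemma bop_compZl (c : R[i]) S T : bop_comp (c *: S) T = c *: bop_comp S T.
Proof. by apply: bop_inj. Qed.
Lemma bop_compZr (c : R[i]) S T : bop_comp S (c *: T) = c *: bop_comp S T.
Proof. by apply: bop_inj => x /=; rewrite bopZ. Qed.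
Lemma adjointK : involutive adjoint.
Proof.
by move=> T; apply: adjoint_uniq => x y; rewrite dotpC -adjointP -dotpC.
Qed.
Lemma adjointD : {morph adjoint : S T / S + T}.
Proof.
move=> S T; apply: adjoint_uniq => x y.
by rewrite !bop_addE dotpDl dotpDr !adjointP.
Qed.
Lemma adjointZ (c : R[i]) T : adjoint (c *: T) = Num.conj c *: adjoint T.
Proof.
apply: adjoint_uniq => x y.
by rewrite !bop_scaleE dotpZl dotpZr conjCK adjointP.
Qed.
Lemma adjointM S T : adjoint (bop_comp S T) = bop_comp (adjoint T) (adjoint S).
Proof. by apply: adjoint_uniq => x y /=; rewrite !adjointP. Qed.

Lemma opnorm_comp S T : opnorm (bop_comp S T) <= opnorm S * opnorm T.
Proof.
apply: opnorm_le => [|x]; first by rewrite mulr_ge0 ?opnorm_ge0.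
by rewrite /= (le_trans (opnormP _ _))// -mulrA ler_wpM2l ?opnorm_ge0 ?opnormP.
Qed.

Lemma opnorm_sq T : opnorm T ^+ 2 <= opnorm (bop_comp (adjoint T) T).
Proof.
set N := opnorm (bop_comp _ _); have N0 : 0 <= N := opnorm_ge0 _.
rewrite -[leRHS](sqr_sqrtr N0) lerXn2r ?nnegrE ?opnorm_ge0 ?sqrtr_ge0//.
apply: opnorm_le => [|x]; first exact: sqrtr_ge0.
rewrite -(@ler_pXn2r _ 2) ?nnegrE ?mulr_ge0 ?rnorm_ge0 ?sqrtr_ge0//.
rewrite exprMn sqr_sqrtr// -rdotxx /rdot adjointP.
apply: (le_trans (rdot_le x (bop_comp (adjoint T) T x))).
by rewrite mulrC expr2 mulrA ler_wpM2r ?rnorm_ge0 ?opnormP.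
Qed.

Lemma opnorm_adj_le T : opnorm T <= opnorm (adjoint T).
Proof.
have [T0|T0] := eqVneq (opnorm T) 0; first by rewrite T0 opnorm_ge0.
have Tp : 0 < opnorm T by rewrite lt_neqAle eq_sym T0 opnorm_ge0.
rewrite -(ler_pM2r Tp) -expr2.
exact: le_trans (opnorm_sq T) (opnorm_comp _ _).
Qed.

Lemma opnorm_adj T : opnorm (adjoint T) = opnorm T.
Proof.
apply/eqP; rewrite eq_le opnorm_adj_le andbT.
by have := opnorm_adj_le (adjoint T); rewrite adjointK.
Qed.

Lemma bop_norm_comp S T : `|bop_comp S T| <= `|S| * `|T|.
Proof. by rewrite !bop_normE -rmorphM/= lecR opnorm_comp. Qed.

Lemma bop_norm_cstar T : `|bop_comp (adjoint T) T| = `|T| ^+ 2.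
Proof.
rewrite !bop_normE -rmorphXn/=; congr (_%:C); apply/eqP; rewrite eq_le opnorm_sq.
by rewrite andbT (le_trans (opnorm_comp _ _))// opnorm_adj expr2.
Qed.

HB.instance Definition _ := isCstarAlgebra.Build R (bop H)
  bop_compA bop_compDl bop_compDr bop_compZl bop_compZr
  adjointK adjointD adjointZ adjointM bop_norm_comp bop_norm_cstar.

End Adjoint.

(* A C*-algebra is handled as a norm-closed *-subalgebra S of an ambient
   C*-algebra A; the case S = setT is that of A itself.  Maps out of S are total
   functions on A, of which only the values on S matter. *)
Section CstarNotions.
Variable R : realType.
Implicit Types A B : cstarAlgType R.

Definition cstar_subalgebra A (S : set A) : Prop :=
  [/\ S 0,
      forall (c : R[i]) a b, S a -> S b -> S (c *: a + b),
      forall a b, S a -> S b -> S (cmul a b),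
      forall a, S a -> S (cstar a)
    & closed S].

Definition closed_ideal A (S I : set A) : Prop :=
  [/\ I `<=` S,
      I 0,
      forall (c : R[i]) a b, I a -> I b -> I (c *: a + b),
      forall a b, S a -> I b -> I (cmul a b) /\ I (cmul b a)
    & closed I].

Definition simple_cstar A (S : set A) : Prop :=
  forall I, closed_ideal S I -> I = [set 0] \/ I = S.

Definition star_morphism A B (S : set A) (f : A -> B) : Prop :=
  [/\ forall (c : R[i]) a b, S a -> S b -> f (c *: a + b) = c *: f a + f b,
      forall a b, S a -> S b -> f (cmul a b) = cmul (f a) (f b)
    & forall a, S a -> f (cstar a) = cstar (f a)].

Definition closed_subspace (K : hilbertType R) (M : set K) : Prop :=
  [/\ M 0,
      forall (c : R[i]) x y, M x -> M y -> M (c *: x + y)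
    & closed M].

Definition irreducible_repr A (S : set A) (K : hilbertType R)
    (rho : A -> bop K) : Prop :=
  [/\ star_morphism S rho,
      exists2 a, S a & rho a <> 0
    & forall M : set K, closed_subspace M ->
        (forall a x, S a -> M x -> M (rho a x)) -> M = [set 0] \/ M = setT].

Definition compact_operator (K : hilbertType R) (T : bop K) : Prop :=
  compact (closure [set T x | x in [set x : K | `|x| <= 1]]).

(* Also used for S a closed two-sided ideal, which is a C*-algebra because it is
   automatically closed under cstar. *)
Definition ccr A (S : set A) : Prop :=
  forall (K : hilbertType R) (rho : A -> bop K), irreducible_repr S rho ->
    forall a, S a -> compact_operator (rho a).

(* B, together with the canonical surjection q : S -> B whose kernel is J, is the
   quotient C*-algebra S / J (the quotient norm is then automatically that
   of B). *)
Definition is_quotient A (S J : set A) B (Q : set B) (q : A -> B) : Prop :=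
  [/\ star_morphism S q, q @` S = Q & forall a, S a -> q a = 0 <-> J a].

Definition gcr A (S : set A) : Prop :=
  forall J : set A, closed_ideal S J -> J <> S ->
  forall B (Q : set B) (q : A -> B), cstar_subalgebra Q -> is_quotient S J Q q ->
  exists I : set B, [/\ closed_ideal Q I, I <> [set 0] & ccr I].

Definition cstar_generated (H : hilbertType R) (T : bop H) : set (bop H) :=
  smallest (@cstar_subalgebra (bop H)) [set T; bop_id H].

Definition gcr_operator (H : hilbertType R) (T : bop H) : Prop :=
  gcr (cstar_generated T).

Definition orthonormal_basis (H : hilbertType R) (e : nat -> H) : Prop :=
  (forall m n, dotp (e m) (e n) = (m == n)%:R) /\
  (forall x, series (fun n => dotp x (e n) *: e n) @ \oo --> x).

End CstarNotions.

Section RandomShift.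
Context (R : realType) (d : measure_display) (Omega : measurableType d)
  (P : probability Omega R).
Implicit Type X : nat -> {RV P >-> R}.

Definition mutually_independent X : Prop :=
  forall (J : {fset nat}) (B : nat -> set R), (forall i, measurable (B i)) ->
    P (\bigcap_(i in [set` J]) (X i @^-1` B i)) =
    (\prod_(i <- J) P (X i @^-1` B i))%E.

Definition identically_distributed X : Prop :=
  forall n (B : set R), measurable B ->
    distribution P (X n) B = distribution P (X 0%N) B.

(* Closed support of the law of Y. *)
Definition essran (Y : {RV P >-> R}) : set R :=
  [set x | forall U : set R, open U -> U x -> (0 < distribution P Y U)%E].

(* T w is the weighted shift with weights X n w for almost every w: bounded
   identically distributed X n have a common bound only off a null set, so the
   weighted shift need not be a bounded operator for every w.  Basis vectors are
   numbered from 0. *)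
Definition random_weighted_shift (H : hilbertType R) (e : nat -> H) X
    (T : Omega -> bop H) : Prop :=
  {ae P, forall w, forall n, T w (e n) = (X n w)%:C *: e n.+1}.

(* E belongs to the completion of the sigma-algebra with respect to P, and has
   probability p there; for measurable E this says P E = p. *)
Definition has_probability (E : set Omega) (p : R) : Prop :=
  exists A B : set Omega, [/\ measurable A, measurable B, A `<=` E, E `<=` B
    & P A = p%:E /\ P B = p%:E].

End RandomShift.

(* Main.v *)
Require Import Defs.
From mathcomp Require Import all_boot all_order all_algebra.
From mathcomp Require Import finmap complex ring lra zify.
From mathcomp Require Import all_classical all_reals all_analysis.
Set Implicit Arguments.
Unset Strict Implicit.
Unset Printing Implicit Defensive.
Import Order.TTheory GRing.Theory Num.Theory numFieldNormedType.Exports.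
Local Open Scope classical_set_scope.
Local Open Scope ring_scope.
Local Open Scope complex_scope.

(** The law of the weights is carried by its support [essran (X 0)], and by
    independence almost every sequence of weights approximates each finite
    word with letters in the support, somewhere and with any precision
    ([ae_essran], [ae_windows]).  This turns both statements into
    deterministic ones about a weighted shift [T] with weights [a].

    Limits.  If windows of [a] of growing length approximate a bilateral
    sequence [w], the corresponding compressions of the elements of [C*(T)]
    converge, and the limit is a *-morphism of [C*(T)] sending [T] to the
    bilateral shift [V] with weights [w] and the unit to the unit
    ([window_limit]).  Its image is closed ([closed_image]), so [C*(V)] is a
    quotient of [C*(T)].

    Simplicity.  If all weights are [0], then [C*(T)] consists of the scalars.
    Otherwise take for [w] a nonzero constant of the support.  Then [V] is a
    multiple of a unitary, so the kernel of the limit morphism contains the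
    self-commutator of [T]; this is not zero, and the kernel does not contain
    the unit ([shift_not_simple]).

    Two nonzero values [alpha] and [beta] in the support.  Take for [w] a
    sequence of letters [alpha] and [beta] which is aperiodic and recurrent.
    Aperiodicity makes [C*(V)] irreducible ([ruler_shift_irreducible]);
    recurrence makes its elements asymptotically commute with translations
    going to infinity, so that it contains no nonzero compact operator
    ([ruler_shift_no_compact]).  A nonzero ideal of [C*(V)] is then
    irreducible as well and contains a noncompact operator, hence is not CCR,
    and [T] is not GCR ([shift_not_gcr]).

    At most one nonzero value [lam].  Then [T] is [lam] times a direct sum of
    unilateral shifts, truncated or not, and the projections [1 - T T^* / lam^2] on the first
    vectors of the summands and [1 - T^* T / lam^2] on the last ones are
    abelian: they cut [C*(T)] down to a commutative algebra.  In any nonzero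
    quotient either one of them survives, or the image of [T] is a multiple
    of a unitary and the unit is abelian.  The closed ideal generated by a
    nonzero abelian projection [p] is CCR ([abelian_projection_ccr]), because
    [p] has rank one in every irreducible representation, so [T] is GCR
    ([two_weights_gcr]).

    The C*-algebra theory used on the way rests on one device: the equation
    [(1 - y)^2 = 1 - x] is solved by an iteration when [|x| <= 1]
    ([cstar_sqrt]).  It yields the contractivity of *-morphisms and the
    absolute values needed for Schur's lemma. *)

(** * Linear rearrangements *)

(** Formal sums, with which identities between sums and differences of
    vectors are decided by comparing coefficients. *)
Inductive zsum := ZVar of nat | ZAdd of zsum & zsum | ZOpp of zsum | ZZero.

Fixpoint zeval (V : zmodType) (env : seq V) (t : zsum) : V :=
  match t with
  | ZVar n => nth 0 env n
  | ZAdd s t => zeval env s + zeval env t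
  | ZOpp t => - zeval env t
  | ZZero => 0
  end.

Fixpoint zcoef (t : zsum) (k : nat) : int :=
  match t with
  | ZVar n => if n == k then 1 else 0
  | ZAdd s t => zcoef s k + zcoef t k
  | ZOpp t => - zcoef t k
  | ZZero => 0
  end.

Lemma zevalE (V : zmodType) (env : seq V) t :
  zeval env t = \sum_(k < size env) nth 0 env k *~ zcoef t k.
Proof.
elim: t => [n|s IHs t IHt|t IHt|] /=.
- have [nlt|nge] := ltnP n (size env).
    rewrite (bigD1 (Ordinal nlt))//= eqxx mulr1z big1 ?addr0// => k kn.
    by rewrite ifN//; apply: contraNneq kn => nk; apply/eqP/val_inj.
  rewrite nth_default// big1// => k _; rewrite ifN//.
  by apply: contraTneq (ltn_ord k) => <-; rewrite -leqNgt.
- by rewrite IHs IHt -big_split; apply: eq_bigr => k _; rewrite mulrzDr.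
- by rewrite IHt -sumrN; apply: eq_bigr => k _; rewrite mulrNz.
- by rewrite big1// => k _; rewrite mulr0z.
Qed.

Lemma zeval_eq (V : zmodType) (env : seq V) s t :
  all (fun k => zcoef s k == zcoef t k) (iota 0 (size env)) ->
  zeval env s = zeval env t.
Proof.
move=> /allP st; rewrite !zevalE; apply: eq_bigr => k _; congr (_ *~ _).
by apply/eqP/st; rewrite mem_iota add0n /= ltn_ord.
Qed.

(** Rewriting leaves behind terms that differ only by the way their algebraic
    structures are inferred; conversion is tried on these alone, as trying it
    on all pairs of atoms would be slow. *)
Ltac same_head f g :=
  lazymatch f with
  | ?f' _ => lazymatch g with ?g' _ => same_head f' g' end
  | _ => constr_eq f g
  end.
Ltac same_atom x y :=
  first
    [ constr_eq x y
    | lazymatch x with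
      | ?f ?a => lazymatch y with
        | ?g ?b => same_atom a b;
          first [same_atom f g | same_head f g; unify f g]
        end
      end ].

Ltac zmod_index x env :=
  match env with
  | (?y :: _) => let _ := match O with _ => same_atom x y end in constr:(0%N)
  | (_ :: ?env') => let n := zmod_index x env' in constr:(S n)
  end.
Ltac zmod_atoms t env :=
  lazymatch t with
  | (?a + ?b)%R => let e := zmod_atoms a env in zmod_atoms b e
  | (- ?a)%R => zmod_atoms a env
  | 0%R => env
  | _ => match env with
         | _ => let n := zmod_index t env in env
         | _ => constr:(t :: env)
         end
  end.
Ltac zmod_quote t env :=
  lazymatch t with
  | (?a + ?b)%R => let a' := zmod_quote a env in let b' := zmod_quote b env in
                   constr:(ZAdd a' b')
  | (- ?a)%R => let a' := zmod_quote a env in constr:(ZOpp a')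
  | 0%R => constr:(ZZero)
  | _ => let n := zmod_index t env in constr:(ZVar n)
  end.
Ltac zmodule :=
  lazymatch goal with
  | |- @eq ?V ?a ?b =>
    let e0 := zmod_atoms a (@nil V) in
    let e := zmod_atoms b e0 in
    let a' := zmod_quote a e in
    let b' := zmod_quote b e in
    apply: (@zeval_eq _ e a' b'); vm_compute; reflexivity
  end.


(** * Sequences and closed sets in normed modules *)

Section NormedSequences.
Context {R : realType}.

Lemma cvg_rnormP (V : normedModType R[i]) (u : nat -> V) (l : V) :
  (u @ \oo --> l) <->
  (forall e : R, 0 < e -> exists N, forall n, (N <= n)%N -> rnorm (u n - l) < e).
Proof.
split.
- move=> /cvgrPdist_lt ul e e0.
  have e0' : 0 < e%:C :> R[i] by rewrite ltcR.
  have [N _ NP] := ul _ e0'; exists N => n Nn.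
  by rewrite -rnormN opprB -ltcR -rnormE; exact: NP.
- move=> ul; apply/cvgrPdist_lt => _ /gtC0E[e e0 ->].
  have [N NP] := ul e e0; exists N => // n /= Nn.
  by rewrite rnormE ltcR -rnormN opprB; exact: NP.
Qed.

Lemma rnorm_closedP (V : normedModType R[i]) (S : set V) :
  closed S <->
  (forall x, (forall e : R, 0 < e -> exists2 y, S y & rnorm (x - y) < e) -> S x).
Proof.
split.
- move=> cS x xS; apply: cS => B /nbhs_ballP[_ /gtC0E[e e0 ->]] eB.
  have [y Sy xy] := xS e e0; exists y; split => //; apply: eB.
  exact/rball.
- move=> H x clx; apply: H => e e0.
  have : nbhs x (ball x e%:C) by apply: nbhsx_ballx; rewrite ltcR.
  by move=> /clx[y [Sy /rball xy]]; exists y.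
Qed.

Lemma cvg_closed (V : normedModType R[i]) (S : set V) (u : nat -> V) l :
  closed S -> (forall n, S (u n)) -> u @ \oo --> l -> S l.
Proof.
move=> /rnorm_closedP cS Su /cvg_rnormP ul; apply: cS => e /ul[N NP].
by exists (u N) => //; rewrite -rnormN opprB; exact: NP.
Qed.

Lemma cauchy_rnorm_cvg (V : completeNormedModType R[i]) (u : nat -> V) :
  (forall e : R, 0 < e -> exists N, forall n, (N <= n)%N -> rnorm (u N - u n) < e) ->
  exists l : V, u @ \oo --> l.
Proof.
move=> H; suff uc : cvg (u @ \oo) by exists (lim (u @ \oo)).
apply: cauchy_cvg; apply: cauchy_exP => _ /gtC0E[e e0 ->].
have [N NP] := H e e0; exists (u N), N => // n /= Nn; apply/rball; exact: NP.
Qed.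

(** By telescoping, two terms are at most as far apart as the values of [t],
    a bounded monotone sequence. *)
Lemma dominated_steps_cvg (V : completeNormedModType R[i]) (u : nat -> V)
    (t : nat -> R) (C : R) :
  (forall n, rnorm (u n.+1 - u n) <= t n.+1 - t n) -> (forall n, t n <= C) ->
  exists l : V, u @ \oo --> l.
Proof.
move=> ut tC.
have tmono : nondecreasing_seq t.
  apply/nondecreasing_seqP => n; rewrite -subr_ge0.
  exact: le_trans (rnorm_ge0 _) (ut n).
have umn n k : rnorm (u n - u (n + k)%N) <= t (n + k)%N - t n.
  elim: k => [|k IH]; first by rewrite addn0 !subrr rnorm0.
  rewrite addnS -[u n](subrK (u (n + k)%N)) -addrA (le_trans (rnormD _ _))//.
  rewrite -[X in _ + X]rnormN opprB.
  by have := ut (n + k)%N; lra.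
have tc : cvg (t @ \oo).
  apply: nondecreasing_is_cvgn => //; exists C => _ [n _ <-]; exact: tC.
apply: cauchy_rnorm_cvg => e e0.
have /cvgrPdist_lt/(_ e e0)[N _ NP] := tc.
exists N => n Nn; rewrite -(subnKC Nn); apply: (le_lt_trans (umn _ _)).
rewrite (subnKC Nn).
have tn : t n <= lim (t @ \oo) by apply: nondecreasing_cvgn_le.
have := NP N (leqnn N); rewrite /= ltr_norml => /andP[_]; lra.
Qed.

End NormedSequences.

(** * Square roots in C*-algebras *)

Section CstarBasics.
Context {R : realType} {A : cstarAlgType R}.
Implicit Types (a b x y : A) (S : set A).

Lemma rnorm_cmul a b : rnorm (cmul a b) <= rnorm a * rnorm b.
Proof. by rewrite -lecR rmorphM/= -!rnormE norm_cmul. Qed.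

Lemma rnorm_cstar_cmul a : rnorm (cmul (cstar a) a) = rnorm a ^+ 2.
Proof. by apply: complexI; rewrite rmorphXn/= -!rnormE norm_cstar. Qed.

Lemma rnorm_cstar_le a : rnorm a <= rnorm (cstar a).
Proof.
have [->|a0] := eqVneq (rnorm a) 0; first exact: rnorm_ge0.
have ap : 0 < rnorm a by rewrite lt_neqAle eq_sym a0 rnorm_ge0.
rewrite -(ler_pM2r ap) -expr2 -rnorm_cstar_cmul; exact: rnorm_cmul.
Qed.

Lemma rnorm_cstar a : rnorm (cstar a) = rnorm a.
Proof.
apply/eqP; rewrite eq_le rnorm_cstar_le andbT.
by have := rnorm_cstar_le (cstar a); rewrite cstarK.
Qed.

Lemma cmul0l a : cmul 0 a = 0.
Proof. by have := cmulZl 0 0 a; rewrite !scale0r. Qed.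
Lemma cmul0r a : cmul a 0 = 0.
Proof. by have := cmulZr 0 a 0; rewrite !scale0r. Qed.
Lemma cmulNl a b : cmul (- a) b = - cmul a b.
Proof. by rewrite -scaleN1r cmulZl scaleN1r. Qed.
Lemma cmulNr a b : cmul a (- b) = - cmul a b.
Proof. by rewrite -scaleN1r cmulZr scaleN1r. Qed.
Lemma cmulBl a b c : cmul (a - b) c = cmul a c - cmul b c.
Proof. by rewrite cmulDl cmulNl. Qed.
Lemma cmulBr a b c : cmul a (b - c) = cmul a b - cmul a c.
Proof. by rewrite cmulDr cmulNr. Qed.
Lemma cstar0 : cstar (0 : A) = 0.
Proof. by have := cstarZ 0 (0 : A); rewrite rmorph0 !scale0r. Qed.
Lemma cstarN a : cstar (- a) = - cstar a.
Proof. by rewrite -scaleN1r cstarZ rmorphN1 scaleN1r. Qed.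
Lemma cstarB a b : cstar (a - b) = cstar a - cstar b.
Proof. by rewrite cstarD cstarN. Qed.
Lemma conjr (r : R) : Num.conj r%:C = r%:C.
Proof. by apply/CrealP/complex_realP; exists r. Qed.
Lemma cstarZr (r : R) a : cstar (r%:C *: a) = r%:C *: cstar a.
Proof. by rewrite cstarZ conjr. Qed.

End CstarBasics.
Lemma cabsr {R : realType} (r : R) : cabs r%:C = `|r|.
Proof. by apply: complexI; rewrite -cabsE normc_def /= expr0n addr0 sqrtr_sqr. Qed.

Section SquareRoot.
Context {R : realType} {A : cstarAlgType R}.
Implicit Types (a b x y : A) (S D : set A).

(** The equation says [(1 - y)^2 = 1 - x], so that [1 - y] is the square root
    of [1 - x]; it is written without the unit in order to apply to ideals.
    The iterates of [y |-> (x + y^2) / 2] are dominated by those of the scalar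
    equation with [x = 1], which increase and stay below [1]. *)
Lemma cstar_sqrt D x : closed D -> D 0 -> rnorm x <= 1 ->
  (forall y, D y -> D ((2^-1 : R)%:C *: (x + cmul y y))) ->
  exists y, [/\ D y, rnorm y <= 1 & (2 : R)%:C *: y = x + cmul y y].
Proof.
move=> cD D0 x1 DS.
pose g y := (2^-1 : R)%:C *: (x + cmul y y).
pose u n := iter n g 0.
pose t n := iter n (fun s : R => 2^-1 * (1 + s ^+ 2)) 0.
have tS n : t n.+1 = 2^-1 * (1 + t n ^+ 2) by [].
have uS n : u n.+1 = (2^-1 : R)%:C *: (x + cmul (u n) (u n)) by [].
have uD n : D (u n) by elim: n => //= n; exact: DS.
have t01 n : 0 <= t n <= 1.
  elim: n => [|n /andP[t0 t1]]; first by rewrite lexx ler01.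
  by rewrite tS; apply/andP; split; nra.
have h2 : cabs (2^-1 : R)%:C = 2^-1 :> R by rewrite cabsr ger0_norm.
have unt n : rnorm (u n) <= t n.
  elim: n => [|n IH]; first by rewrite rnorm0.
  rewrite uS tS rnormZ h2 ler_wpM2l//.
  rewrite (le_trans (rnormD _ _))// lerD// (le_trans (rnorm_cmul _ _))//.
  by rewrite expr2 ler_pM ?rnorm_ge0.
(* [y^2 - z^2 = y (y - z) + (y - z) z] needs no commutation. *)
have ustep n : rnorm (u n.+1 - u n) <= t n.+1 - t n.
  elim: n => [|n IH].
    rewrite uS tS cmul0l addr0 subr0 rnormZ h2 expr0n/= addr0 subr0.
    by rewrite ler_wpM2l.
  have -> : u n.+2 - u n.+1 = (2^-1 : R)%:C *:
      (cmul (u n.+1) (u n.+1 - u n) + cmul (u n.+1 - u n) (u n)).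
    rewrite (uS n.+1) [X in _ - X](uS n) -scalerBr cmulBr cmulBl.
    congr (_ *: _).
    zmodule.
  rewrite rnormZ h2.
  have -> : t n.+2 - t n.+1 = 2^-1 * ((t n.+1 - t n) * (t n.+1 + t n)).
    rewrite (tS n.+1) [X in _ - X = _](tS n); ring.
  rewrite ler_wpM2l// (le_trans (rnormD _ _))// mulrDr lerD//.
    rewrite (le_trans (rnorm_cmul _ _))// mulrC ler_pM ?rnorm_ge0//.
  by rewrite (le_trans (rnorm_cmul _ _))// ler_pM ?rnorm_ge0.
have [y uy] : exists l : A, u @ \oo --> l.
  by apply: (dominated_steps_cvg ustep (C := 1)) => n; case/andP: (t01 n).
have Dy : D y by exact: cvg_closed uy.
have y1 : rnorm y <= 1.
  apply/ler_addgt0Pr => e e0; move/cvg_rnormP/(_ e e0): uy => [N NP].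
  rewrite -[y](subrK (u N)) (le_trans (rnormD _ _))// addrC lerD//.
    by rewrite (le_trans (unt N))//; case/andP: (t01 N).
  by rewrite -rnormN opprB ltW// NP.
exists y; split => //.
apply/eqP; rewrite -subr_eq0; apply/eqP/rnorm0_eq0/eqP.
rewrite eq_le rnorm_ge0 andbT; apply/ler_addgt0Pr => e e0; rewrite add0r.
have e4 : 0 < e / 4 by rewrite divr_gt0.
move/cvg_rnormP/(_ _ e4): uy => [N NP].
have gE : (2 : R)%:C *: u N.+1 = x + cmul (u N) (u N).
  by rewrite uS scalerA -rmorphM/= divff// ?scale1r.
have -> : (2 : R)%:C *: y - (x + cmul y y) =
  - ((2 : R)%:C *: (u N.+1 - y)) +
   (cmul (u N) (u N - y) + cmul (u N - y) y).
  rewrite scalerBr gE cmulBr cmulBl.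
  zmodule.
rewrite (le_trans (rnormD _ _))// rnormN rnormZ cabsr ger0_norm//.
have N1 : rnorm (u N.+1 - y) < e / 4 by apply: NP.
have N0 : rnorm (u N - y) < e / 4 by apply: NP.
have p : rnorm (cmul (u N) (u N - y) + cmul (u N - y) y) <= e / 4 + e / 4.
  rewrite (le_trans (rnormD _ _))// lerD//.
    rewrite (le_trans (rnorm_cmul _ _))// -[leRHS]mul1r ler_pM ?rnorm_ge0 ?(ltW N0)//.
    by rewrite (le_trans (unt N))//; case/andP: (t01 N).
  by rewrite (le_trans (rnorm_cmul _ _))// -[leRHS]mulr1 ler_pM ?rnorm_ge0 ?(ltW N0).
lra.
Qed.

End SquareRoot.

(** * Subalgebras and *-morphisms *)

Section LinearSets.
Context {R : realType}.

Lemma scale_half (V : lmodType R[i]) (x : V) : (2^-1 : R)%:C *: (x + x) = x.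
Proof.
rewrite scalerDr -scalerDl -rmorphD.
have -> : 2^-1 + 2^-1 = 1 :> R by rewrite [RHS]splitr !mul1r.
by rewrite scale1r.
Qed.

Definition linear_set (V : lmodType R[i]) (S : set V) :=
  S 0 /\ forall (c : R[i]) a b, S a -> S b -> S (c *: a + b).

Section LinearSetTheory.
Context {V : lmodType R[i]} {S : set V}.
Hypothesis lS : linear_set S.

Lemma linear_setZ c a : S a -> S (c *: a).
Proof. by move=> Sa; rewrite -[_ *: _]addr0; apply: lS.2 => //; exact: lS.1. Qed.
Lemma linear_setD a b : S a -> S b -> S (a + b).
Proof. by move=> Sa; rewrite -[a]scale1r; exact: lS.2. Qed.
Lemma linear_setN a : S a -> S (- a).
Proof. by rewrite -scaleN1r; exact: linear_setZ. Qed.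
Lemma linear_setB a b : S a -> S b -> S (a - b).
Proof. by move=> Sa /linear_setN; exact: linear_setD. Qed.
Lemma linear_set_sum (I : Type) (r : seq I) (P : pred I) (F : I -> V) :
  (forall i, P i -> S (F i)) -> S (\sum_(i <- r | P i) F i).
Proof. by move=> SF; apply: big_ind => //; [exact: lS.1|exact: linear_setD]. Qed.
End LinearSetTheory.

Lemma subspace_linear (K : hilbertType R) (M : set K) :
  closed_subspace M -> linear_set M.
Proof. by case. Qed.

Lemma subalgebra_linear (A : cstarAlgType R) (S : set A) :
  cstar_subalgebra S -> linear_set S.
Proof. by case. Qed.

Lemma ideal_linear (A : cstarAlgType R) (S I : set A) :
  closed_ideal S I -> linear_set I.
Proof. by case. Qed.

End LinearSets.

Section Bops.
Context {R : realType} {H : hilbertType R}.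
Implicit Types (S T : bop H) (x y : H).

Lemma rnorm_bop T x : rnorm (T x) <= rnorm T * rnorm x.
Proof. exact: opnormP. Qed.
Lemma rnorm_bop_le T (M : R) : 0 <= M ->
  (forall x, rnorm (T x) <= M * rnorm x) -> rnorm T <= M.
Proof. exact: opnorm_le. Qed.
Lemma cmul_bopE S T x : cmul S T x = S (T x). Proof. by []. Qed.
Lemma dotp_cstar T x y : dotp (T x) y = dotp x (cstar T y).
Proof. exact: adjointP. Qed.
Lemma dotp_cstarl T x y : dotp (cstar T x) y = dotp x (T y).
Proof. by rewrite dotp_cstar cstarK. Qed.
Lemma bopB T x y : T (x - y) = T x - T y.
Proof. by rewrite bopD bopN. Qed.
Lemma bop_subE S T x : (S - T) x = S x - T x.
Proof. by rewrite bop_addE bop_oppE. Qed.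
Lemma bop_zeroE x : (0 : bop H) x = 0. Proof. by []. Qed.

Lemma dotp0l x : dotp 0 x = 0.
Proof. by have := dotpZl 0 0 x; rewrite scale0r mul0r. Qed.
Lemma dotp0r x : dotp x 0 = 0.
Proof. by rewrite dotpC dotp0l rmorph0. Qed.
Lemma dotpNl x y : dotp (- x) y = - dotp x y.
Proof. by rewrite -scaleN1r dotpZl mulN1r. Qed.
Lemma dotpNr x y : dotp x (- y) = - dotp x y.
Proof. by rewrite -scaleN1r dotpZr rmorphN1 mulN1r. Qed.
Lemma dotpBl x y z : dotp (x - y) z = dotp x z - dotp y z.
Proof. by rewrite dotpDl dotpNl. Qed.
Lemma dotp_suml (I : Type) (r : seq I) (P : pred I) (F : I -> H) y :
  dotp (\sum_(i <- r | P i) F i) y = \sum_(i <- r | P i) dotp (F i) y.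
Proof.
by elim/big_rec2: _ => [|i u v _ <-]; rewrite ?dotp0l ?dotpDl.
Qed.
Lemma dotp_sumr (I : Type) (r : seq I) (P : pred I) (F : I -> H) y :
  dotp y (\sum_(i <- r | P i) F i) = \sum_(i <- r | P i) dotp y (F i).
Proof.
by elim/big_rec2: _ => [|i u v _ <-]; rewrite ?dotp0r ?dotpDr.
Qed.
Lemma rdot_cstar T x y : rdot (T x) y = rdot x (cstar T y).
Proof. by rewrite /rdot dotp_cstar. Qed.
Lemma rdotNr x y : rdot x (- y) = - rdot x y.
Proof. by rewrite /rdot dotpNr raddfN. Qed.
Lemma rdotBr x y z : rdot x (y - z) = rdot x y - rdot x z.
Proof. by rewrite rdotDr rdotNr. Qed.
Lemma rnormBsq x y : rnorm (x - y) ^+ 2 = rnorm x ^+ 2 - 2 * rdot x y + rnorm y ^+ 2.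
Proof. by rewrite rnormDsq rnormN rdotNr mulrN. Qed.
Lemma dotpxx0 x : dotp x x = 0 -> x = 0.
Proof.
move=> x0; apply: rnorm0_eq0; apply/eqP; rewrite -sqrf_eq0 -rdotxx.
by rewrite /rdot x0.
Qed.

Lemma closed_bop_eval (M : set H) x : closed M -> closed [set T : bop H | M (T x)].
Proof.
move=> /rnorm_closedP cM; apply/rnorm_closedP => T HT; apply: cM => e e0.
have d0 : 0 < rnorm x + 1 by rewrite ltr_wpDl ?rnorm_ge0.
have [S MS TS] := HT _ (divr_gt0 e0 d0); exists (S x) => //.
rewrite -bop_subE (le_lt_trans (rnorm_bop _ _))//.
apply: (@le_lt_trans _ _ (rnorm (T - S) * (rnorm x + 1))).
  by rewrite ler_wpM2l ?rnorm_ge0// lerDl.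
by rewrite -ltr_pdivlMr.
Qed.

Lemma closed_preimage_bop (M : set H) T : closed M -> closed [set x : H | M (T x)].
Proof. by move=> cM; apply: closed_comp => // x _; exact: bop_continuous. Qed.

Lemma closed_dotp0 y : closed [set x : H | dotp x y = 0].
Proof.
apply/rnorm_closedP => x Hx.
suff : cabs (dotp x y) = 0.
  by move=> c0; apply/eqP; rewrite -normr_eq0 cabsE c0.
apply/eqP; rewrite eq_le cabs_ge0 andbT; apply/ler_addgt0Pr => e e0; rewrite add0r.
have d0 : 0 < rnorm y + 1 by rewrite ltr_wpDl ?rnorm_ge0.
have [z zy xz] := Hx _ (divr_gt0 e0 d0).
have -> : dotp x y = dotp (x - z) y by rewrite dotpBl zy subr0.
rewrite (le_trans (dotp_le _ _))//.
apply: (@le_trans _ _ (rnorm (x - z) * (rnorm y + 1))).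
  by rewrite ler_wpM2l ?rnorm_ge0// lerDl.
by rewrite -ler_pdivlMr// ltW.
Qed.

Lemma closed_cstar_preimage (A : cstarAlgType R) (D : set A) :
  closed D -> closed [set a | D (cstar a)].
Proof.
move=> /rnorm_closedP cD; apply/rnorm_closedP => a Ha; apply: cD => e /Ha[b Db ab].
by exists (cstar b) => //; rewrite -cstarB rnorm_cstar.
Qed.

Lemma closed_cmul_preimage (A : cstarAlgType R) (D : set A) b c :
  closed D -> closed [set a | D (cmul b (cmul a c))].
Proof.
move=> /rnorm_closedP cD; apply/rnorm_closedP => a Ha; apply: cD => e e0.
have d0 : 0 < rnorm b * rnorm c + 1 by rewrite ltr_wpDl ?mulr_ge0 ?rnorm_ge0.
have [a' Da' aa'] := Ha _ (divr_gt0 e0 d0).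
exists (cmul b (cmul a' c)) => //; rewrite -cmulBr -cmulBl.
rewrite (le_lt_trans (rnorm_cmul _ _))//.
apply: (@le_lt_trans _ _ (rnorm (a - a') * (rnorm b * rnorm c + 1))).
  rewrite mulrDr mulr1 mulrCA -[leLHS]addr0 lerD ?rnorm_ge0//.
  by rewrite ler_wpM2l ?rnorm_ge0 ?rnorm_cmul.
by rewrite -ltr_pdivlMr.
Qed.

Lemma closed_commutant (A : cstarAlgType R) (b : A) (J : set A) : closed J ->
  linear_set J -> closed [set a | J (cmul a b - cmul b a)].
Proof.
move=> /rnorm_closedP cJ lJ; apply/rnorm_closedP => a Ha; apply: cJ => e e0.
have d0 : 0 < rnorm b + rnorm b + 1.
  by rewrite ltr_wpDl ?addr_ge0 ?rnorm_ge0.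
have [a' Da' aa'] := Ha _ (divr_gt0 e0 d0).
exists (cmul a' b - cmul b a') => //.
have -> : cmul a b - cmul b a - (cmul a' b - cmul b a') =
  cmul (a - a') b - cmul b (a - a') by rewrite cmulBl cmulBr; zmodule.
rewrite (le_lt_trans (rnormD _ _))// rnormN.
apply: (@le_lt_trans _ _ (rnorm (a - a') * (rnorm b + rnorm b + 1))).
  rewrite !mulrDr mulr1 -[leLHS]addr0 lerD ?rnorm_ge0// lerD//.
    exact: rnorm_cmul.
  by rewrite mulrC rnorm_cmul.
by rewrite -ltr_pdivlMr.
Qed.

End Bops.

Section Generated.
Context {R : realType} {H : hilbertType R} (T : bop H).

Lemma cstar_generated_subalgebra : cstar_subalgebra (cstar_generated T).
Proof.
split.
- by move=> S [[]].
- move=> c a b Sa Sb S CS; have [[_ SL _ _ _] _] := CS.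
  by apply: SL; [exact: Sa|exact: Sb].
- move=> a b Sa Sb S CS; have [[_ _ SM _ _] _] := CS.
  by apply: SM; [exact: Sa|exact: Sb].
- move=> a Sa S CS; have [[_ _ _ SS _] _] := CS.
  by apply: SS; exact: Sa.
- by apply: closed_bigI => S [[]].
Qed.

Lemma cstar_generated_self : cstar_generated T T.
Proof. by move=> S [_ ST]; apply: ST; left. Qed.

Lemma cstar_generated_id : cstar_generated T (bop_id H).
Proof. by move=> S [_ ST]; apply: ST; right. Qed.

Lemma cstar_generated_min (S : set (bop H)) :
  cstar_subalgebra S -> S T -> S (bop_id H) -> cstar_generated T `<=` S.
Proof. by move=> sS ST Sid a; apply; split=> // _ [->|->]. Qed.

End Generated.

Section StarMorphisms.
Context {R : realType} {A B : cstarAlgType R} (S : set A) (f : A -> B).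
Hypotheses (lS : linear_set S) (mf : star_morphism S f).

Lemma star_morphism0 : f 0 = 0.
Proof.
have S0 := lS.1; case: mf => fL _ _.
by have := fL (-1) 0 0 S0 S0; rewrite scaler0 addr0 scaleN1r addNr.
Qed.
Lemma star_morphismD a b : S a -> S b -> f (a + b) = f a + f b.
Proof. by case: mf => fL _ _ Sa Sb; have := fL 1 a b Sa Sb; rewrite !scale1r. Qed.
Lemma star_morphismZ c a : S a -> f (c *: a) = c *: f a.
Proof.
case: mf => fL _ _ Sa; have := fL c a 0 Sa lS.1.
by rewrite !addr0 star_morphism0 addr0.
Qed.
Lemma star_morphismN a : S a -> f (- a) = - f a.
Proof. by move=> Sa; rewrite -scaleN1r star_morphismZ// scaleN1r. Qed.
Lemma star_morphismB a b : S a -> S b -> f (a - b) = f a - f b.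
Proof.
by move=> Sa Sb; rewrite star_morphismD ?star_morphismN//; exact: linear_setN.
Qed.

End StarMorphisms.

Section Contraction.
Context {R : realType} {A : cstarAlgType R} {K : hilbertType R}.
Variables (S : set A) (rho : A -> bop K).
Hypotheses (sS : cstar_subalgebra S) (mrho : star_morphism S rho).

Let lS := subalgebra_linear sS.

(** With [(1 - y)^2 = 1 - a^2] as in [cstar_sqrt], the operator
    [1 - rho a ^2 = (1 - rho y)^2] is positive, whence [|rho a| <= 1]. *)
Lemma selfadjoint_contractive a : S a -> cstar a = a -> rnorm a <= 1 ->
  rnorm (rho a) <= 1.
Proof.
move=> Sa sa a1; have [S0 SL SM SS cS] := sS.
pose D := S `&` [set y | cstar y = y].
have cD : closed D.
  apply: closedI => //; apply/rnorm_closedP => y Hy.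
  apply/eqP; rewrite -subr_eq0; apply/eqP/rnorm0_eq0/eqP.
  rewrite eq_le rnorm_ge0 andbT; apply/ler_addgt0Pr => e e0; rewrite add0r.
  have e2 : 0 < e / 2 by rewrite divr_gt0.
  have [z /= sz yz] := Hy _ e2.
  have -> : cstar y - y = cstar (y - z) - (y - z) by rewrite cstarB sz; zmodule.
  by rewrite (le_trans (rnormD _ _))// rnormN rnorm_cstar; lra.
have aa1 : rnorm (cmul a a) <= 1.
  by rewrite (le_trans (rnorm_cmul _ _))// mulr_ile1 ?rnorm_ge0.
have [||y [[Sy sy] _ yE]] := cstar_sqrt cD _ aa1.
- by split => //=; exact: cstar0.
- move=> y [Sy /= sy]; split => /=.
    by apply: linear_setZ => //; apply: linear_setD => //; exact: SM.
  by rewrite cstarZr cstarD !cstarM sa sy.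
have [_ rM rS] := mrho.
have sra : cstar (rho a) = rho a by rewrite -rS// sa.
have sry : cstar (rho y) = rho y by rewrite -rS// sy.
have ryE v : (2 : R)%:C *: rho y v = rho a (rho a v) + rho y (rho y v).
  have := congr1 (fun z : A => rho z v) yE.
  rewrite (star_morphismZ lS mrho)// (star_morphismD mrho)// ?rM//; exact: SM.
apply: rnorm_bop_le => // v; rewrite mul1r.
rewrite -(@ler_pXn2r _ 2) ?nnegrE ?rnorm_ge0//.
have h1 : rnorm (rho a v) ^+ 2 = 2 * rdot v (rho y v) - rnorm (rho y v) ^+ 2.
  rewrite -!rdotxx !rdot_cstar sra sry -rdotZr ryE rdotDr addrK//.
have := sqr_ge0 (rnorm (v - rho y v)); rewrite rnormBsq h1; lra.
Qed.

(** The C*-identity reduces the general case to the selfadjoint one. *)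
Lemma star_morphism_contractive a : S a -> rnorm (rho a) <= rnorm a.
Proof.
have [S0 SL SM SS cS] := sS; have [_ rM rS] := mrho.
have sa_case b : S b -> cstar b = b -> rnorm (rho b) <= rnorm b.
  move=> Sb sb; have [/rnorm0_eq0->|b0] := eqVneq (rnorm b) 0.
    by rewrite (star_morphism0 lS mrho) !rnorm0.
  have bp : 0 < rnorm b by rewrite lt_neqAle eq_sym b0 rnorm_ge0.
  have cb : cabs (rnorm b)^-1%:C = (rnorm b)^-1.
    by rewrite cabsr ger0_norm// invr_ge0 ltW.
  have : rnorm (rho ((rnorm b)^-1%:C *: b)) <= 1.
    apply: selfadjoint_contractive; first exact: linear_setZ.
      by rewrite cstarZr sb.
    by rewrite rnormZ cb mulVf.
  by rewrite (star_morphismZ lS mrho)// rnormZ cb mulrC ler_pdivrMr// mul1r.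
move=> Sa; rewrite -(@ler_pXn2r _ 2) ?nnegrE ?rnorm_ge0//.
rewrite -!rnorm_cstar_cmul -rS// -rM//; last exact: SS.
by apply: sa_case; [apply: SM => //; exact: SS|rewrite cstarM cstarK].
Qed.

(** As [rho] is a total function of which only the values on [S] matter, the
    preimage has to be taken within [S]. *)
Lemma closed_morphism_preimage (W : set (bop K)) : closed W ->
  closed (S `&` [set a | W (rho a)]).
Proof.
move=> /rnorm_closedP cW; apply/rnorm_closedP => x Hx.
have Sx : S x.
  case: sS => _ _ _ _ /rnorm_closedP; apply => e /Hx[y [Sy _] xy].
  by exists y.
split => //=; apply: cW => e /Hx[y [Sy Wy] xy]; exists (rho y) => //.
rewrite -(star_morphismB lS mrho)//; apply: (le_lt_trans _ xy).
by apply: star_morphism_contractive; exact: linear_setB.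
Qed.

End Contraction.

(** * Compact operators *)

Section TotallyBounded.
Context {R : realType}.

Definition totally_bounded (K : normedModType R[i]) (A : set K) :=
  forall e : R, 0 < e ->
  exists s : seq K, forall x, A x -> exists2 y, y \in s & rnorm (x - y) < e.

Lemma ultra_seq_cover (T : Type) (I : eqType) (F : set_system T) (s : seq I)
    (U : I -> set T) (D : set T) : UltraFilter F -> F D ->
  (forall x, D x -> exists2 i, i \in s & U i x) -> exists i, F (U i).
Proof.
move=> FU; elim: s D => [|i s IH] D FD Ds.
  by have [x /Ds[]] := filter_ex FD.
have [|FnU] := in_ultra_setVsetC (U i) FU; first by exists i.
apply: (IH (D `&` ~` U i)); first exact: filterI.
move=> x [/Ds[j]]; rewrite in_cons => /orP[/eqP->//|js Ujx _].
by exists j.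
Qed.

(** An ultrafilter contains, for every radius, one ball of a finite cover, and
    so is Cauchy. *)
Lemma totally_bounded_compact (K : completeNormedModType R[i]) (A : set K) :
  totally_bounded A -> compact (closure A).
Proof.
move=> tA; rewrite compact_ultra => F FU FA.
have Fc : cvg F.
  apply: cauchy_cvg; apply: cauchy_exP => _ /gtC0E[e e0 ->].
  have e2 : 0 < e / 2 by rewrite divr_gt0.
  have [s sA] := tA _ e2.
  apply: (@ultra_seq_cover _ _ F s (fun y => ball y e%:C) _ FU FA) => x.
  move=> clx.
  have : nbhs x (ball x (e / 2)%:C) by apply: nbhsx_ballx; rewrite ltcR.
  move=> /clx[z [/sA[y ys zy] /rball xz]]; exists y => //; apply/rball.
  rewrite -rnormN opprB -[x](subrK z) -addrA (le_lt_trans (rnormD _ _))//.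
  lra.
exists (lim F); split => //=.
apply: contrapT => nA.
have : F (~` closure A).
  by apply: Fc; apply: open_nbhs_nbhs; split => //; apply: closed_openC; exact: closed_closure.
by move=> /(filterI FA)/filter_ex[x []].
Qed.

Lemma interval_net (C e : R) : 0 < e ->
  exists s : seq R, forall r, `|r| <= C -> exists2 r', r' \in s & `|r - r'| < e.
Proof.
move=> e0; (* the grid of step [e], on which [r] is rounded down *)
exists [seq - C + e * i%:R | i <- iota 0 (Num.truncn (2 * C / e)).+1].
move=> r rC; pose i := Num.truncn ((r + C) / e).
have rC0 : 0 <= r + C by have := ler_norm (- r); rewrite normrN; lra.
exists (- C + e * i%:R).
  apply/mapP; exists i => //; rewrite mem_iota add0n leq0n/= ltnS le_truncn//.
  by rewrite ler_pM2r ?invr_gt0//; have := ler_norm r; lra.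
have /andP[i1 i2] := truncn_itv (divr_ge0 rC0 (ltW e0)).
move: i1 i2; rewrite -/i ler_pdivlMr// ltr_pdivrMr// -natr1 => i1 i2.
rewrite ger0_norm; lra.
Qed.

Lemma disc_net (C e : R) : 0 < e ->
  exists s : seq R[i], forall c, cabs c <= C -> exists2 c', c' \in s & cabs (c - c') < e.
Proof.
move=> e0; have e2 : 0 < e / 2 by rewrite divr_gt0.
have [s sP] := interval_net C e2.
exists [seq (a +i* b)%C | a <- s, b <- s] => -[a b] cC.
have ReIm : `|a| <= cabs (a +i* b)%C /\ `|b| <= cabs (a +i* b)%C.
  rewrite /cabs /= -(sqrtr_sqr a) -(sqrtr_sqr b); split; apply: ler_wsqrtr.
    by rewrite lerDl sqr_ge0.
  by rewrite lerDr sqr_ge0.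
have [a' a's aa'] := sP a (le_trans ReIm.1 cC).
have [b' b's bb'] := sP b (le_trans ReIm.2 cC).
exists (a' +i* b')%C; first exact: allpairs_f.
have -> : (a +i* b - (a' +i* b'))%C = (a - a')%:C + 'i * (b - b')%:C.
  by apply/eqP; rewrite eq_complex /= !mul0r !mul1r !subr0 !addr0 !add0r !eqxx.
rewrite -ltcR -cabsE (le_lt_trans (ler_normD _ _))// normrM normCi mul1r.
by rewrite !cabsE !cabsr -rmorphD/= ltcR; lra.
Qed.

(** Unlike compactness of the closed image of the ball, this form visibly
    passes to linear combinations and to norm limits. *)
Definition tb_operator (K : hilbertType R) (T : bop K) :=
  totally_bounded [set T x | x in [set x : K | `|x| <= 1]].

Lemma tb_operator_compact (K : hilbertType R) (T : bop K) :
  tb_operator T -> compact_operator T.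
Proof. exact: totally_bounded_compact. Qed.

Lemma tb_operatorP (K : hilbertType R) (T : bop K) :
  tb_operator T <-> forall e : R, 0 < e -> exists s : seq K,
    forall x, rnorm x <= 1 -> exists2 y, y \in s & rnorm (T x - y) < e.
Proof.
have n1 (x : K) : (`|x| <= 1) = (rnorm x <= 1) by rewrite rnormE lecR.
split=> H e /H[s sP]; exists s.
  by move=> x x1; apply: sP; exists x => //=; rewrite n1.
by move=> _ [x /= x1 <-]; apply: sP; rewrite -n1.
Qed.

Lemma tb_operator_linear (K : hilbertType R) : linear_set (@tb_operator K).
Proof.
split.
  apply/tb_operatorP => e e0; exists [:: 0] => x _; exists 0; first exact: mem_head.
  by rewrite bop_zeroE subrr rnorm0.
move=> c S T /tb_operatorP tS /tb_operatorP tT; apply/tb_operatorP => e e0.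
have c1 : 0 < cabs c + 1 by rewrite ltr_wpDl ?cabs_ge0.
have e2 : 0 < e / 2 by rewrite divr_gt0.
have [s sP] := tS _ (divr_gt0 e2 c1); have [t tP] := tT _ e2.
exists [seq c *: y + z | y <- s, z <- t] => x x1.
have [y ys Sy] := sP x x1; have [z zt Tz] := tP x x1.
exists (c *: y + z); first exact: allpairs_f.
have -> : (c *: S + T) x - (c *: y + z) = c *: (S x - y) + (T x - z).
  by rewrite bop_addE bop_scaleE scalerBr; zmodule.
rewrite (le_lt_trans (rnormD _ _))// rnormZ [ltRHS]splitr ler_ltD//.
apply: (@le_trans _ _ ((cabs c + 1) * rnorm (S x - y))).
  by rewrite ler_wpM2r ?rnorm_ge0// lerDl.
by rewrite mulrC -ler_pdivlMr// ltW.
Qed.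

Lemma tb_operator_closed (K : hilbertType R) : closed (@tb_operator K).
Proof.
apply/rnorm_closedP => T HT; apply/tb_operatorP => e e0.
have e2 : 0 < e / 2 by rewrite divr_gt0.
have [S /tb_operatorP tS TS] := HT _ e2.
have [s sP] := tS _ e2; exists s => x x1.
have [y ys Sy] := sP x x1; exists y => //.
have -> : T x - y = (T - S) x + (S x - y) by rewrite bop_subE; zmodule.
rewrite (le_lt_trans (rnormD _ _))// [ltRHS]splitr ler_ltD//.
rewrite (le_trans (rnorm_bop _ _))//.
by rewrite -[leRHS]mulr1 ler_pM ?rnorm_ge0// ltW.
Qed.

Lemma rank_one_tb (K : hilbertType R) (T : bop K) (phi : K -> R[i]) (z : K) (C : R) :
  (forall x, T x = phi x *: z) ->
  (forall x, cabs (phi x) <= C * rnorm x) -> 0 <= C -> tb_operator T.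
Proof.
move=> Tphi phiC C0; apply/tb_operatorP => e e0.
have d0 : 0 < rnorm z + 1 by rewrite ltr_wpDl ?rnorm_ge0.
have [s sP] := disc_net C (divr_gt0 e0 d0).
exists [seq c *: z | c <- s] => x x1.
have [|c cs cc] := sP (phi x).
  by rewrite (le_trans (phiC x))// ler_piMr.
exists (c *: z); first exact: map_f.
rewrite Tphi -scalerBl rnormZ; move: cc; rewrite ltr_pdivlMr//; apply: le_lt_trans.
by rewrite ler_wpM2l ?cabs_ge0// lerDl.
Qed.

End TotallyBounded.

(** * The ideal generated by an abelian projection *)

Section OperatorAbs.
Context {R : realType} {K : hilbertType R}.

Lemma closed_zero (V : normedModType R[i]) : closed [set (0 : V)].
Proof.
apply/rnorm_closedP => x Hx /=; apply: rnorm0_eq0; apply/eqP.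
rewrite eq_le rnorm_ge0 andbT; apply/ler_addgt0Pr => e /Hx[_ ->].
by rewrite subr0 add0r => /ltW.
Qed.

(** The absolute value of [B], obtained as the square root of [B^2]; the last
    clause is what remains of its positivity. *)
Lemma bop_abs (B : bop K) : cstar B = B -> rnorm B <= 1 ->
  exists N : bop K, [/\ cmul N N = cmul B B,
    forall C, cmul C B = cmul B C -> cmul C N = cmul N C &
    forall x, rdot (N x) x = 0 -> N x = 0].
Proof.
move=> sB B1.
pose D : set (bop K) := \bigcap_(C in [set C | cmul C B = cmul B C])
   [set y | [set (0 : bop K)] (cmul y C - cmul C y)].
have DP y C : D y -> cmul C B = cmul B C -> cmul y C = cmul C y.
  by move=> Dy /Dy /= /eqP; rewrite subr_eq0 => /eqP.
pose x := bop_id K - cmul B B.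
(* [|v - B^2 v|^2 = |v|^2 - 2 |B v|^2 + |B^2 v|^2], and [|B^2 v| <= |B v|] *)
have x1 : rnorm x <= 1.
  apply: rnorm_bop_le => // v; rewrite mul1r.
  rewrite -(@ler_pXn2r _ 2) ?nnegrE ?rnorm_ge0// bop_subE /= rnormBsq.
  have -> : rdot v (B (B v)) = rnorm (B v) ^+ 2 by rewrite -{1}sB -rdot_cstar rdotxx.
  have : rnorm (B (B v)) <= rnorm (B v).
    by rewrite (le_trans (rnorm_bop _ _))// ler_piMl ?rnorm_ge0.
  move=> le; have : rnorm (B (B v)) ^+ 2 <= rnorm (B v) ^+ 2.
    by rewrite ler_pXn2r ?nnegrE ?rnorm_ge0.
  by have := sqr_ge0 (rnorm (B v)); lra.
have [|||y [Dy y1 yE]] := cstar_sqrt (D := D) _ _ x1.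
- apply: closed_bigI => C _; apply: closed_commutant => //; first exact: closed_zero.
  by split => // c a b -> ->; rewrite scaler0 addr0.
- by move=> C _ /=; rewrite cmul0l cmul0r subrr.
- move=> y Dy C CB /=; have yC := DP _ _ Dy CB.
  rewrite cmulZl cmulZr -scalerBr; apply/eqP; rewrite scaler_eq0; apply/orP; right.
  rewrite cmulDl cmulDr -[cmul (cmul y y) C]cmulA yC !cmulA yC.
  have -> : cmul x C = cmul C x.
    rewrite /x cmulBl cmulBr -cmulA -CB !cmulA -CB; congr (_ - _).
    by apply: bop_inj.
  by rewrite subrr.
exists (bop_id K - y); split.
- apply: bop_inj => v; rewrite !cmul_bopE !bop_subE /= bopB.
  have : (2 : R)%:C *: y v = v - B (B v) + y (y v).
    by have := congr1 (fun T : bop K => T v) yE; rewrite bop_addE bop_subE.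
  have -> : (2 : R)%:C *: y v = y v + y v.
    by rewrite rmorph_nat scaler_nat mulr2n.
  move=> yv; have -> : v - y v - (y v - y (y v)) = v - (y v + y v) + y (y v).
    zmodule.
  rewrite yv; zmodule.
- move=> C CB; rewrite cmulBl cmulBr (DP _ _ Dy CB); congr (_ - _).
  exact: bop_inj.
- move=> v; rewrite !bop_subE /= => h; apply: rnorm0_eq0; apply/eqP.
  rewrite -sqrf_eq0 eq_le sqr_ge0 andbT rnormBsq.
  move: h; rewrite rdotC rdotBr rdotxx => h.
  have : rnorm (y v) <= rnorm v.
    by rewrite (le_trans (rnorm_bop _ _))// ler_piMl ?rnorm_ge0.
  move=> le; have : rnorm (y v) ^+ 2 <= rnorm v ^+ 2.
    by rewrite ler_pXn2r ?nnegrE ?rnorm_ge0.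
  by move: h; rewrite rdotC; lra.
Qed.

End OperatorAbs.

Lemma closed_subspace_kernels {R : realType} {K : hilbertType R} (J : Type)
    (D : set J) (T : J -> bop K) :
  closed_subspace [set v | forall j, D j -> T j v = 0].
Proof.
split.
- by move=> j _; rewrite bop0.
- by move=> s x y Tx Ty j Dj; rewrite bopD bopZ Tx// Ty// scaler0 addr0.
- have -> : [set v | forall j, D j -> T j v = 0] =
      \bigcap_(j in D) [set v | [set 0] (T j v)] by [].
  by apply: closed_bigI => j _; apply: closed_preimage_bop; exact: closed_zero.
Qed.

Section AbelianIrreps.
Context {R : realType} {A : cstarAlgType R} {K : hilbertType R}.
Variables (I : set A) (rho : A -> bop K) (p : A).
Hypotheses (sI : cstar_subalgebra I) (irr : irreducible_repr I rho) (Ip : I p).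
Hypotheses (sp : cstar p = p) (pp : cmul p p = p).
Hypothesis abel : forall a b, I a -> I b ->
  cmul (cmul p (cmul a p)) (cmul p (cmul b p)) =
  cmul (cmul p (cmul b p)) (cmul p (cmul a p)).

Let lI : linear_set I := subalgebra_linear sI.
Let mrho : star_morphism I rho. Proof. by case: irr. Qed.
Let IM a b : I a -> I b -> I (cmul a b).
Proof. by case: sI => _ _ IM _ _; exact: IM. Qed.
Let IS a : I a -> I (cstar a).
Proof. by case: sI => _ _ _ IS _; exact: IS. Qed.
Let rM a b : I a -> I b -> rho (cmul a b) = cmul (rho a) (rho b).
Proof. by case: mrho => _ rM _; exact: rM. Qed.
Let rS a : I a -> rho (cstar a) = cstar (rho a).
Proof. by case: mrho => _ _ rS; exact: rS. Qed.
Let P := rho p.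
Let PP x : P (P x) = P x.
Proof. by rewrite -cmul_bopE -rM// pp. Qed.
Let sP : cstar P = P. Proof. by rewrite -rS// sp. Qed.

(** Schur's lemma for the corner [p I p]: with [N1 = |B| - B] and
    [N2 = |B| + B] one has [N1 N2 = 0], and both commute with the corner.
    Either of them vanishes on [u], because the vectors [v] with
    [N1 P rho(a) v = 0] for all [a] form an invariant subspace; as
    [<B u, u> = 0], so does [|B|]. *)
Lemma corner_selfadjoint_eigen b u : I b -> cstar b = b -> cmul p b = b ->
  cmul b p = b -> P u = u -> rnorm u = 1 -> exists s : R[i], rho b u = s *: u.
Proof.
move=> Ib sb pb bp Pu u1.
pose c := rdot (rho b u) u.
pose B0 : bop K := rho b - c%:C *: P.
have sB0 : cstar B0 = B0 by rewrite cstarB cstarZr sP -rS// sb.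
pose k := (rnorm B0 + 1)^-1.
have B1 : 0 < rnorm B0 + 1 by rewrite ltr_wpDl ?rnorm_ge0.
have k0 : 0 < k by rewrite invr_gt0.
pose B : bop K := k%:C *: B0.
have sB : cstar B = B by rewrite cstarZr sB0.
have nB : rnorm B <= 1.
  by rewrite rnormZ cabsr (ger0_norm (ltW k0)) mulrC ler_pdivrMr// mul1r lerDl.
have [N [NN NC Npos]] := bop_abs sB nB.
have corner_comm a : I a -> cmul (rho (cmul p (cmul a p))) B =
    cmul B (rho (cmul p (cmul a p))).
  move=> Ia; have Ipap : I (cmul p (cmul a p)) by do 2?apply: IM.
  rewrite /B /B0 cmulZl cmulZr; congr (_ *: _).
  rewrite cmulBl cmulBr; congr (_ - _).
    rewrite -!rM//; congr rho.
    by rewrite -bp -pb -[cmul (cmul p b) p]cmulA abel.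
  by rewrite cmulZl cmulZr -!rM//; congr (_ *: rho _); rewrite !cmulA pp -!cmulA pp.
have pC : cmul P B = cmul B P.
  by have := corner_comm p Ip; rewrite pp pp.
have PN : cmul P N = cmul N P by exact: NC.
have BN : cmul B N = cmul N B by exact: NC.
pose N1 : bop K := N - B; pose N2 : bop K := N + B.
have N12 : cmul N1 N2 = 0.
  rewrite /N1 /N2 cmulBl !cmulDr NN BN; zmodule.
pose M : set K := [set v | forall a, I a -> cmul N1 (cmul P (rho a)) v = 0].
have cM : closed_subspace M by exact: closed_subspace_kernels.
have Nu : N1 u = 0 \/ N2 u = 0.
  have [_ _ /(_ M cM)[]] := irr.
  - move=> a x Ia Mx b' Ib'; rewrite -cmul_bopE -!cmulA -rM//.
    by apply: Mx; exact: IM.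
  - move=> M0; right; suff : M (N2 u) by rewrite M0.
    move=> a Ia; rewrite !cmul_bopE.
    have -> : P (rho a (N2 u)) = N2 (rho (cmul p (cmul a p)) u).
      have -> : N2 u = P (N2 u).
        rewrite -{1}Pu -!cmul_bopE; congr (bopf _ u).
        by rewrite cmulDl cmulDr PN pC.
      have -> : P (rho a (P (N2 u))) = cmul (rho (cmul p (cmul a p))) N2 u.
        by rewrite !rM//; exact: IM.
      rewrite -cmul_bopE; congr (bopf _ u).
      by rewrite cmulDr cmulDl NC ?corner_comm.
    by rewrite -cmul_bopE N12.
  - move=> MT; left; have /(_ p Ip) : M u by rewrite MT.
    by rewrite !cmul_bopE -/P PP Pu.
have B0u : rdot (B0 u) u = 0.
  rewrite bop_subE bop_scaleE Pu rdotC rdotBr [rdot u (rho b u)]rdotC.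
  by rewrite rdotZr rdotxx u1 expr1n mulr1 subrr.
have Bu0 : rdot (B u) u = 0 by rewrite bop_scaleE rdotZl B0u mulr0.
have NBu : N u = B u \/ N u = - B u.
  case: Nu; rewrite ?bop_subE ?bop_addE => /eqP.
    by rewrite subr_eq0 => /eqP; left.
  by rewrite addr_eq0 => /eqP; right.
have Nu0 : N u = 0.
  by apply: Npos; case: NBu => ->; rewrite ?Bu0// rdotC rdotNr rdotC Bu0 oppr0.
have Bu : B u = 0.
  by case: NBu => h; [rewrite -h|rewrite -[B u]opprK -h Nu0 oppr0].
exists c%:C; move: Bu => /eqP; rewrite bop_scaleE scaler_eq0 => /orP[|].
  by rewrite fmorph_eq0 (gt_eqF k0).
by rewrite bop_subE bop_scaleE Pu subr_eq0 => /eqP.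
Qed.

(** The real and imaginary parts of [p a p] are selfadjoint elements of the
    corner. *)
Lemma corner_eigen a u : I a -> P u = u -> rnorm u = 1 ->
  exists s : R[i], rho (cmul p (cmul a p)) u = s *: u.
Proof.
move=> Ia Pu u1; pose d := cmul p (cmul a p).
have Id : I d by do 2?apply: IM.
have sd : cstar d = cmul p (cmul (cstar a) p) by rewrite !cstarM sp cmulA.
have pd : cmul p d = d by rewrite cmulA pp.
have dp : cmul d p = d by rewrite -!cmulA pp.
have psd : cmul p (cstar d) = cstar d by rewrite sd cmulA pp.
have sdp : cmul (cstar d) p = cstar d by rewrite sd -!cmulA pp.
have Isd : I (cstar d) by exact: IS.
have [s1 e1] : exists s : R[i], rho (d + cstar d) u = s *: u.
  apply: corner_selfadjoint_eigen => //.
  - exact: linear_setD.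
  - by rewrite cstarD cstarK addrC.
  - by rewrite cmulDr pd psd.
  - by rewrite cmulDl dp sdp.
have [s2 e2] : exists s : R[i], rho ('i *: (d - cstar d)) u = s *: u.
  apply: corner_selfadjoint_eigen => //.
  - by apply: linear_setZ => //; exact: (linear_setB lI).
  - by rewrite cstarZ cstarB cstarK conjCi scaleNr -scalerN opprB.
  - by rewrite cmulZr cmulBr pd psd.
  - by rewrite cmulZl cmulBl dp sdp.
exists (2^-1 * (s1 - 'i * s2)).
have lr := star_morphismZ lI mrho.
have e3 : rho d u + rho (cstar d) u = s1 *: u.
  by rewrite -e1 (star_morphismD mrho).
have e4 : 'i *: (rho d u - rho (cstar d) u) = s2 *: u.
  rewrite -e2 lr; first by rewrite (star_morphismB lI mrho)// bop_scaleE bop_subE.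
  exact: (linear_setB lI).
have e5 : rho d u - rho (cstar d) u = - ('i * s2) *: u.
  by rewrite scaleNr -scalerA -e4 scalerA mulCii scaleN1r opprK.
have e6 : rho d u + rho d u = (s1 - 'i * s2) *: u.
  rewrite scalerDl -e3 -e5; zmodule.
have h : 2^-1 + 2^-1 = 1 :> R[i] by rewrite [RHS]splitr !mul1r.
by rewrite -scalerA -e6 scalerDr -scalerDl h scale1r.
Qed.

(** If [v] is in the range of [P] and orthogonal to the unit vector [u] of that
    range, then the vectors [z] with [<rho(a) z, v> = 0] for all [a] form an
    invariant subspace, which contains [u] because the corner acts on [u] by
    scalars.  It is therefore everything, and [<P v, v> = 0]. *)
Lemma corner_rank_one : P <> 0 ->
  exists2 u, P u = u /\ rnorm u = 1 & forall x, P x = dotp (P x) u *: u.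
Proof.
move=> P0.
have [x Px] : exists x, P x <> 0.
  apply: contrapT => nx; apply: P0; apply: bop_inj => x.
  by apply: contrapT => Px; apply: nx; exists x.
have nPx : 0 < rnorm (P x).
  by rewrite lt_neqAle rnorm_ge0 andbT eq_sym; apply/eqP => /rnorm0_eq0.
pose u := (rnorm (P x))^-1%:C *: P x.
have Pu : P u = u by rewrite bopZ PP.
have u1 : rnorm u = 1.
  by rewrite rnormZ cabsr ger0_norm ?invr_ge0 ?rnorm_ge0// mulVf ?gt_eqF.
exists u => // y; apply/eqP; rewrite -subr_eq0; apply/eqP.
set v := _ - _.
have Pv : P v = v by rewrite /v bopB bopZ PP Pu.
have uu : dotp u u = 1 by rewrite dotpxx rnormE u1 expr1n.
have vu : dotp v u = 0 by rewrite dotpBl dotpZl uu mulr1 subrr.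
have uv : dotp u v = 0 by rewrite dotpC vu rmorph0.
pose M : set K := \bigcap_(a in I) [set z | [set z | dotp z v = 0] (rho a z)].
have cM : closed_subspace M.
  split.
  - by move=> a _ /=; rewrite bop0 dotp0l.
  - move=> s z w Mz Mw a Ia /=; rewrite bopD bopZ dotpDl dotpZl.
    by rewrite (Mz a Ia) (Mw a Ia) mulr0 addr0.
  - by apply: closed_bigI => a _; apply: closed_preimage_bop; exact: closed_dotp0.
have [_ _ /(_ M cM)[]] := irr.
- move=> a z Ia Mz b Ib /=; rewrite -cmul_bopE -rM//; apply: Mz; exact: IM.
- move=> M0; suff : M u.
    rewrite M0 => /= u0; move: u1; rewrite u0 rnorm0 => /eqP.
    by rewrite eq_sym oner_eq0.
  move=> a Ia /=; rewrite -Pv -sP -dotp_cstar -Pu.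
  have -> : P (rho a (P u)) = rho (cmul p (cmul a p)) u.
    by rewrite -!cmul_bopE !rM//; exact: IM.
  by have [s ->] := corner_eigen Ia Pu u1; rewrite dotpZl uv mulr0.
- move=> MT; have /(_ p Ip)/= : M v by rewrite MT.
  by rewrite -/P Pv => /dotpxx0.
Qed.

End AbelianIrreps.

Section AbelianProjection.
Context {R : realType} {A : cstarAlgType R}.
Variables (Q : set A) (one p : A).
Hypotheses (sQ : cstar_subalgebra Q) (Q1 : Q one).
Hypotheses (one_cmul : forall a, Q a -> cmul one a = a)
           (cmul_one : forall a, Q a -> cmul a one = a).
Hypotheses (Qp : Q p) (sp : cstar p = p) (pp : cmul p p = p) (p0 : p <> 0).
Hypothesis abel : forall a b, Q a -> Q b ->
  cmul (cmul p (cmul a p)) (cmul p (cmul b p)) =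
  cmul (cmul p (cmul b p)) (cmul p (cmul a p)).

Let I := smallest (closed_ideal Q) [set p].
Let lQ : linear_set Q := subalgebra_linear sQ.
Let QM a b : Q a -> Q b -> Q (cmul a b).
Proof. by case: sQ => _ _ QM _ _; exact: QM. Qed.
Let QS a : Q a -> Q (cstar a).
Proof. by case: sQ => _ _ _ QS _; exact: QS. Qed.

Let idealI : closed_ideal Q I.
Proof.
have idQ : closed_ideal Q Q.
  have [S0 SL SM SS cS] := sQ; split => //.
  by move=> a b Qa Qb; split; exact: SM.
split.
- by move=> a; apply; split => // _ ->.
- by move=> J [[]].
- move=> c a b Ia Ib J CJ; have [[_ _ JL _ _] _] := CJ.
  by apply: JL; [exact: Ia|exact: Ib].
- move=> a b Qa Ib; split=> J CJ; have [[_ _ _ JM _] _] := CJ.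
    by apply: (JM a b _ _).1 => //; exact: Ib.
  by apply: (JM a b _ _).2 => //; exact: Ib.
- by apply: closed_bigI => J [[]].
Qed.

Let Ip : I p. Proof. by move=> J [_]; exact. Qed.

(** An ideal is reached from its generator by two-sided multiplication only
    up to linear combinations and limits; [Z] absorbs those. *)
Let ideal_ind (Z : set A) : closed Z -> linear_set Z ->
  (forall b c, Q b -> Q c -> Z (cmul b (cmul p c))) -> I `<=` Z.
Proof.
move=> cZ lZ Zp.
have [IQ I0 IL IM cI] := idealI.
pose J := I `&` \bigcap_(bc in [set bc : A * A | Q bc.1 /\ Q bc.2])
                   [set a | Z (cmul bc.1 (cmul a bc.2))].
have JP a b c : J a -> Q b -> Q c -> Z (cmul b (cmul a c)).
  by move=> [_ Ja] Qb Qc; exact: (Ja (b, c)).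
suff idJ : closed_ideal Q J.
  move=> a Ia; have Ja : J a.
    by apply: Ia; split => // _ ->; split => // -[b c] [/= Qb Qc]; exact: Zp.
  by have := JP _ _ _ Ja Q1 Q1; rewrite cmul_one ?one_cmul//; exact: IQ.
split.
- by move=> a [/IQ].
- by split => // -[b c] _ /=; rewrite cmul0l cmul0r; exact: lZ.1.
- move=> s a b Ja Jb; split; first by apply: IL; [exact: Ja.1|exact: Jb.1].
  move=> -[c d] [/= Qc Qd]; rewrite cmulDl cmulZl cmulDr cmulZr.
  by apply: lZ.2; exact: JP.
- move=> a b Qa Jb; split; (split; first by case: (IM a b Qa Jb.1)) => -[c d] [/= Qc Qd].
    by rewrite -[cmul (cmul a b) d]cmulA cmulA; apply: JP => //; exact: QM.
  by rewrite -[cmul (cmul b a) d]cmulA; apply: JP => //; exact: QM.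
- apply: closedI => //; apply: closed_bigI => -[b c] _; exact: closed_cmul_preimage.
Qed.

Let starI a : I a -> I (cstar a).
Proof.
have [IQ I0 IL IM cI] := idealI.
apply: (@ideal_ind [set a | I (cstar a)]).
- exact: closed_cstar_preimage.
- split; first by rewrite /= cstar0.
  by move=> c x y /= Ix Iy; rewrite cstarD cstarZ; exact: IL.
- move=> b c Qb Qc /=; rewrite !cstarM sp.
  apply: (IM _ _ _ _).2; first exact: QS.
  by apply: (IM _ _ _ _).1 => //; exact: QS.
Qed.

Let subI : cstar_subalgebra I.
Proof.
have [IQ I0 IL IM cI] := idealI; split => //.
by move=> a b Ia Ib; apply: (IM a b _ _).1 => //; exact: IQ.
Qed.

(** In an irreducible representation [rho] of the ideal, the projection [p]
    becomes a rank one projection, so that [rho (b p c)] has rank at most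
    one; the compact operators being a closed subspace, they contain the
    image of the whole ideal. *)
Lemma abelian_projection_ccr :
  exists I : set A, [/\ closed_ideal Q I, I <> [set 0] & ccr I].
Proof.
have [IQ I0 IL IM cI] := idealI.
exists I; split => //; first by move=> I0'; apply: p0; move: Ip; rewrite I0'.
move=> K rho irr; have mrho : star_morphism I rho by case: irr.
have lI : linear_set I := subalgebra_linear subI.
have [rL rM rS] := mrho.
pose pre (W : set (bop K)) := I `&` [set a | W (rho a)].
have preP (W : set (bop K)) : closed W -> linear_set W ->
    (forall b c, Q b -> Q c -> W (rho (cmul b (cmul p c)))) ->
    forall a, I a -> W (rho a).
  move=> cW lW Wp a Ia; suff : I `<=` pre W by move=> /(_ a Ia)[].
  apply: ideal_ind.
  - exact: closed_morphism_preimage.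
  - split; first by split => //=; rewrite (star_morphism0 lI mrho); exact: lW.1.
    move=> s x y [Ix Wx] [Iy Wy]; split; first exact: IL.
    by rewrite /= rL//; exact: lW.2.
  - move=> b c Qb Qc; split; last exact: Wp.
    by apply: (IM _ _ _ _).1 => //; apply: (IM c p _ _).2.
have Ipc c : Q c -> I (cmul p c) by move=> Qc; apply: (IM c p _ _).2.
have Ibp b : Q b -> I (cmul b p) by move=> Qb; apply: (IM b p _ _).1.
have rbpc b c : Q b -> Q c ->
    rho (cmul b (cmul p c)) = cmul (rho (cmul b p)) (cmul (rho p) (rho (cmul p c))).
  move=> Qb Qc; have -> : cmul b (cmul p c) = cmul (cmul b p) (cmul p (cmul p c)).
    by rewrite !cmulA -(cmulA b p p) pp -(cmulA b p p) pp.
  have Ippc : I (cmul p (cmul p c)) by rewrite cmulA pp; exact: Ipc.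
  by rewrite (rM _ _ (Ibp _ Qb) Ippc) (rM _ _ Ip (Ipc _ Qc)).
have rp0 : rho p <> 0.
  move=> rp0; have [_ [a Ia +] _] := irr; apply.
  apply: (preP [set 0]) => //; first exact: closed_zero.
    by split => // s x y -> ->; rewrite scaler0 addr0.
  by move=> b c Qb Qc /=; rewrite rbpc// rp0 cmul0l cmul0r.
have [u [Pu u1] Pxu] : exists2 u, rho p u = u /\ rnorm u = 1 &
    forall x, rho p x = dotp (rho p x) u *: u.
  apply: (corner_rank_one subI irr Ip sp pp) => // a b Ia Ib.
  by apply: abel; exact: IQ.
move=> a Ia; apply: tb_operator_compact; move: a Ia; apply: preP.
- exact: tb_operator_closed.
- exact: tb_operator_linear.
move=> b c Qb Qc; rewrite rbpc//.
apply: (@rank_one_tb _ _ _ (fun x => dotp (rho p (rho (cmul p c) x)) u)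
   (rho (cmul b p) u) (rnorm (rho p) * rnorm (rho (cmul p c)))).
- by move=> x; rewrite !cmul_bopE {1}Pxu bopZ.
- move=> x; rewrite (le_trans (dotp_le _ _))// u1 mulr1.
  rewrite (le_trans (rnorm_bop _ _))// -mulrA ler_wpM2l ?rnorm_ge0//.
  exact: rnorm_bop.
- by rewrite mulr_ge0 ?rnorm_ge0.
Qed.

End AbelianProjection.

(** * Orthonormal bases and weighted shifts *)

Section Basis.
Context {R : realType} {H : hilbertType R} (e : nat -> H).
Hypothesis e_basis : orthonormal_basis e.

Lemma basis_dotp m n : dotp (e m) (e n) = (m == n)%:R.
Proof. by case: e_basis. Qed.

Lemma basis_rnorm n : rnorm (e n) = 1.
Proof.
apply/eqP; rewrite -(@eqrXn2 _ 2) ?rnorm_ge0// expr1n -rdotxx /rdot.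
by rewrite basis_dotp eqxx.
Qed.

Lemma basis_total (M : set H) : closed_subspace M -> (forall n, M (e n)) -> forall x, M x.
Proof.
move=> cM Me x; have [_ /(_ x) ex] := e_basis.
apply: (cvg_closed _ _ ex); first by case: cM.
have lM := subspace_linear cM.
by move=> n; apply: linear_set_sum => // i _; exact: linear_setZ.
Qed.

Lemma closed_subspace_dotp (v : H) : closed_subspace [set z : H | dotp z v = 0].
Proof.
split; first by rewrite /= dotp0l.
  by move=> c x y /= xv yv; rewrite dotpDl dotpZl xv yv mulr0 addr0.
exact: closed_dotp0.
Qed.

Lemma basis_eq0 x : (forall n, dotp x (e n) = 0) -> x = 0.
Proof.
move=> xe; apply: dotpxx0.
apply: (basis_total (M := [set z | dotp z x = 0])); first exact: closed_subspace_dotp.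
by move=> n; rewrite /= dotpC xe rmorph0.
Qed.

Lemma basis_eq x y : (forall n, dotp x (e n) = dotp y (e n)) -> x = y.
Proof.
move=> xy; apply/eqP; rewrite -subr_eq0; apply/eqP/basis_eq0 => n.
by rewrite dotpBl xy subrr.
Qed.

Lemma basis_bop_eq (S T : bop H) : (forall n, S (e n) = T (e n)) -> S = T.
Proof.
move=> ST; apply: bop_inj => x; apply/eqP; rewrite -subr_eq0 -bop_subE; apply/eqP.
pose M := [set v | forall j : unit, setT j -> (fun=> S - T) j v = 0].
have cM : closed_subspace M by exact: closed_subspace_kernels.
suff : M x by move=> /(_ tt I).
by apply: basis_total => // n j _; rewrite bop_subE ST subrr.
Qed.

Lemma basis_bop_coef_eq (S T : bop H) :
  (forall m n, dotp (S (e m)) (e n) = dotp (T (e m)) (e n)) -> S = T.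
Proof. by move=> ST; apply: basis_bop_eq => m; exact: basis_eq. Qed.

Lemma basis_single x n : (forall k, k != n -> dotp x (e k) = 0) ->
  x = dotp x (e n) *: e n.
Proof.
move=> xk; apply: basis_eq => k; rewrite dotpZl basis_dotp eq_sym.
by have [->|kn] := eqVneq k n; rewrite ?mulr1// mulr0 xk.
Qed.

End Basis.

(** The two subalgebras of this section serve to carry a property of the
    generator over to the algebra that it generates.  Conditions on the
    adjoint are part of their definitions to make them closed under it. *)
Section InvariantFamily.
Context {R : realType} {H : hilbertType R}.

Lemma reducing_subalgebra (F : set (set H)) : (forall M, F M -> closed_subspace M) ->
  cstar_subalgebra [set A : bop H | forall M, F M -> forall x, M x ->
    M (A x) /\ M ((cstar A : bop H) x)].
Proof.
move=> FM; split.
- by move=> M /FM[M0 _ _] x _; rewrite cstar0.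
- move=> c A B HA HB M FMM x Mx; have [_ ML _] := FM _ FMM.
  have [A1 A2] := HA _ FMM _ Mx; have [B1 B2] := HB _ FMM _ Mx.
  by rewrite cstarD cstarZ !bop_addE !bop_scaleE; split; exact: ML.
- move=> A B HA HB M FMM x Mx; rewrite cstarM !cmul_bopE; split.
    by apply: (HA _ FMM _ _).1; exact: (HB _ FMM _ _).1.
  by apply: (HB _ FMM _ _).2; exact: (HA _ FMM _ _).2.
- by move=> A HA M FMM x Mx; rewrite cstarK; case: (HA _ FMM _ Mx).
- have -> : [set A : bop H | forall M, F M -> forall x, M x ->
    M (A x) /\ M ((cstar A : bop H) x)] = \bigcap_(M in F) \bigcap_(x in M)
      ([set A : bop H | M (A x)] `&` [set A : bop H | M ((cstar A : bop H) x)]).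
    by apply/seteqP; split => A HA M FMM x Mx; exact: HA.
  apply: closed_bigI => M /FM[_ _ cM]; apply: closed_bigI => x _.
  apply: closedI; first exact: closed_bop_eval.
  by apply: (@closed_cstar_preimage _ _ [set A : bop H | M (A x)]); exact: closed_bop_eval.
Qed.

Lemma commutant_mod_subalgebra (A : cstarAlgType R) (S J W : set A) :
  cstar_subalgebra S -> closed_ideal S J -> W `<=` S ->
  cstar_subalgebra (S `&` [set a | forall w, W w ->
    J (cmul a w - cmul w a) /\ J (cmul (cstar a) w - cmul w (cstar a))]).
Proof.
move=> sS iJ WS; have [S0 SL SM SS cS] := sS; have [JS J0 JL JM cJ] := iJ.
have lJ := ideal_linear iJ.
have comm_lin c a b w : J (cmul a w - cmul w a) -> J (cmul b w - cmul w b) ->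
    J (cmul (c *: a + b) w - cmul w (c *: a + b)).
  move=> Ja Jb; have -> : cmul (c *: a + b) w - cmul w (c *: a + b) =
      c *: (cmul a w - cmul w a) + (cmul b w - cmul w b).
    by rewrite cmulDl cmulDr cmulZl cmulZr scalerBr; zmodule.
  exact: JL.
have comm_mul a b w : S a -> S b -> S w -> J (cmul a w - cmul w a) ->
    J (cmul b w - cmul w b) ->
    J (cmul (cmul a b) w - cmul w (cmul a b)).
  move=> Sa Sb Sw Ja Jb; have -> : cmul (cmul a b) w - cmul w (cmul a b) =
      cmul a (cmul b w - cmul w b) + cmul (cmul a w - cmul w a) b.
    by rewrite cmulBr cmulBl !cmulA; zmodule.
  by apply: linear_setD => //; [exact: (JM _ _ _ _).1|exact: (JM _ _ _ _).2].
split.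
- by split => // w _; rewrite cstar0 cmul0l cmul0r subrr.
- move=> c a b [Sa Ha] [Sb Hb]; split; first exact: SL.
  move=> w Ww; have [a1 a2] := Ha w Ww; have [b1 b2] := Hb w Ww.
  by rewrite cstarD cstarZ; split; exact: comm_lin.
- move=> a b [Sa Ha] [Sb Hb]; split; first exact: SM.
  move=> w Ww; have [a1 a2] := Ha w Ww; have [b1 b2] := Hb w Ww.
  have Sw := WS _ Ww.
  by rewrite cstarM; split; apply: comm_mul => //; exact: SS.
- move=> a [Sa Ha]; split; first exact: SS.
  by move=> w Ww; rewrite cstarK; case: (Ha w Ww).
- apply: closedI => //.
  have -> : [set a | forall w, W w ->
    J (cmul a w - cmul w a) /\ J (cmul (cstar a) w - cmul w (cstar a))] =
    \bigcap_(w in W) ([set a | J (cmul a w - cmul w a)] `&`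
      [set a | [set a | J (cmul a w - cmul w a)] (cstar a)]).
    by apply/seteqP; split => a Ha w Ww; exact: Ha.
  apply: closed_bigI => w _; apply: closedI; first exact: closed_commutant.
  by apply: closed_cstar_preimage; exact: closed_commutant.
Qed.

End InvariantFamily.

Section Shift.
Context {R : realType} {H : hilbertType R} (e : nat -> H).
Hypothesis e_basis : orthonormal_basis e.
Variables (a : nat -> R) (T : bop H).
Hypothesis Te : forall n, T (e n) = (a n)%:C *: e n.+1.

Lemma shift_cstar0 : (cstar T : bop H) (e 0) = 0.
Proof.
apply: (basis_eq0 e_basis) => n.
by rewrite dotp_cstarl Te dotpZr (basis_dotp e_basis) mulr0.
Qed.

Lemma shift_cstarS n : (cstar T : bop H) (e n.+1) = (a n)%:C *: e n.
Proof.
apply: (basis_eq e_basis) => k.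
rewrite dotp_cstarl Te dotpZl dotpZr !(basis_dotp e_basis) conjr eqSS.
by have [->|] := eqVneq n k; rewrite ?mulr0.
Qed.

Lemma shift_coef0 x : dotp (T x) (e 0) = 0.
Proof. by rewrite dotp_cstar shift_cstar0 dotp0r. Qed.

Lemma shift_coefS x n : dotp (T x) (e n.+1) = (a n)%:C * dotp x (e n).
Proof. by rewrite dotp_cstar shift_cstarS dotpZr conjr. Qed.

Lemma shift_cstar_coef x n : dotp ((cstar T : bop H) x) (e n) = (a n)%:C * dotp x (e n.+1).
Proof. by rewrite dotp_cstarl Te dotpZr conjr. Qed.

End Shift.

(** * Shifts with weights in a two-point set containing zero *)

Section TwoWeights.
Context {R : realType} {H : hilbertType R} (e : nat -> H).
Hypothesis e_basis : orthonormal_basis e.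
Variables (a : nat -> R) (T : bop H) (lam : R).
Hypothesis Te : forall n, T (e n) = (a n)%:C *: e n.+1.
Hypothesis lam0 : lam != 0.
Hypothesis a_lam : forall n, a n = 0 \/ a n = lam.

Let S := cstar_generated T.
Let sS : cstar_subalgebra S := cstar_generated_subalgebra T.
Let lS : linear_set S := subalgebra_linear sS.

(** The vanishing weights cut the basis into blocks, numbered by [block]; the
    shift is a direct sum of shifts, truncated or not, one for each block. *)
Let block n := (\sum_(i < n) (a i == 0%R))%N.

Let blockS n : block n.+1 = (block n + (a n == 0%R))%N.
Proof. by rewrite /block big_ord_recr. Qed.

Let block_leq m n : (m <= n)%N -> (block m <= block n)%N.
Proof.
move=> /subnKC <-; elim: (n - m)%N => [|k IH]; first by rewrite addn0.
by rewrite addnS blockS (leq_trans IH) ?leq_addr.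
Qed.

Let block_space j : set H := [set x | forall k, block k != j -> dotp x (e k) = 0].

Let block_space_closed j : closed_subspace (block_space j).
Proof.
have -> : block_space j =
    \bigcap_(k in [set k | block k != j]) [set x | dotp x (e k) = 0] by [].
have cs k := closed_subspace_dotp (e k).
split.
- by move=> k _; case: (cs k).
- move=> c x y Hx Hy k kj; have [_ L _] := cs k.
  by apply: L; [exact: Hx|exact: Hy].
- by apply: closed_bigI => k _; case: (cs k).
Qed.

Let block_space_invariant A j x : S A -> block_space j x -> block_space j (A x).
Proof.
move=> SA jx.
have sub := @reducing_subalgebra R H (range block_space) _.
have := cstar_generated_min (sub _) _ _ SA => /(_ _ _ _ _ (imageT _ j) _ jx)[] //.
- by move=> _ [i _ <-]; exact: block_space_closed.
- move=> _ [i _ <-] y iy; split => -[|k] kj.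
  + by rewrite (shift_coef0 e_basis Te).
  + rewrite (shift_coefS e_basis Te); have [->|ak] := eqVneq (a k) 0; first by rewrite mul0r.
    by rewrite iy ?mulr0//; move: kj; rewrite blockS (negbTE ak) addn0.
  + rewrite (shift_cstar_coef Te); have [->|ak] := eqVneq (a 0%N) 0; first by rewrite mul0r.
    by rewrite iy ?mulr0// blockS (negbTE ak) addn0.
  + rewrite (shift_cstar_coef Te); have [->|ak] := eqVneq (a k.+1) 0; first by rewrite mul0r.
    by rewrite iy ?mulr0// blockS (negbTE ak) addn0.
- move=> _ [i _ <-] y iy; split => //.
  suff -> : cstar (bop_id H) = bop_id H by [].
  by apply: adjoint_uniq.
Qed.

(** A projection onto a set of basis vectors from distinct blocks is an abelian
    projection: cut down by it, every element of the algebra is diagonal. *)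
Let selection_abelian (N : pred nat) (E : bop H) :
  (forall m n, N m -> N n -> block m = block n -> m = n) ->
  cstar E = E ->
  (forall n, E (e n) = if N n then e n else 0) ->
  forall A B, S A -> S B ->
  cmul (cmul E (cmul A E)) (cmul E (cmul B E)) =
  cmul (cmul E (cmul B E)) (cmul E (cmul A E)).
Proof.
move=> Ninj sE Ee A B SA SB.
have diag C n : S C -> exists c : R[i], E (C (E (e n))) = c *: e n.
  move=> SC; rewrite Ee; case: ifPn => [Nn|_]; last first.
    by exists 0; rewrite !bop0 scale0r.
  exists (dotp (E (C (e n))) (e n)); apply: (basis_single e_basis) => k kn.
  rewrite dotp_cstar sE Ee; case: ifPn => [Nk|_]; last by rewrite dotp0r.
  apply: (block_space_invariant (j := block n)) => // [i ni|].
    rewrite (basis_dotp e_basis); case: eqVneq => // ni'.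
    by rewrite ni' eqxx in ni.
  by apply: contra_neq kn; exact: Ninj.
apply: (@basis_bop_eq _ _ _ e_basis (cmul _ _) (cmul _ _)) => n.
change (E (A (E (E (B (E (e n)))))) = E (B (E (E (A (E (e n))))))).
have [c cA] := diag A n SA; have [d dB] := diag B n SB.
by rewrite dB cA !bopZ cA dB !scalerA mulrC.
Qed.

Let starts : bop H := bop_id H - (lam ^- 2)%:C *: cmul T (cstar T).
Let ends : bop H := bop_id H - (lam ^- 2)%:C *: cmul (cstar T) T.

Let cstar_id : cstar (bop_id H) = bop_id H.
Proof. exact: adjoint_uniq. Qed.

Let weight_sq n : (lam ^- 2)%:C * (a n)%:C * (a n)%:C = (a n != 0)%:R :> R[i].
Proof.
rewrite -!rmorphM/=; case: (a_lam n) => ->; first by rewrite eqxx !mulr0.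
by rewrite lam0 -mulrA -expr2 mulVf ?expf_neq0.
Qed.

Let startsE n : starts (e n) = if (n == 0)%N || (a n.-1 == 0) then e n else 0.
Proof.
rewrite /starts bop_subE bop_scaleE cmul_bopE /=; case: n => [|n] /=.
  by rewrite (shift_cstar0 e_basis Te) bop0 scaler0 subr0.
rewrite (shift_cstarS e_basis Te) bopZ Te !scalerA weight_sq.
by case: eqP => _; rewrite /= ?scale0r ?scale1r ?subr0 ?subrr.
Qed.

Let endsE n : ends (e n) = if a n == 0 then e n else 0.
Proof.
rewrite /ends bop_subE bop_scaleE cmul_bopE /= Te bopZ (shift_cstarS e_basis Te).
rewrite !scalerA weight_sq.
by case: eqP => _; rewrite /= ?scale0r ?scale1r ?subr0 ?subrr.
Qed.

Let selection_idem (N : pred nat) (E : bop H) :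
  (forall n, E (e n) = if N n then e n else 0) -> cmul E E = E.
Proof.
move=> Ee; apply: (basis_bop_eq e_basis) => m.
by rewrite cmul_bopE Ee; case: ifPn => Nm; rewrite ?bop0// Ee Nm.
Qed.

Let quotient_ccr (J : set (bop H)) (B : cstarAlgType R) (Q : set B) (q : bop H -> B) E :
  closed_ideal S J -> cstar_subalgebra Q -> is_quotient S J Q q ->
  S E -> cstar E = E -> cmul E E = E -> ~ J E ->
  (forall A B, S A -> S B ->
    J (cmul (cmul E (cmul A E)) (cmul E (cmul B E)) -
       cmul (cmul E (cmul B E)) (cmul E (cmul A E)))) ->
  exists I : set B, [/\ closed_ideal Q I, I <> [set 0] & ccr I].
Proof.
move=> iJ sQ [mq qS qJ] SE sE EE nJE abel.
have [qL qM qs] := mq; have [S0 SL SM SS cS] := sS.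
have Sid : S (bop_id H) by exact: cstar_generated_id.
have Qq A : S A -> Q (q A) by move=> SA; rewrite -qS; exists A.
have onel A : cmul (bop_id H) A = A by exact: bop_inj.
have oner A : cmul A (bop_id H) = A by exact: bop_inj.
apply: (@abelian_projection_ccr R B Q (q (bop_id H)) (q E)) => //.
- exact: Qq.
- by rewrite -qS => _ [A SA <-]; rewrite -qM// onel.
- by rewrite -qS => _ [A SA <-]; rewrite -qM// oner.
- exact: Qq.
- by rewrite -qs// sE.
- by rewrite -qM// EE.
- by move=> qE0; apply: nJE; exact/(qJ _ SE).
- rewrite -qS => _ _ [A SA <-] [C SC <-].
  have SAE : S (cmul E (cmul A E)) by exact: (SM _ _ SE (SM _ _ SA SE)).
  have SCE : S (cmul E (cmul C E)) by exact: (SM _ _ SE (SM _ _ SC SE)).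
  have h A' : S A' -> cmul (q E) (cmul (q A') (q E)) = q (cmul E (cmul A' E)).
    by move=> SA'; rewrite !qM//; exact: SM.
  have SX := SM _ _ SAE SCE; have SY := SM _ _ SCE SAE.
  rewrite (h _ SA) (h _ SC) -(qM _ _ SAE SCE) -(qM _ _ SCE SAE).
  apply/eqP; rewrite -subr_eq0 -(star_morphismB lS mq SX SY).
  by apply/eqP; apply: (qJ _ (linear_setB lS SX SY)).2; exact: abel.
Qed.

(** A quotient in which the projections on the starts and on the ends of the
    blocks both vanish is commutative, since the generator becomes a multiple
    of a unitary; then the unit is an abelian projection. *)
Lemma two_weights_gcr : gcr_operator T.
Proof.
move=> J iJ JS B Q q sQ isq.
have [S0 SL SM SS cS] := sS.
have [JsubS J0 JL JM cJ] := iJ; have lJ := ideal_linear iJ.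
have ST : S T := @cstar_generated_self _ _ T.
have Sid : S (bop_id H) := @cstar_generated_id _ _ T.
have SsT : S (cstar T) by exact: SS.
have onel A : cmul (bop_id H) A = A by exact: bop_inj.
have oner A : cmul A (bop_id H) = A by exact: bop_inj.
have Sstarts : S starts.
  by apply: (linear_setB lS) => //; apply: (linear_setZ lS); exact: SM.
have Sends : S ends.
  by apply: (linear_setB lS) => //; apply: (linear_setZ lS); exact: SM.
have s_starts : cstar starts = starts.
  by rewrite /starts cstarB cstarZr cstarM cstarK cstar_id.
have s_ends : cstar ends = ends.
  by rewrite /ends cstarB cstarZr cstarM cstarK cstar_id.
have [Jst|nJst] := pselect (J starts); last first.
  apply: (quotient_ccr iJ sQ isq Sstarts) => //.
    exact: (selection_idem startsE).
  move=> A C SA SC; rewrite (selection_abelian _ s_starts startsE)// ?subrr//.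
  have wlog m n : (m <= n)%N -> (n == 0)%N || (a n.-1 == 0) -> block m = block n -> m = n.
    rewrite leq_eqVlt => /orP[/eqP//|mn]; case: n mn => [//|n] mn /= an.
    by move=> mn'; have := block_leq (mn : (m <= n)%N); rewrite mn' blockS an addn1 ltnn.
  move=> m n Nm Nn mn; have [|] := leP m n; first by move=> /wlog; exact.
  by move=> /ltnW/wlog h; apply/esym/h.
have [Jen|nJen] := pselect (J ends); last first.
  apply: (quotient_ccr iJ sQ isq Sends) => //.
    exact: (selection_idem endsE).
  move=> A C SA SC; rewrite (selection_abelian _ s_ends endsE)// ?subrr//.
  have wlog m n : (m <= n)%N -> a m == 0 -> block m = block n -> m = n.
    rewrite leq_eqVlt => /orP[/eqP//|mn] am.
    by move=> mn'; have := block_leq mn; rewrite blockS am addn1 mn' ltnn.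
  move=> m n Nm Nn mn; have [|] := leP m n; first by move=> /wlog; exact.
  by move=> /ltnW/wlog h; apply/esym/h.
have JTT : J (cmul T (cstar T) - cmul (cstar T) T).
  have -> : cmul T (cstar T) - cmul (cstar T) T = (lam ^+ 2)%:C *: (ends - starts).
    rewrite /ends /starts.
    have -> : bop_id H - (lam ^- 2)%:C *: cmul (cstar T) T -
      (bop_id H - (lam ^- 2)%:C *: cmul T (cstar T)) =
      (lam ^- 2)%:C *: cmul T (cstar T) - (lam ^- 2)%:C *: cmul (cstar T) T by zmodule.
    by rewrite -scalerBr scalerA -rmorphM/= divff ?expf_neq0// scale1r.
  by apply: (linear_setZ lJ); exact: (linear_setB lJ).
have J_anti A C : J (cmul A C - cmul C A) -> J (cmul C A - cmul A C).
  by move=> /(linear_setN lJ); rewrite opprB.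
have comm_T A : S A -> J (cmul A T - cmul T A) /\ J (cmul A (cstar T) - cmul (cstar T) A).
  pose W := [set T; cstar T].
  have WS : W `<=` S by move=> _ [->|->].
  move=> SA; have := cstar_generated_min (commutant_mod_subalgebra sS iJ WS) _ _ SA.
  case=> [||_ h].
  - by split => // _ [->|->]; rewrite ?cstarK subrr; split => //; exact: J_anti.
  - by split => // w _; rewrite cstar_id onel oner subrr.
  - by split; [case: (h T) => //; left|case: (h (cstar T)) => //; right].
have comm A C : S A -> S C -> J (cmul A C - cmul C A).
  move=> SA SC; have SS' : S `<=` S by [].
  have := cstar_generated_min (commutant_mod_subalgebra sS iJ SS') _ _ SA.
  case=> [||_ h].
  - by split => // w Sw; have [h1 h2] := comm_T w Sw; split; exact: J_anti.
  - by split => // w _; rewrite cstar_id onel oner subrr.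
  - by case: (h C SC).
apply: (quotient_ccr iJ sQ isq Sid) => //.
- move=> Jid; apply: JS; apply/seteqP; split => // A SA.
  by rewrite -[A]onel; exact: (JM _ _ _ _).2.
- by move=> A C SA SC; rewrite !onel !oner; exact: comm.
Qed.

End TwoWeights.

(** * Operators given by their values on a basis *)

Section WeightedInjection.
Context {R : realType} {H : hilbertType R} (e : nat -> H).
Hypothesis e_basis : orthonormal_basis e.

Lemma rnorm_sqr_scale (c : R[i]) (x : H) : rnorm (c *: x) ^+ 2 = cabs c ^+ 2 * rnorm x ^+ 2.
Proof. by rewrite rnormZ exprMn. Qed.

Lemma orthogonal_sum_rnorm (sigma : nat -> nat) (d : nat -> R[i]) m n :
  injective sigma -> (m <= n)%N ->
  rnorm (\sum_(m <= k < n) d k *: e (sigma k)) ^+ 2 = \sum_(m <= k < n) cabs (d k) ^+ 2.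
Proof.
move=> sinj /subnKC <-; elim: (n - m)%N => [|j IH].
  by rewrite addn0 !big_geq// rnorm0 expr0n.
rewrite addnS !big_nat_recr ?leq_addr//= rnormDsq IH rnorm_sqr_scale.
rewrite (basis_rnorm e_basis) expr1n mulr1; congr (_ + _).
rewrite -[RHS]addr0; congr (_ + _).
suff -> : rdot (\sum_(m <= k < m + j) d k *: e (sigma k))
    (d (m + j)%N *: e (sigma (m + j)%N)) = 0 by rewrite mulr0.
rewrite /rdot dotp_suml big_nat big1// => k /andP[_ kj].
rewrite dotpZl dotpZr (basis_dotp e_basis) (inj_eq sinj).
by rewrite (ltn_eqF kj) !mulr0.
Qed.

Lemma bessel (x : H) n : \sum_(0 <= k < n) cabs (dotp x (e k)) ^+ 2 <= rnorm x ^+ 2.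
Proof.
pose s := \sum_(0 <= k < n) dotp x (e k) *: e k.
have sE : rnorm s ^+ 2 = \sum_(0 <= k < n) cabs (dotp x (e k)) ^+ 2.
  exact: (@orthogonal_sum_rnorm id).
have xs : rdot x s = rnorm s ^+ 2.
  rewrite sE /rdot /s dotp_sumr raddf_sum; apply: eq_bigr => k _.
  rewrite dotpZr mulrC -normCK cabsE -rmorphXn/=//.
have := sqr_ge0 (rnorm (x - s)); rewrite rnormBsq xs -sE; lra.
Qed.

(** The images of distinct basis vectors being orthogonal, the partial sums of
    [sum dotp x (e k) * c k *: e (sigma k)] are Cauchy and bounded by Bessel's
    inequality. *)
Lemma weighted_injection (sigma : nat -> nat) (c : nat -> R[i]) (C : R) :
  injective sigma -> 0 <= C -> (forall n, cabs (c n) <= C) ->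
  exists T : bop H, forall n, T (e n) = c n *: e (sigma n).
Proof.
move=> sinj C0 cC.
pose u x N := \sum_(0 <= k < N) (dotp x (e k) * c k) *: e (sigma k).
pose t x N : R := \sum_(0 <= k < N) cabs (dotp x (e k)) ^+ 2.
have cabsM (a b : R[i]) : cabs (a * b) = cabs a * cabs b.
  by apply: complexI; rewrite rmorphM/= -!cabsE normrM.
have terms x m n : (m <= n)%N ->
    rnorm (\sum_(m <= k < n) (dotp x (e k) * c k) *: e (sigma k)) ^+ 2 <=
    C ^+ 2 * \sum_(m <= k < n) cabs (dotp x (e k)) ^+ 2.
  move=> mn; rewrite orthogonal_sum_rnorm// mulr_sumr; apply: ler_sum => k _.
  rewrite cabsM exprMn mulrC ler_wpM2r ?sqr_ge0//.
  by rewrite lerXn2r ?nnegrE ?cabs_ge0.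
have ucvg x : exists l : H, u x @ \oo --> l.
  have tmono : nondecreasing_seq (t x).
    apply/nondecreasing_seqP => n; rewrite /t big_nat_recr//= lerDl; exact: sqr_ge0.
  have tc : cvg (t x @ \oo).
    by apply: nondecreasing_is_cvgn => //; exists (rnorm x ^+ 2) => _ [n _ <-]; exact: bessel.
  apply: cauchy_rnorm_cvg => eps eps0.
  have C1 : 0 < C ^+ 2 + 1 by rewrite ltr_wpDl ?sqr_ge0.
  have [N _ NP] := (@cvgrPdist_lt _ _ _ _ _ _ _).1 tc _
    (divr_gt0 (exprn_gt0 2 eps0) C1).
  exists N => n Nn.
  have tn : t x n <= lim (t x @ \oo) by apply: nondecreasing_cvgn_le.
  have tN := NP N (leqnn N).
  have tnN : t x n - t x N < eps ^+ 2 / (C ^+ 2 + 1).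
    by apply: le_lt_trans tN; rewrite /= (le_trans _ (ler_norm _))// lerD2r.
  rewrite -(@ltr_pXn2r _ 2) ?nnegrE ?rnorm_ge0 ?ltW// -rnormN opprB.
  have -> : u x n - u x N = \sum_(N <= k < n) (dotp x (e k) * c k) *: e (sigma k).
    have -> : u x n = u x N + \sum_(N <= k < n) (dotp x (e k) * c k) *: e (sigma k).
      exact: big_cat_nat.
    by rewrite addrC addKr.
  apply: (le_lt_trans (terms x _ _ Nn)).
  have tE : \sum_(N <= k < n) cabs (dotp x (e k)) ^+ 2 = t x n - t x N.
    have -> : t x n = t x N + \sum_(N <= k < n) cabs (dotp x (e k)) ^+ 2.
      exact: big_cat_nat.
    by rewrite addrC addKr.
  rewrite tE; apply: (@le_lt_trans _ _ ((C ^+ 2 + 1) * (t x n - t x N))).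
    by rewrite ler_wpM2r ?lerDl// subr_ge0; exact: tmono.
  by rewrite mulrC -ltr_pdivlMr.
have [f fP] := choice ucvg.
have flin : linear f.
  move=> a x y; apply: (@cvg_unique _ (@norm_hausdorff _ _) _ _ _ _ (fP _)).
  have -> : u (a *: x + y) = (fun N => a *: u x N + u y N).
    apply/funext => N; rewrite /u scaler_sumr -big_split /=; apply: eq_bigr => k _.
    by rewrite dotpDl dotpZl mulrDl scalerDl scalerA mulrA.
  by apply: cvgD; [apply: cvgZr|]; exact: fP.
have fbnd x : rnorm (f x) <= C * rnorm x.
  pose D := [set y : H | rnorm y <= C * rnorm x].
  suff : D (f x) by [].
  apply: (cvg_closed _ _ (fP x)).
    apply/rnorm_closedP => y Hy; apply/ler_addgt0Pr => eps /Hy[z Dz yz].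
    rewrite -[y](subrK z) (le_trans (rnormD _ _))// addrC lerD//; exact: ltW.
  move=> n; rewrite /D /= -(@ler_pXn2r _ 2) ?nnegrE ?rnorm_ge0 ?mulr_ge0 ?rnorm_ge0//.
  rewrite (le_trans (terms x 0%N n _))// exprMn ler_wpM2l ?sqr_ge0//.
  exact: bessel.
exists (mkbop flin (ex_intro _ C fbnd)) => n /=.
apply: (@cvg_unique _ (@norm_hausdorff _ _) _ _ _ _ (fP _)).
apply/cvg_rnormP => eps eps0; exists n.+1 => N nN.
rewrite /u big_mkord (bigD1 (Ordinal nN))//= big1 ?addr0; last first.
  move=> k; rewrite -(inj_eq val_inj)/= eq_sym => kn.
  by rewrite (basis_dotp e_basis) (negbTE kn) mul0r scale0r.
by rewrite (basis_dotp e_basis) eqxx mul1r subrr rnorm0.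
Qed.

Lemma injection_isometry (sigma : nat -> nat) : injective sigma ->
  exists J : bop H, (forall n, J (e n) = e (sigma n)) /\ (forall x, rnorm (J x) = rnorm x).
Proof.
move=> sinj.
have [|J JE] := @weighted_injection sigma (fun=> 1) 1 sinj ler01.
  by move=> _; rewrite -[1]/(1%:C) cabsr normr1.
have {}JE n : J (e n) = e (sigma n) by rewrite JE scale1r.
exists J; split => // x.
have JJ : cmul (cstar J) J = bop_id H.
  apply: (basis_bop_coef_eq e_basis) => m n.
  by rewrite cmul_bopE dotp_cstarl !JE !(basis_dotp e_basis) (inj_eq sinj).
apply/eqP; rewrite -(@eqrXn2 _ 2) ?rnorm_ge0//.
by rewrite -!rdotxx rdot_cstar -cmul_bopE JJ.
Qed.

End WeightedInjection.

(** * Limits of compressions along isometries *)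

Section AsymptoticIntertwining.
Context {R : realType} {H : hilbertType R}.
Variable J : nat -> bop H.
Hypothesis J_iso : forall n x, rnorm (J n x) = rnorm x.

(** Both sides are embeddings of [H] along [J n]: the condition says that [B]
    is the limit of the compressions of [A] by the isometries [J n], in the
    strong sense that the range of [J n] becomes invariant in the limit. *)
Definition intertwines (A B : bop H) :=
  forall x, (fun n => A (J n x) - J n (B x)) @ \oo --> (0 : H).

Definition star_intertwines (A B : bop H) :=
  intertwines A B /\ intertwines (cstar A) (cstar B).

Lemma bop_cvg0 (A : bop H) (u : nat -> H) :
  u @ \oo --> (0 : H) -> (fun n => A (u n)) @ \oo --> (0 : H).
Proof.
move=> u0; rewrite -[X in _ --> X](bop0 A).
by apply: (cvg_comp _ _ u0); exact: bop_continuous.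
Qed.

Lemma intertwines_linear c A1 B1 A2 B2 : intertwines A1 B1 -> intertwines A2 B2 ->
  intertwines (c *: A1 + A2) (c *: B1 + B2).
Proof.
move=> h1 h2 x.
have -> : (fun n => (c *: A1 + A2) (J n x) - J n ((c *: B1 + B2) x)) =
    (fun n => c *: (A1 (J n x) - J n (B1 x)) + (A2 (J n x) - J n (B2 x))).
  apply/funext => n; rewrite !bop_addE !bop_scaleE bopD bopZ scalerBr; zmodule.
have -> : (0 : H) = c *: 0 + 0 by rewrite scaler0 addr0.
by apply: cvgD; [apply: cvgZr; exact: h1|exact: h2].
Qed.

Lemma intertwines_mul A1 B1 A2 B2 : intertwines A1 B1 -> intertwines A2 B2 ->
  intertwines (cmul A1 A2) (cmul B1 B2).
Proof.
move=> h1 h2 x.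
have -> : (fun n => cmul A1 A2 (J n x) - J n (cmul B1 B2 x)) =
    (fun n => A1 (A2 (J n x) - J n (B2 x)) + (A1 (J n (B2 x)) - J n (B1 (B2 x)))).
  apply/funext => n; rewrite !cmul_bopE bopB; zmodule.
rewrite -[X in _ --> X]addr0.
by apply: cvgD; [apply: bop_cvg0; exact: h2|exact: h1].
Qed.

Lemma intertwines_id : intertwines (bop_id H) (bop_id H).
Proof.
move=> x; have -> : (fun n => bop_id H (J n x) - J n (bop_id H x)) = cst 0.
  by apply/funext => n; rewrite /= subrr.
exact: cvg_cst.
Qed.

Lemma intertwines_rnorm A B : intertwines A B -> rnorm B <= rnorm A.
Proof.
move=> h; apply: rnorm_bop_le; first exact: rnorm_ge0.
move=> x; apply/ler_addgt0Pr => eps eps0.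
have /cvg_rnormP/(_ eps eps0)[N NP] := h x.
have := NP N (leqnn N); rewrite subr0 => hN.
rewrite -(J_iso N (B x)) -rnormN.
have -> : - J N (B x) = - A (J N x) + (A (J N x) - J N (B x)) by zmodule.
rewrite (le_trans (rnormD _ _))// rnormN lerD//; last exact: ltW.
by rewrite (le_trans (rnorm_bop _ _))// J_iso.
Qed.

Lemma intertwinesB A1 B1 A2 B2 : intertwines A1 B1 -> intertwines A2 B2 ->
  intertwines (A1 - A2) (B1 - B2).
Proof.
move=> h1 h2; have := intertwines_linear (-1) h2 h1.
by rewrite !scaleN1r ![- _ + _]addrC.
Qed.

Lemma intertwines_uniq A B B' : intertwines A B -> intertwines A B' -> B = B'.
Proof.
move=> h h'; apply/eqP; rewrite -subr_eq0; apply/eqP/rnorm0_eq0/eqP.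
rewrite eq_le rnorm_ge0 andbT.
by have := intertwines_rnorm (intertwinesB h h'); rewrite subrr rnorm0.
Qed.

Lemma intertwines_closed A B :
  (forall eps : R, 0 < eps -> exists A' B', [/\ intertwines A' B',
     rnorm (A - A') < eps & rnorm (B - B') < eps]) -> intertwines A B.
Proof.
move=> AB x; apply/cvg_rnormP => eps eps0.
have x1 : 0 < rnorm x + 1 by rewrite ltr_wpDl ?rnorm_ge0.
have eps3 : 0 < eps / 3 by rewrite divr_gt0.
have [A' [B' [h' AA' BB']]] := AB _ (divr_gt0 eps3 x1).
have /cvg_rnormP/(_ _ eps3)[N NP] := h' x.
have small (C : bop H) y : rnorm C < eps / 3 / (rnorm x + 1) -> rnorm y = rnorm x ->
    rnorm (C y) < eps / 3.
  move=> Ce yx; apply: (le_lt_trans (rnorm_bop _ _)); rewrite yx.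
  apply: (@le_lt_trans _ _ (rnorm C * (rnorm x + 1))).
    by rewrite ler_wpM2l ?rnorm_ge0// lerDl.
  by rewrite -ltr_pdivlMr.
exists N => n /NP; rewrite !subr0 => hn.
have -> : A (J n x) - J n (B x) = (A - A') (J n x) +
    ((A' (J n x) - J n (B' x)) - J n ((B - B') x)).
  rewrite !bop_subE bopB; zmodule.
have s1 := small _ _ AA' (J_iso n x).
have s2 : rnorm (J n ((B - B') x)) < eps / 3 by rewrite J_iso; exact: small.
rewrite (le_lt_trans (rnormD _ _))//.
have := rnormD (A' (J n x) - J n (B' x)) (- J n ((B - B') x)).
rewrite rnormN; move: s1 s2 hn.
move: (rnorm _) (rnorm _) (rnorm _) (rnorm _) => r1 r2 r3 r4; lra.
Qed.

(** By [intertwines_rnorm] the limit depends contractively on the operator, so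
    that the limits of a Cauchy sequence of operators converge. *)
Lemma star_intertwines_dom : cstar_subalgebra [set A | exists B, star_intertwines A B].
Proof.
split.
- exists 0; have h0 : intertwines 0 0.
    have := intertwines_linear (-1) intertwines_id intertwines_id.
    by rewrite scaleN1r addNr.
  by split; rewrite ?cstar0.
- move=> c A1 A2 [B1 [h1 s1]] [B2 [h2 s2]]; exists (c *: B1 + B2).
  by split; rewrite ?cstarD ?cstarZ; exact: intertwines_linear.
- move=> A1 A2 [B1 [h1 s1]] [B2 [h2 s2]]; exists (cmul B1 B2).
  by split; rewrite ?cstarM; exact: intertwines_mul.
- by move=> A [B [h s]]; exists (cstar B); split; rewrite ?cstarK.
- apply/rnorm_closedP => A HA.
  have inv0 n : 0 < n.+1%:R^-1 :> R by rewrite invr_gt0.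
  have small (eps : R) : 0 < eps -> exists N, forall n, (N <= n)%N -> n.+1%:R^-1 < eps.
    move=> eps0; exists (Num.truncn eps^-1) => n Nn.
    rewrite -[ltRHS]invrK ltf_pV2 ?posrE ?invr_gt0//.
    by rewrite (lt_le_trans (truncnS_gt _))// ler_nat.
  have /choice[AB ABP] : forall n, exists p : bop H * bop H,
      star_intertwines p.1 p.2 /\ rnorm (A - p.1) < n.+1%:R^-1.
    move=> n.
    by have [A' [B' h'] AA'] := HA _ (inv0 n); exists (A', B').
  have [B BP] : exists B : bop H, (fun n => (AB n).2) @ \oo --> B.
    apply: cauchy_rnorm_cvg => eps eps0.
    have eps2 : 0 < eps / 2 by rewrite divr_gt0.
    have [N NP] := small _ eps2; exists N => n Nn.
    have [[hN _] AN] := ABP N; have [[hn _] An] := ABP n.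
    apply: (le_lt_trans (intertwines_rnorm (intertwinesB hN hn))).
    have -> : (AB N).1 - (AB n).1 = - (A - (AB N).1) + (A - (AB n).1) by zmodule.
    rewrite (le_lt_trans (rnormD _ _))// rnormN.
    by rewrite [ltRHS]splitr ltrD// ?(lt_trans AN (NP N _))// (lt_trans An (NP n Nn)).
  have lim_pair (eps : R) : 0 < eps -> exists n,
      rnorm (A - (AB n).1) < eps /\ rnorm (B - (AB n).2) < eps.
    move=> eps0; have [N NP] := small _ eps0.
    have /cvg_rnormP/(_ _ eps0)[M MP] := BP.
    exists (maxn N M); split.
      by apply: (lt_trans (ABP _).2); apply: NP; rewrite leq_maxl.
    by rewrite -rnormN opprB; apply: MP; rewrite leq_maxr.
  exists B; split; apply: intertwines_closed => eps /lim_pair[n [An Bn]].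
    by exists (AB n).1, (AB n).2; split => //; exact: (ABP n).1.1.
  exists (cstar (AB n).1), (cstar (AB n).2); rewrite -!cstarB !rnorm_cstar.
  by split => //; exact: (ABP n).1.2.
Qed.

Lemma star_intertwines_self : cstar_subalgebra [set A | star_intertwines A A].
Proof.
split.
- have h0 : intertwines 0 0.
    have := intertwines_linear (-1) intertwines_id intertwines_id.
    by rewrite scaleN1r addNr.
  by split; rewrite ?cstar0.
- move=> c A1 A2 [h1 s1] [h2 s2].
  by split; rewrite ?cstarD ?cstarZ; exact: intertwines_linear.
- move=> A1 A2 [h1 s1] [h2 s2].
  by split; rewrite ?cstarM; exact: intertwines_mul.
- by move=> A [h s]; split; rewrite ?cstarK.
- apply/rnorm_closedP => A HA; split; apply: intertwines_closed => eps /HA[B [h s] AB].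
    by exists B, B.
  by exists (cstar B), (cstar B); rewrite -!cstarB !rnorm_cstar.
Qed.

Lemma intertwines_basis (e : nat -> H) (A B : bop H) : orthonormal_basis e ->
  (forall k, (fun n => A (J n (e k)) - J n (B (e k))) @ \oo --> (0 : H)) ->
  intertwines A B.
Proof.
move=> e_basis ABe.
apply: (@basis_total _ _ _ e_basis
  [set x | (fun n => A (J n x) - J n (B x)) @ \oo --> (0 : H)]) => //.
split => /=.
- rewrite [X in X @ _ --> _](_ : _ = cst 0); first exact: cvg_cst.
  by apply/funext => n; rewrite !bop0 subrr.
- move=> c x y hx hy.
  have -> : (fun n => A (J n (c *: x + y)) - J n (B (c *: x + y))) =
      (fun n => c *: (A (J n x) - J n (B x)) + (A (J n y) - J n (B y))).
    apply/funext => n; rewrite !(bopD, bopZ) scalerBr; zmodule.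
  have -> : (0 : H) = c *: 0 + 0 by rewrite scaler0 addr0.
  by apply: cvgD => //; exact: cvgZr.
- apply/rnorm_closedP => x Hx; apply/cvg_rnormP => eps eps0.
  have eps2 : 0 < eps / 2 by rewrite divr_gt0.
  have AB1 : 0 < rnorm A + rnorm B + 1.
    by rewrite ltr_wpDl ?addr_ge0 ?rnorm_ge0.
  have [y /cvg_rnormP/(_ _ eps2)[N NP] xy] := Hx _ (divr_gt0 eps2 AB1).
  exists N => n /NP; rewrite !subr0 => hn.
  have -> : A (J n x) - J n (B x) =
      (A (J n (x - y)) - J n (B (x - y))) + (A (J n y) - J n (B y)).
    rewrite !bopB; zmodule.
  rewrite (le_lt_trans (rnormD _ _))// [ltRHS]splitr ler_ltD//.
  rewrite (le_trans (rnormD _ _))// rnormN J_iso.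
  apply: (@le_trans _ _ (rnorm (x - y) * (rnorm A + rnorm B + 1))).
    rewrite !mulrDr mulr1 -[leLHS]addr0 lerD ?rnorm_ge0// lerD//.
      by rewrite (le_trans (rnorm_bop _ _))// J_iso mulrC.
    by rewrite (le_trans (rnorm_bop _ _))// mulrC.
  by rewrite -ler_pdivlMr// ltW.
Qed.

(** An operator has at most one limit along the isometries, and the operators
    that have one form a C*-algebra; taking the limit is a morphism. *)
Lemma limit_morphism (T V : bop H) : star_intertwines T V ->
  exists q : bop H -> bop H, star_morphism (cstar_generated T) q /\
    forall A, cstar_generated T A -> star_intertwines A (q A).
Proof.
move=> TV.
have /choice[q qP] : forall A : bop H, exists B : bop H,
    cstar_generated T A -> star_intertwines A B.
  move=> A.
  have [SA|nSA] := pselect (cstar_generated T A); last by exists 0.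
  have [||B AB] := cstar_generated_min star_intertwines_dom _ _ SA.
  - by exists V.
  - exists (bop_id H); split; first exact: intertwines_id.
    have -> : cstar (bop_id H) = bop_id H by exact: adjoint_uniq.
    exact: intertwines_id.
  - by exists B.
exists q; split => //.
have [S0 SL SM SS _] := cstar_generated_subalgebra T.
split.
- move=> c A B SA SB; apply: (intertwines_uniq (qP _ (SL c _ _ SA SB)).1).
  exact: (intertwines_linear _ (qP _ SA).1 (qP _ SB).1).
- move=> A B SA SB; apply: (intertwines_uniq (qP _ (SM _ _ SA SB)).1).
  exact: (intertwines_mul (qP _ SA).1 (qP _ SB).1).
- move=> A SA; apply: (intertwines_uniq (qP _ (SS _ SA)).1).
  exact: (qP _ SA).2.
Qed.

End AsymptoticIntertwining.

(** * The image of a C*-algebra under a morphism is closed *)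

Section ClosedImage.
Context {R : realType} {H K : hilbertType R}.
Variables (S : set (bop H)) (q : bop H -> bop K).
Hypotheses (sS : cstar_subalgebra S) (Sid : S (bop_id H)).
Hypotheses (mq : star_morphism S q) (qid : q (bop_id H) = bop_id K).

Let lS : linear_set S := subalgebra_linear sS.

Let onel (L : hilbertType R) (A : bop L) : cmul (bop_id L) A = A.
Proof. exact: bop_inj. Qed.
Let oner (L : hilbertType R) (A : bop L) : cmul A (bop_id L) = A.
Proof. exact: bop_inj. Qed.
Let star_id (L : hilbertType R) : cstar (bop_id L) = bop_id L.
Proof. exact: adjoint_uniq. Qed.

(** [(1 + A^2)^-1] is the sum of the Neumann series of
    [X = (|A|^2 - A^2) / (1 + |A|^2)], whose norm is less than [1]. *)
Lemma resolvent_of_square (A : bop H) : S A -> cstar A = A ->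
  exists2 r, S r & [/\ cstar r = r, cmul A r = cmul r A & r + cmul A (cmul A r) = bop_id H].
Proof.
move=> SA sA; have [S0 SL SM SS cS] := sS.
pose M := rnorm A ^+ 2; have M0 : 0 <= M by rewrite sqr_ge0.
have M1 : 0 < 1 + M by rewrite ltr_pwDl.
pose X : bop H := (1 + M)^-1%:C *: (M%:C *: bop_id H - cmul A A).
pose th := (1 + M)^-1 * M.
have th0 : 0 <= th by rewrite mulr_ge0// invr_ge0 ltW.
have th1 : th < 1 by rewrite /th mulrC ltr_pdivrMr// mul1r; lra.
have SX : S X.
  apply: (linear_setZ lS); apply: (linear_setB lS); last exact: SM.
  exact: (linear_setZ lS).
have sX : cstar X = X by rewrite cstarZr cstarB cstarZr star_id cstarM sA.
have XA : cmul A X = cmul X A.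
  rewrite cmulZr cmulZl; congr (_ *: _).
  by rewrite cmulBr cmulBl cmulZr cmulZl onel oner cmulA.
have nX : rnorm X <= th.
  have iM : 0 <= (1 + M)^-1 by rewrite invr_ge0 ltW.
  rewrite /th rnormZ cabsr ger0_norm// ler_wpM2l//.
  apply: rnorm_bop_le => // v; rewrite -(@ler_pXn2r _ 2) ?nnegrE ?rnorm_ge0 ?mulr_ge0 ?rnorm_ge0//.
  have -> : (M%:C *: bop_id H - cmul A A) v = M%:C *: v - A (A v).
    by rewrite bop_subE bop_scaleE.
  rewrite rnormBsq rnormZ cabsr ger0_norm// rdotC rdotZr rdot_cstar sA rdotxx exprMn.
  have AA : rnorm (A (A v)) ^+ 2 <= M * rnorm (A v) ^+ 2.
    rewrite /M -exprMn lerXn2r ?nnegrE ?rnorm_ge0 ?mulr_ge0 ?rnorm_ge0//.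
    exact: rnorm_bop.
  have := sqr_ge0 (rnorm (A v)); nra.
pose u n := iter n (fun y : bop H => bop_id H + cmul X y) (bop_id H).
have uS n : u n.+1 = bop_id H + cmul X (u n) by [].
pose D : set (bop H) := S `&` ([set y | [set z : bop H | z = 0] (cmul y A - cmul A y)] `&`
  [set y | cstar y - y = 0]).
have cD : closed D.
  apply: closedI => //; apply: closedI.
    apply: closed_commutant; first exact: closed_zero.
    by split => // c a b /= -> ->; rewrite scaler0 addr0.
  apply/rnorm_closedP => y Hy /=.
  apply/rnorm0_eq0/eqP; rewrite eq_le rnorm_ge0 andbT.
  apply/ler_addgt0Pr => eps eps0; rewrite add0r.
  have eps2 : 0 < eps / 2 by rewrite divr_gt0.
  have [z /= sz yz] := Hy _ eps2.
  have -> : cstar y - y = cstar (y - z) - (y - z).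
    rewrite cstarB; move/eqP: sz; rewrite subr_eq0 => /eqP ->; zmodule.
  by rewrite (le_trans (rnormD _ _))// rnormN rnorm_cstar; lra.
have AP y : D y -> cmul y A = cmul A y.
  by move=> [_ [/= /eqP + _]]; rewrite subr_eq0 => /eqP.
have sP y : D y -> cstar y = y.
  by move=> [_ [_ /= /eqP]]; rewrite subr_eq0 => /eqP.
have uD n : D (u n).
  elim: n => [|n IH].
    by split => //; split; rewrite /= ?onel ?oner ?star_id subrr.
  have un_A := AP _ IH; have un_s := sP _ IH.
  have un_X : cmul (u n) X = cmul X (u n).
    rewrite cmulZr cmulZl; congr (_ *: _); rewrite cmulBr cmulBl cmulZr cmulZl onel oner.
    by rewrite !cmulA un_A -cmulA un_A cmulA.
  rewrite uS; split; first by apply: (linear_setD lS) => //; apply: SM => //; case: IH.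
  split => /=.
    by rewrite cmulDl cmulDr onel oner -cmulA un_A !cmulA XA subrr.
  by rewrite cstarD cstarM star_id sX un_s un_X subrr.
have ustep n : rnorm (u n.+1 - u n) <= th ^+ n.
  elim: n => [|n IH].
    rewrite uS /= oner addrC addKr expr0; exact: le_trans nX (ltW th1).
  have -> : u n.+2 - u n.+1 = cmul X (u n.+1 - u n).
    by rewrite (uS n.+1) [X in _ - X](uS n) cmulBr; zmodule.
  by rewrite exprS (le_trans (rnorm_cmul _ _))// ler_pM ?rnorm_ge0.
have th1' : 1 - th != 0 by rewrite subr_eq0 eq_sym lt_eqF.
have [y uy] : exists l : bop H, u @ \oo --> l.
  apply: (@dominated_steps_cvg _ _ u (fun n => (1 - th ^+ n) / (1 - th)) (1 - th)^-1).
    move=> n; apply: (le_trans (ustep n)); rewrite exprS -mulrBl.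
    by rewrite le_eqVlt; apply/orP; left; apply/eqP; field.
  move=> n; rewrite -[leRHS]mul1r ler_wpM2r ?invr_ge0 ?subr_ge0 ?(ltW th1)// gerBl.
  exact: exprn_ge0.
have Dy : D y by exact: cvg_closed uy.
have yE : y = bop_id H + cmul X y.
  apply: (@cvg_unique _ (@norm_hausdorff _ _) (u @ \oo)) => //.
  apply/cvg_rnormP => eps eps0; have /cvg_rnormP/(_ _ eps0)[N NP] := uy.
  exists N.+1 => -[//|n] /NP un; rewrite uS.
  have -> : bop_id H + cmul X (u n) - (bop_id H + cmul X y) = cmul X (u n - y).
    by rewrite cmulBr; zmodule.
  apply: le_lt_trans un; rewrite (le_trans (rnorm_cmul _ _))// ler_piMl ?rnorm_ge0//.
  by rewrite (le_trans nX)// ltW.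
have [Sy _] := Dy.
exists ((1 + M)^-1%:C *: y); first exact: (linear_setZ lS).
split.
- by rewrite cstarZr sP.
- by rewrite cmulZr cmulZl AP.
- rewrite !cmulZr -scalerDr; apply/eqP.
  have M1' : (1 + M)%:C != 0 :> R[i] by rewrite fmorph_eq0 gt_eqF.
  rewrite -(inj_eq (scalerI M1')) scalerA -rmorphM/= mulfV ?gt_eqF// scale1r.
  have E : (1 + M)%:C *: y = (1 + M)%:C *: bop_id H + (M%:C *: y - cmul A (cmul A y)).
    rewrite {1}yE scalerDr; congr (_ + _).
    rewrite cmulZl scalerA -rmorphM/= mulfV ?gt_eqF// scale1r.
    by rewrite cmulBl cmulZl onel cmulA.
  have E' : (1 + M)%:C *: y = y + M%:C *: y by rewrite rmorphD scalerDl scale1r.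
  apply/eqP; move: E; rewrite E' => E.
  have -> : y + cmul A (cmul A y) = y + M%:C *: y - (M%:C *: y - cmul A (cmul A y)) by zmodule.
  by rewrite E addrK.
Qed.

Lemma resolvent_bounds (L : hilbertType R) (A r : bop L) : cstar A = A ->
  r + cmul A (cmul A r) = bop_id L -> rnorm r <= 1 /\ rnorm (cmul A r) <= 1.
Proof.
move=> sA rE.
have key v : rnorm v ^+ 2 = rnorm (r v) ^+ 2 + 2 * rnorm (A (r v)) ^+ 2 +
    rnorm (A (A (r v))) ^+ 2.
  have {1}-> : v = r v + A (A (r v)).
    by have := congr1 (fun T : bop L => T v) rE; rewrite bop_addE.
  by rewrite rnormDsq -[X in _ = _ + 2 * X + _]rdotxx (rdot_cstar A) sA.
split; apply: rnorm_bop_le => // v; rewrite mul1r -(@ler_pXn2r _ 2) ?nnegrE ?rnorm_ge0//;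
  rewrite ?cmul_bopE (key v);
  have := sqr_ge0 (rnorm (r v)); have := sqr_ge0 (rnorm (A (r v)));
  have := sqr_ge0 (rnorm (A (A (r v)))); lra.
Qed.

(** Lifts of bounded norm up to a cubic error: [t / (1 + t^2)] is bounded on
    the real line and differs from [t] by at most [|t|^3]. *)
Lemma approximate_lift (A : bop H) : S A -> cstar A = A ->
  exists A1, [/\ S A1, cstar A1 = A1, rnorm A1 <= 1 &
    rnorm (q A - q A1) <= rnorm (q A) ^+ 3].
Proof.
move=> SA sA; have [r Sr [sr Ar rE]] := resolvent_of_square SA sA.
have [_ SL SM SS cS] := sS; have [qL qM qS] := mq.
exists (cmul A r); split.
- exact: SM.
- by rewrite cstarM sA sr Ar.
- exact: (resolvent_bounds sA rE).2.
- have SAr : S (cmul A r) by exact: SM.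
  have SAAr : S (cmul A (cmul A r)) by exact: SM.
  have rqE : q r + cmul (q A) (cmul (q A) (q r)) = bop_id K.
    by rewrite -(qM _ _ SA Sr) -(qM _ _ SA SAr) -(star_morphismD mq Sr SAAr) rE.
  have sqA : cstar (q A) = q A by rewrite -qS// sA.
  have nqr := (resolvent_bounds sqA rqE).1.
  rewrite (qM _ _ SA Sr).
  have -> : q A - cmul (q A) (q r) = cmul (q A) (cmul (q A) (cmul (q A) (q r))).
    by rewrite -{1}(oner (q A)) -rqE cmulDr; zmodule.
  rewrite exprS expr2.
  have n3 : rnorm (cmul (q A) (q r)) <= rnorm (q A).
    by rewrite (le_trans (rnorm_cmul _ _))// ler_piMr ?rnorm_ge0.
  rewrite (le_trans (rnorm_cmul _ _))// ler_wpM2l ?rnorm_ge0//.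
  by rewrite (le_trans (rnorm_cmul _ _))// ler_wpM2l ?rnorm_ge0.
Qed.

Let adherent (b : bop K) := forall eps : R, 0 < eps -> exists2 A, S A & rnorm (b - q A) < eps.

Let adherent_lin c b1 b2 : adherent b1 -> adherent b2 -> adherent (c *: b1 + b2).
Proof.
move=> h1 h2 eps eps0; have c1 : 0 < cabs c + 1 by rewrite ltr_wpDl ?cabs_ge0.
have eps2 : 0 < eps / 2 by rewrite divr_gt0.
have [A1 S1 n1] := h1 _ (divr_gt0 eps2 c1); have [A2 S2 n2] := h2 _ eps2.
have [_ SL SM SS cS] := sS; have [qL qM qS] := mq.
exists (c *: A1 + A2); first exact: SL.
rewrite qL//.
have -> : c *: b1 + b2 - (c *: q A1 + q A2) = c *: (b1 - q A1) + (b2 - q A2).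
  by rewrite scalerBr; zmodule.
rewrite (le_lt_trans (rnormD _ _))// rnormZ [ltRHS]splitr ler_ltD//.
apply: (@le_trans _ _ ((cabs c + 1) * rnorm (b1 - q A1))).
  by rewrite ler_wpM2r ?rnorm_ge0// lerDl.
by rewrite mulrC -ler_pdivlMr// ltW.
Qed.

Let adherent_star b : adherent b -> adherent (cstar b).
Proof.
move=> h eps /h[A SA bA]; have [_ _ _ SS _] := sS; have [_ _ qS] := mq.
by exists (cstar A); [exact: SS|rewrite qS// -cstarB rnorm_cstar].
Qed.

Let adherent_image A : S A -> adherent (q A).
Proof. by move=> SA eps eps0; exists A => //; rewrite subrr rnorm0. Qed.

Let adherentZ c b : adherent b -> adherent (c *: b).
Proof.
have a0 : adherent 0.
  by rewrite -(star_morphism0 lS mq); apply: adherent_image; exact: lS.1.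
by move=> h; have := adherent_lin c h a0; rewrite addr0.
Qed.

Let adherentB b1 b2 : adherent b1 -> adherent b2 -> adherent (b1 - b2).
Proof. by move=> h1 h2; have := adherent_lin (-1) h2 h1; rewrite scaleN1r addrC. Qed.

Let good b := [/\ adherent b, cstar b = b & rnorm b <= 4^-1].

(** With [|q A - b| <= 1/16] and [|b| <= 1/4], the lift of [q A] has error at
    most [1/16 + (5/16)^3 <= 1/8] as a lift of [b]; doubling the error brings
    it back into the ball of radius [1/4]. *)
Let good_step b : good b ->
  exists2 A, S A /\ rnorm A <= 1 & good ((2 : R)%:C *: (b - q A)).
Proof.
move=> [ab sb nb].
have e0 : 0 < 16^-1 :> R by rewrite invr_gt0.
have [A0 SA0 bA0] := ab _ e0.
have [_ SL SM SS cS] := sS; have [qL qM qS] := mq.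
pose A : bop H := (2^-1)%:C *: (A0 + cstar A0).
have SA0' : S (A0 + cstar A0) by apply: (linear_setD lS) => //; exact: SS.
have SA : S A by exact: (linear_setZ lS).
have sA : cstar A = A by rewrite cstarZr cstarD cstarK addrC.
have bA : rnorm (b - q A) <= 16^-1.
  rewrite (star_morphismZ lS mq _ SA0') (star_morphismD mq SA0 (SS _ SA0)) qS//.
  have -> : b - (2^-1)%:C *: (q A0 + cstar (q A0)) =
      (2^-1)%:C *: ((b - q A0) + cstar (b - q A0)).
    by rewrite -{1}[b]scale_half -scalerBr cstarB sb; congr (_ *: _); zmodule.
  rewrite rnormZ cabsr ger0_norm//.
  have := rnormD (b - q A0) (cstar (b - q A0)); rewrite rnorm_cstar; lra.
have [A1 [SA1 sA1 nA1 qA1]] := approximate_lift SA sA.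
exists A1 => //; split.
- by apply: adherentZ; apply: adherentB => //; exact: adherent_image.
- by rewrite cstarZr cstarB sb -qS// sA1.
- rewrite rnormZ cabsr ger0_norm//.
  have nqA : rnorm (q A) <= 16^-1 + 4^-1.
    have -> : q A = - (b - q A) + b by zmodule.
    by rewrite (le_trans (rnormD _ _))// rnormN lerD.
  have nqA3 : rnorm (q A) ^+ 3 <= (16^-1 + 4^-1) ^+ 3.
    by rewrite lerXn2r ?nnegrE ?rnorm_ge0//; lra.
  have : rnorm (b - q A1) <= rnorm (b - q A) + rnorm (q A - q A1).
    have -> : b - q A1 = (b - q A) + (q A - q A1) by zmodule.
    exact: rnormD.
  move: nqA3; rewrite !exprS expr0; lra.
Qed.

(** Iterating [good_step] writes [b] as [q (sum (g b_k) / 2^k)]. *)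
Let good_lift b : good b -> exists2 A, S A & q A = b.
Proof.
move=> gb.
have /choice[g gP] : forall b : bop K, exists A : bop H, good b ->
    (S A /\ rnorm A <= 1) /\ good ((2 : R)%:C *: (b - q A)).
  move=> b'.
  have [gb'|ngb'] := pselect (good b'); last by exists 0.
  by have [A h1 h2] := good_step gb'; exists A.
pose bs n := iter n (fun b' => (2 : R)%:C *: (b' - q (g b'))) b.
have bsS n : bs n.+1 = (2 : R)%:C *: (bs n - q (g (bs n))) by [].
have gbs n : good (bs n) by elim: n => // n IH; rewrite bsS; exact: (gP _ IH).2.
pose h n : R := 2^-1 ^+ n.
have h0 n : 0 <= h n by rewrite exprn_ge0.
pose W n : bop H := \sum_(0 <= k < n) (h k)%:C *: g (bs k).
have WS n : W n.+1 = W n + (h n)%:C *: g (bs n) by rewrite /W big_nat_recr.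
have Sg n : S (g (bs n)) by case: (gP _ (gbs n)) => -[].
have SW n : S (W n).
  elim: n => [|n IH]; first by rewrite /W big_geq//; exact: lS.1.
  by rewrite WS; apply: (linear_setD lS) => //; exact: (linear_setZ lS).
have bE n : b = q (W n) + (h n)%:C *: bs n.
  elim: n => [|n IH].
    by rewrite /W big_geq// (star_morphism0 lS mq) add0r /h expr0 scale1r.
  rewrite WS (star_morphismD mq)//; last exact: (linear_setZ lS).
  rewrite (star_morphismZ lS mq)// bsS scalerA -rmorphM/=.
  have -> : h n.+1 * 2 = h n by rewrite /h exprS mulrAC mulVf// mul1r.
  by rewrite scalerBr {1}IH; zmodule.
have [W' WW'] : exists l : bop H, W @ \oo --> l.
  apply: (@dominated_steps_cvg _ _ W (fun n => 2 - 2 * h n) 2).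
    move=> n; rewrite WS addrC addKr rnormZ cabsr ger0_norm//.
    have -> : 2 - 2 * h n.+1 - (2 - 2 * h n) = h n by rewrite /h exprS; field.
    by rewrite ler_piMr//; case: (gP _ (gbs n)) => -[].
  by move=> n; rewrite gerBl mulr_ge0.
have SW' : S W' by case: sS => _ _ _ _ cS; exact: (cvg_closed cS SW WW').
exists W' => //; apply/eqP; rewrite -subr_eq0; apply/eqP/rnorm0_eq0/eqP.
rewrite eq_le rnorm_ge0 andbT; apply/ler_addgt0Pr => eps eps0; rewrite add0r.
have eps2 : 0 < eps / 2 by rewrite divr_gt0.
have /cvg_rnormP/(_ _ eps2)[N NP] := WW'.
have hc : h @ \oo --> (0 : R).
  by apply: cvg_expr; rewrite ger0_norm// invf_lt1// ltr1n.
have /cvgrPdist_lt/(_ _ eps2)[N' _ NP'] := hc.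
pose n := maxn N N'.
have hn : h n < eps / 2.
  by have := NP' n (leq_maxr _ _); rewrite /= sub0r normrN ger0_norm.
have Wn : rnorm (W' - W n) < eps / 2.
  by rewrite -rnormN opprB; apply: NP; exact: leq_maxl.
have -> : q W' - b = q (W' - W n) - (h n)%:C *: bs n.
  rewrite (star_morphismB lS mq)// {1}(bE n); zmodule.
rewrite (le_trans (rnormD _ _))// rnormN rnormZ cabsr ger0_norm// [leRHS]splitr lerD//.
  rewrite (le_trans (star_morphism_contractive sS mq _)) ?(ltW Wn)//.
  exact: (linear_setB lS).
rewrite (le_trans _ (ltW hn))// ler_piMr//.
by have [_ _ nb] := gbs n; rewrite (le_trans nb)// invf_le1// ler1n.
Qed.

Lemma closed_image : closed (q @` S).
Proof.
have [_ SL SM SS cS] := sS; have [qL qM qS] := mq.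
have sa_lift b : adherent b -> cstar b = b -> exists2 A, S A & q A = b.
  move=> ab sb; pose k : R := 4 * (rnorm b + 1).
  have b1 : 0 < rnorm b + 1 by rewrite ltr_wpDl ?rnorm_ge0.
  have k0 : 0 < k by rewrite mulr_gt0.
  have kC : k%:C != 0 :> R[i] by rewrite fmorph_eq0 gt_eqF.
  have [|A SA qA] := @good_lift ((k^-1)%:C *: b).
  - split.
    + exact: adherentZ.
    + by rewrite cstarZr sb.
    + rewrite rnormZ cabsr ger0_norm ?invr_ge0 ?(ltW k0)// mulrC ler_pdivrMr//.
      by rewrite /k mulrA mulVf// mul1r; lra.
  - exists (k%:C *: A); first exact: (linear_setZ lS).
    by rewrite (star_morphismZ lS mq)// qA scalerA -rmorphM/= mulfV ?gt_eqF// scale1r.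
apply/rnorm_closedP => b Hb.
have ab : adherent b by move=> eps /Hb[_ [A SA <-] bA]; exists A.
have asb := adherent_star ab.
have [A1 SA1 qA1] : exists2 A, S A & q A = b + cstar b.
  apply: sa_lift; last by rewrite cstarD cstarK addrC.
  by have := adherent_lin 1 ab asb; rewrite scale1r.
have [A2 SA2 qA2] : exists2 A, S A & q A = 'i *: (b - cstar b).
  apply: sa_lift.
    by apply: adherentZ; exact: adherentB.
  by rewrite cstarZ cstarB cstarK conjCi scaleNr -scalerN opprB.
exists ((2^-1 : R)%:C *: (A1 - 'i *: A2)).
  apply: (linear_setZ lS); apply: (linear_setB lS) => //; exact: (linear_setZ lS).
have SiA2 : S ('i *: A2) by exact: (linear_setZ lS).
rewrite (star_morphismZ lS mq); last exact: (linear_setB lS).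
rewrite (star_morphismB lS mq)// (star_morphismZ lS mq)// qA1 qA2 scalerA mulCii scaleN1r.
have -> : b + cstar b - - (b - cstar b) = b + b by zmodule.
exact: scale_half.
Qed.

Lemma image_subalgebra : cstar_subalgebra (q @` S).
Proof.
have [S0 SL SM SS cS] := sS; have [qL qM qS] := mq.
split; last exact: closed_image.
- by exists 0 => //; rewrite (star_morphism0 lS mq).
- by move=> c _ _ [A SA <-] [B SB <-]; exists (c *: A + B); [exact: SL|exact: qL].
- by move=> _ _ [A SA <-] [B SB <-]; exists (cmul A B); [exact: SM|exact: qM].
- by move=> _ [A SA <-]; exists (cstar A); [exact: SS|exact: qS].
Qed.

End ClosedImage.

(** * A bilateral shift whose C*-algebra has no CCR ideal *)

(** The exponents of the ruler sequence taken modulo two.  This two-valued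
    sequence is recurrent and aperiodic; its value at [0] is even, which agrees
    with the values at the powers of [4]. *)
Definition ruler (k : int) : bool := odd (logn 2 `|k|%N).

Lemma logn_two_add (k m : int) : k != 0 ->
  ((2 ^+ (logn 2 `|k|%N).+1)%R %| m)%Z -> logn 2 `|(k + m)%R|%N = logn 2 `|k|%N.
Proof.
move=> k0; set s := logn 2 `|k|%N => /dvdzP[m' ->].
have kpos : (0 < `|k|)%N by rewrite absz_gt0.
have /dvdzP[k' kE] : ((2 ^+ s)%R %| k)%Z.
  by rewrite dvdzE abszX; exact: pfactor_dvdnn.
have kodd : odd `|k'|%N.
  have : logn 2 `|k|%N = (logn 2 `|k'|%N + s)%N.
    rewrite {1}kE abszM abszX lognM ?expn_gt0//; last first.
      by rewrite absz_gt0; apply: contraNneq k0 => k'0; rewrite kE k'0 mul0r.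
    by rewrite pfactorK//.
  rewrite -/s => /eqP; rewrite -{1}[s]add0n eqn_add2r => /eqP k'0.
  have k'pos : (0 < `|k'|)%N.
    by rewrite absz_gt0; apply: contraNneq k0 => k'0'; rewrite kE k'0' mul0r.
  rewrite -[odd _]negbK -dvdn2; apply/negP => k'2.
  have : (0 < logn 2 `|k'|)%N by rewrite logn_gt0 mem_primes k'pos k'2.
  by rewrite -k'0.
have -> : k + m' * 2 ^+ s.+1 = (k' + m' * 2) * 2 ^+ s by rewrite {1}kE exprS; ring.
have sumodd : odd `|(k' + m' * 2)%R|%N by lia.
rewrite abszM abszX lognM ?expn_gt0//; last by lia.
rewrite pfactorK// [logn 2 `|_|%N]logn_coprime ?add0n//.
by rewrite coprime2n.
Qed.

Lemma ruler_translate N (k : int) : (`|k| < 4 ^ N)%N -> ruler (k + (4 ^ N)%:Z) = ruler k.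
Proof.
have pow4 : (4 ^ N = 2 ^ N.*2)%N by rewrite -mul2n expnM.
move=> kN; rewrite /ruler; have [->|k0] := eqVneq k 0.
  by rewrite add0r absz_nat pow4 pfactorK// odd_double logn0.
rewrite logn_two_add// dvdzE abszX absz_nat pow4 dvdn_exp2l//.
have k_gt0 : (0 < `|k|)%N by rewrite absz_gt0.
rewrite -(@ltn_exp2l 2)//; apply: leq_ltn_trans (_ : `|k| < _)%N.
  exact: dvdn_leq (pfactor_dvdnn _ _).
by rewrite -pow4.
Qed.

(** The ruler sequence is not periodic, even in one direction: if
    [l - k = 2^s * odd], the valuations at [n] and at [n + l - k] have
    different parities for [n = 2^(s + 1 + 2i)]. *)
Lemma ruler_separates (k l : int) : k != l ->
  exists j : nat, ruler (k + j%:Z) != ruler (l + j%:Z).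
Proof.
move=> kl; pose d := l - k; have d0 : d != 0 by rewrite subr_eq0 eq_sym.
pose s := logn 2 `|d|%N; pose r := (s.+1 + `|k|.*2)%N.
have kr : (k <= (2 ^ r)%:Z)%R.
  have : (`|k| <= 2 ^ r)%N.
    apply: leq_trans (ltnW (ltn_expl _ (ltnSn 1))) _.
    by rewrite leq_exp2l// /r -addnn addnA leq_addl.
  by move: (2 ^ r)%N => n; lia.
pose j := `|(2 ^ r)%:Z - k|%N; exists j.
have jE : j%:Z = (2 ^ r)%:Z - k by rewrite /j gez0_abs// subr_ge0.
have -> : k + j%:Z = (2 ^ r)%:Z by rewrite jE; ring.
have -> : l + j%:Z = d + (2 ^ r)%:Z by rewrite jE /d; ring.
rewrite /ruler logn_two_add//; last first.
  by rewrite dvdzE abszX absz_nat dvdn_exp2l// /r leq_addr.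
by rewrite absz_nat pfactorK// /r oddD odd_double addbF /= -/s; case: odd.
Qed.

Definition nat_of_int (k : int) : nat :=
  match k with Posz n => n.*2 | Negz n => n.*2.+1 end.
Definition int_of_nat (m : nat) : int := if odd m then Negz m./2 else Posz m./2.

Lemma nat_of_intK : cancel nat_of_int int_of_nat.
Proof.
by case=> n; rewrite /int_of_nat /= odd_double /= ?doubleK ?uphalf_double.
Qed.
Lemma int_of_natK : cancel int_of_nat nat_of_int.
Proof.
move=> m; rewrite /int_of_nat; have := odd_double_half m.
by case: odd => /= h; exact: h.
Qed.

(** The terms of a convergent series tend to zero. *)
Lemma basis_coef_cvg0 {R : realType} {H : hilbertType R} (e : nat -> H) (y : H) (eps : R) :
  orthonormal_basis e -> 0 < eps ->
  exists N, forall m, (N <= m)%N -> cabs (dotp y (e m)) < eps.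
Proof.
move=> e_basis eps0; have eps2 : 0 < eps / 2 by rewrite divr_gt0.
have [_ /(_ y)/cvg_rnormP/(_ _ eps2)[N NP]] := e_basis.
exists N => m Nm; pose S := series (fun n => dotp y (e n) *: e n).
have -> : cabs (dotp y (e m)) = rnorm (dotp y (e m) *: e m).
  by rewrite rnormZ (basis_rnorm e_basis) mulr1.
have -> : dotp y (e m) *: e m = (S m.+1 - y) - (S m - y).
  have -> : S m.+1 = S m + dotp y (e m) *: e m by rewrite /S /series /= big_nat_recr.
  zmodule.
rewrite (le_lt_trans (rnormD _ _))// rnormN [ltRHS]splitr ltrD//; apply: NP => //.
exact: leqW.
Qed.

Section BilateralShift.
Context {R : realType} {H : hilbertType R} (e : nat -> H).
Hypothesis e_basis : orthonormal_basis e.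

Definition bilateral_shift (w : int -> R) (V : bop H) :=
  forall k, V (e (nat_of_int k)) = (w k)%:C *: e (nat_of_int (k + 1)).

Lemma bilateral_shift_exists (w : int -> R) (C : R) : 0 <= C ->
  (forall k, `|w k| <= C) -> exists V, bilateral_shift w V.
Proof.
move=> C0 wC; pose sigma m := nat_of_int (int_of_nat m + 1).
have sinj : injective sigma.
  by move=> m n /(can_inj nat_of_intK)/addIr/(can_inj int_of_natK).
have [n|V VE] := @weighted_injection _ _ _ e_basis sigma
  (fun m => (w (int_of_nat m))%:C) C sinj C0; first by rewrite cabsr.
by exists V => k; rewrite VE /sigma nat_of_intK.
Qed.

Lemma bilateral_shift_cstar (w : int -> R) (V : bop H) k : bilateral_shift w V ->
  (cstar V : bop H) (e (nat_of_int k)) = (w (k - 1))%:C *: e (nat_of_int (k - 1)).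
Proof.
move=> Vf; apply: (basis_eq e_basis) => m; rewrite dotp_cstarl -(int_of_natK m).
move: (int_of_nat m) => l.
rewrite Vf dotpZl dotpZr !(basis_dotp e_basis) conjr !(inj_eq (can_inj nat_of_intK)).
have -> : (k == l + 1) = (k - 1 == l) by rewrite subr_eq.
by case: eqP => [->|]; rewrite ?mulr0.
Qed.

End BilateralShift.

Section RulerShift.
Context {R : realType} {H : hilbertType R} (e : nat -> H).
Hypothesis e_basis : orthonormal_basis e.
Variables (alpha beta : R).

Let f (k : int) : H := e (nat_of_int k).
Let f_dotp k l : dotp (f k) (f l) = (k == l)%:R.
Proof. by rewrite /f (basis_dotp e_basis) (inj_eq (can_inj nat_of_intK)). Qed.
Let f_rnorm k : rnorm (f k) = 1. Proof. exact: (basis_rnorm e_basis). Qed.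
Let eE m : e m = f (int_of_nat m). Proof. by rewrite /f int_of_natK. Qed.

Let bop_eqf (A B : bop H) : (forall k, A (f k) = B (f k)) -> A = B.
Proof. by move=> AB; apply: (basis_bop_eq e_basis) => m; rewrite eE. Qed.
Let eqf x y : (forall k, dotp x (f k) = dotp y (f k)) -> x = y.
Proof. by move=> xy; apply: (basis_eq e_basis) => m; rewrite eE. Qed.

Definition ruler_weight (k : int) : R := if ruler k then alpha else beta.

Section FixedShift.
Variable V : bop H.
Hypothesis Vf : bilateral_shift e ruler_weight V.

Let Vsf k : (cstar V : bop H) (f k) = (ruler_weight (k - 1))%:C *: f (k - 1).
Proof. exact: bilateral_shift_cstar. Qed.

(** ** Absence of compact operators *)

(** The ruler sequence recurs: it agrees with its translate by [4^N] on the
    window [|k| < 4^N], so that every element of the algebra asymptotically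
    commutes with these translations. *)
Let translations : exists U : nat -> bop H, (forall n x, rnorm (U n x) = rnorm x) /\
  forall n k, U n (f k) = f (k + (4 ^ n)%:Z).
Proof.
have /choice[U UP] : forall n, exists U : bop H, (forall x, rnorm (U x) = rnorm x) /\
    forall k, U (f k) = f (k + (4 ^ n)%:Z).
  move=> n; pose sigma m := nat_of_int (int_of_nat m + (4 ^ n)%:Z).
  have sinj : injective sigma.
    by move=> i j /(can_inj nat_of_intK)/addIr/(can_inj int_of_natK).
  have [U [Ue U1]] := injection_isometry e_basis sinj.
  by exists U; split => // k; rewrite /f Ue /sigma nat_of_intK.
by exists U; split => [n|n]; case: (UP n).
Qed.

(** The vectors [A f_(k + 4^n)] have norms tending to [|A f_k|], and tend weakly
    to zero; if [A] is compact, they have a cluster point, which must be zero. *)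
Lemma ruler_shift_no_compact (A : bop H) : cstar_generated V A ->
  compact_operator A -> A = 0.
Proof.
move=> QA cA; have [U [U1 Uf]] := translations.
have VV : star_intertwines U V V.
  split; apply: (intertwines_basis U1 e_basis) => m; rewrite eE;
    move: (int_of_nat m) => k; apply/cvg_rnormP => eps eps0;
    exists (`|k| + 1)%N => n nk; rewrite subr0.
    rewrite Uf !Vf bopZ Uf addrAC /ruler_weight ruler_translate ?subrr ?rnorm0//.
    by apply: leq_ltn_trans (ltn_expl n (isT : 1 < 4)%N); lia.
  rewrite Uf !Vsf bopZ Uf addrAC /ruler_weight ruler_translate ?subrr ?rnorm0//.
  by apply: leq_ltn_trans (ltn_expl n (isT : 1 < 4)%N); lia.
have AA : intertwines U A A.
  have Vid : star_intertwines U (bop_id H) (bop_id H).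
    split; first exact: intertwines_id.
    have -> : cstar (bop_id H) = bop_id H by exact: adjoint_uniq.
    exact: intertwines_id.
  exact: (cstar_generated_min (star_intertwines_self U1) VV Vid QA).1.
apply: bop_eqf => k; rewrite bop_zeroE.
pose u n := A (f (k + (4 ^ n)%:Z)).
have weak l (eps : R) : 0 < eps -> exists N, forall n, (N <= n)%N ->
    cabs (dotp (u n) (f l)) < eps.
  move=> eps0; have [N NP] := basis_coef_cvg0 ((cstar A : bop H) (f l)) e_basis eps0.
  exists (N + `|k|)%N => n Nn; rewrite /u dotp_cstar dotpC cabsJ; apply: NP.
  have n4 := ltn_expl n (isT : 1 < 4)%N; move: (4 ^ n)%N n4 => t n4.
  have : (N <= `|(k + t%:Z)%R|)%N by lia.
  move/leq_trans; apply; case: (k + t%:Z) => i /=; first by rewrite -addnn leq_addr.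
  by rewrite ltnS -addnn leq_addr.
have [z [_ zu]] : closure [set A x | x in [set x : H | `|x| <= 1]] `&`
    cluster (u @ \oo) !=set0.
  apply: cA; exists 0%N => // n _; apply: subset_closure.
  by exists (f (k + (4 ^ n)%:Z)) => //=; rewrite rnormE f_rnorm.
have near_z (eps : R) (P : nat -> Prop) : 0 < eps ->
    (exists N, forall n, (N <= n)%N -> P n) -> exists n, P n /\ rnorm (z - u n) < eps.
  move=> eps0 [N NP].
  have FN : (u @ \oo) (u @` [set n | P n]).
    by exists N => // n /NP Pn; exists n.
  have Bz : nbhs z (ball z eps%:C) by apply: nbhsx_ballx; rewrite ltcR.
  have [_ [[n Pn <-] /rball zn]] := zu _ _ FN Bz.
  by exists n.
have z0 : z = 0.
  apply: eqf => l; rewrite dotp0l; apply/eqP; rewrite -normr_eq0 cabsE fmorph_eq0.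
  rewrite eq_le cabs_ge0 andbT; apply/ler_addgt0Pr => eps eps0; rewrite add0r.
  have eps2 : 0 < eps / 2 by rewrite divr_gt0.
  have [n [un zn]] := near_z _ _ eps2 (weak l _ eps2).
  have -> : dotp z (f l) = dotp (z - u n) (f l) + dotp (u n) (f l).
    by rewrite dotpBl subrK.
  rewrite -lecR -cabsE (le_trans (ler_normD _ _))// !cabsE -rmorphD lecR.
  have := dotp_le (z - u n) (f l); rewrite f_rnorm mulr1; lra.
apply: rnorm0_eq0; apply/eqP; rewrite eq_le rnorm_ge0 andbT.
apply/ler_addgt0Pr => eps eps0; rewrite add0r.
have eps2 : 0 < eps / 2 by rewrite divr_gt0.
have /cvg_rnormP/(_ _ eps2)[N NP] := AA (f k).
have [n [Nn zn]] := near_z _ (fun n => (N <= n)%N) eps2 (ex_intro _ N (fun n h => h)).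
have := NP n Nn; rewrite subr0 Uf -/(u n) => hn.
rewrite -(U1 n (A (f k))).
have -> : U n (A (f k)) = - (u n - U n (A (f k))) + (- (z - u n)) by rewrite z0; zmodule.
by rewrite (le_trans (rnormD _ _))// !rnormN [leRHS]splitr lerD// ltW.
Qed.

(** ** Irreducibility *)

Hypotheses (alpha0 : 0 < alpha) (beta0 : 0 < beta) (alpha_beta : alpha != beta).

Lemma ruler_weight_gt0 k : 0 < ruler_weight k.
Proof. by rewrite /ruler_weight; case: (ruler _). Qed.

Let Q := cstar_generated V.
Let sQ : cstar_subalgebra Q := cstar_generated_subalgebra V.
Let lQ : linear_set Q := subalgebra_linear sQ.
Let QM A B : Q A -> Q B -> Q (cmul A B).
Proof. by case: sQ => _ _ QM _ _; exact: QM. Qed.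
Let QS A : Q A -> Q (cstar A).
Proof. by case: sQ => _ _ _ QS _; exact: QS. Qed.
Let Qid : Q (bop_id H). Proof. exact: cstar_generated_id. Qed.
Let QV : Q V. Proof. exact: cstar_generated_self. Qed.

Let diagonal (D : bop H) (theta : int -> bool) :=
  Q D /\ forall k, D (f k) = (theta k)%:R *: f k.

Let diagonalC D theta : diagonal D theta ->
  exists D', diagonal D' (fun k => ~~ theta k).
Proof.
move=> [QD Df]; exists (bop_id H - D); split; first exact: (linear_setB lQ).
by move=> k; rewrite bop_subE Df; case: (theta k); rewrite ?scale1r ?scale0r ?subrr ?subr0.
Qed.

Let diagonalI D1 t1 D2 t2 : diagonal D1 t1 -> diagonal D2 t2 ->
  exists D, diagonal D (fun k => t1 k && t2 k).
Proof.
move=> [Q1 D1f] [Q2 D2f]; exists (cmul D1 D2); split; first exact: QM.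
by move=> k; rewrite cmul_bopE D2f bopZ D1f scalerA mulrC -natrM mulnb.
Qed.

Let diagonal_contractive D theta x : diagonal D theta -> rnorm (D x) <= rnorm x.
Proof.
move=> [_ Df].
have DD : cmul (cstar D) D = D.
  apply: bop_eqf => k; apply: eqf => l; rewrite cmul_bopE dotp_cstarl !Df.
  rewrite !dotpZl dotpZr f_dotp; case: eqP => [->|_]; last by rewrite !mulr0.
  by case: (theta l); rewrite ?conjC1 ?mulr1// mul0r.
have [->|Dx0] := eqVneq (rnorm (D x)) 0; first exact: rnorm_ge0.
have Dxp : 0 < rnorm (D x) by rewrite lt_neqAle eq_sym Dx0 rnorm_ge0.
rewrite -(ler_pM2l Dxp) -expr2 -rdotxx rdot_cstar -cmul_bopE DD rdotC mulrC.
by rewrite mulrC; exact: rdot_le.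
Qed.

Let chi_diagonal : exists D, diagonal D ruler.
Proof.
have ab : alpha ^+ 2 - beta ^+ 2 != 0.
  by rewrite subr_sqr mulf_neq0 ?subr_eq0// gt_eqF// addr_gt0.
exists ((alpha ^+ 2 - beta ^+ 2)^-1%:C *: (cmul (cstar V) V - (beta ^+ 2)%:C *: bop_id H)).
split.
  apply: (linear_setZ lQ); apply: (linear_setB lQ); last exact: (linear_setZ lQ).
  by apply: QM => //; exact: QS.
move=> k; rewrite bop_scaleE bop_subE bop_scaleE cmul_bopE Vf bopZ Vsf addrK /=.
rewrite scalerA -rmorphM/= -expr2 -scalerBl -rmorphB/= scalerA -rmorphM/=.
rewrite /ruler_weight; case: (ruler _); first by rewrite mulVf.
by rewrite subrr mulr0.
Qed.

(** Dividing by the weights turns the generator into the unweighted shift. *)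
Let unweighted : exists2 W : bop H, Q W & forall k, W (f k) = f (k + 1).
Proof.
have [D [QD Df]] := chi_diagonal.
exists (cmul V (alpha^-1%:C *: D + beta^-1%:C *: (bop_id H - D))).
  apply: QM => //; apply: (linear_setD lQ); apply: (linear_setZ lQ) => //.
  exact: (linear_setB lQ).
move=> k; rewrite cmul_bopE bop_addE !bop_scaleE bop_subE Df /= bopD !bopZ bopB bopZ Vf.
have aC : alpha%:C != 0 :> R[i] by rewrite fmorph_eq0 gt_eqF.
have bC : beta%:C != 0 :> R[i] by rewrite fmorph_eq0 gt_eqF.
rewrite /ruler_weight; case: (ruler _).
  by rewrite scale1r subrr scaler0 addr0 scalerA fmorphV mulVf// scale1r.
by rewrite scale0r scaler0 add0r subr0 scalerA fmorphV mulVf// scale1r.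
Qed.

Let diagonal_translate (j : nat) : exists D, diagonal D (fun k => ruler (k + j%:Z)).
Proof.
have [W QW Wf] := unweighted.
have Wsf k : (cstar W : bop H) (f (k + 1)) = f k.
  apply: eqf => l; rewrite dotp_cstarl Wf !f_dotp.
  by rewrite (inj_eq (addIr _)).
elim: j => [|j [D [QD Df]]].
  by have [D [QD Df]] := chi_diagonal; exists D; split => // k; rewrite addr0.
exists (cmul (cstar W) (cmul D W)); split.
  by apply: QM; [exact: QS|exact: QM].
move=> k; rewrite !cmul_bopE Wf Df bopZ Wsf.
by rewrite -addrA -[1 + _]/(Posz (1 + j)).
Qed.

(** Projections converging strongly to the one onto the line of [f k]. *)
Let diagonal_isolates (k : int) N : exists D theta,
  [/\ diagonal D theta, theta k & forall m, (m < N)%N -> m != nat_of_int k ->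
      ~~ theta (int_of_nat m)].
Proof.
elim: N => [|N [D [t [Dt tk tN]]]].
  exists (bop_id H), xpredT; split => //; split => // l; by rewrite scale1r.
have [Nk|Nk] := eqVneq N (nat_of_int k).
  exists D, t; split => // m; rewrite ltnS leq_eqVlt => /orP[/eqP->|mN mk].
    by rewrite Nk eqxx.
  exact: tN.
have /ruler_separates[j jP] : k != int_of_nat N.
  by apply: contraNneq Nk => ->; rewrite int_of_natK.
have [E [s [Es sk sN]]] : exists E s, [/\ diagonal E s, s k & ~~ s (int_of_nat N)].
  have [E Ej] := diagonal_translate j; have [E' E'j] := diagonalC Ej.
  case rk : (ruler (k + j%:Z)) jP => /= jP.
    by exists E, (fun k => ruler (k + j%:Z)); split => //; case: (ruler _) jP.
  by exists E', (fun k => ~~ ruler (k + j%:Z)); rewrite rk; split => //; case: (ruler _) jP.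
have [F Fts] := diagonalI Dt Es; exists F, (fun k => t k && s k); split => //.
  by rewrite tk sk.
move=> m; rewrite ltnS leq_eqVlt => /orP[/eqP->|mN] mk; first by rewrite (negbTE sN) andbF.
by rewrite (negbTE (tN m mN mk)).
Qed.

(** An invariant subspace containing a vector [x] with a nonzero coefficient at
    [f k] contains [f k], by applying the projections that isolate it, and then
    the whole basis, by applying the unweighted shift and its adjoint. *)
Lemma ruler_shift_irreducible (M : set H) : closed_subspace M ->
  (forall A x, cstar_generated V A -> M x -> M (A x)) -> M = [set 0] \/ M = setT.
Proof.
move=> cM MQ; have lM := subspace_linear cM; have [M0 ML MC] := cM.
have [[x [Mx x0]]|nM] := pselect (exists x, M x /\ x != 0); last first.
  left; apply/seteqP; split => x; last by move=> ->.
  by move=> Mx; apply: contrapT => /eqP x0; apply: nM; exists x.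
right; have [k xk] : exists k, dotp x (f k) != 0.
  apply: contrapT => nk; move/eqP: x0; apply.
  apply: eqf => k; rewrite dotp0l; apply: contrapT => /eqP xk.
  by apply: nk; exists k.
have Mfk : M (f k).
  suff Mxk : M (dotp x (f k) *: f k).
    by have := linear_setZ lM (dotp x (f k))^-1 Mxk; rewrite scalerA mulVf// scale1r.
  move/rnorm_closedP: MC; apply => eps eps0.
  pose y := x - dotp x (f k) *: f k.
  have yk : dotp y (f k) = 0 by rewrite dotpBl dotpZl f_dotp eqxx mulr1 subrr.
  have [_ /(_ y)/cvg_rnormP/(_ eps eps0)[N NP]] := e_basis.
  have [D [t [Dt tk tN]]] := diagonal_isolates k N.
  exists (D x); first by apply: MQ => //; case: Dt.
  pose yN := series (fun n => dotp y (e n) *: e n) N.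
  have DyN : D yN = 0.
    have : linear_set [set z : H | D z = 0].
      split; first exact: bop0.
      by move=> c a b /= Da Db; rewrite bopD bopZ Da Db scaler0 addr0.
    move=> lL; rewrite /yN /series /= big_nat; apply: (linear_set_sum lL) => m /= mN.
    rewrite bopZ eE (Dt.2); have [mk|mk] := eqVneq m (nat_of_int k).
      by rewrite mk nat_of_intK yk scale0r.
    by rewrite (negbTE (tN m mN mk)) scale0r scaler0.
  have xE : x = dotp x (f k) *: f k + (yN + (y - yN)) by rewrite /y; zmodule.
  have -> : dotp x (f k) *: f k - D x = D (yN - y).
    by rewrite {2}xE !(bopD, bopZ, bopN) DyN (Dt.2) tk scale1r; zmodule.
  rewrite (le_lt_trans (diagonal_contractive _ Dt))//; exact: NP.
have [W QW Wf] := unweighted.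
have Wsf l : (cstar W : bop H) (f (l + 1)) = f l.
  by apply: eqf => i; rewrite dotp_cstarl Wf !f_dotp (inj_eq (addIr _)).
have up (n : nat) : M (f (k + n%:Z)).
  elim: n => [|n IH]; first by rewrite addr0.
  by have := MQ _ _ QW IH; rewrite Wf -addrA [n%:Z + 1]addrC -intS.
have down (n : nat) : M (f (k - n%:Z)).
  elim: n => [|n IH]; first by rewrite subr0.
  have := MQ _ _ (QS QW) IH; rewrite -[k - n%:Z](subrK 1) Wsf.
  by rewrite intS opprD addrA addrAC.
apply/seteqP; split => // z _; apply: (basis_total e_basis cM) => m; rewrite eE.
set l := int_of_nat m; have -> : l = k + (l - k) by rewrite addrC subrK.
by case: (l - k) => n; [exact: up|rewrite NegzE; exact: down].
Qed.

End FixedShift.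
End RulerShift.

(** * Ideals of irreducible algebras *)

Section IrreducibleIdeals.
Context {R : realType} {H : hilbertType R}.

(** A nonzero ideal [I] of an irreducible algebra is irreducible: an
    [I]-invariant subspace [M] contains the closed span of [I M], and lies in
    the annihilator of [I] if that span vanishes; both are invariant under
    the whole algebra. *)
Lemma irreducible_ideal (Q I : set (bop H)) :
  (forall M : set H, closed_subspace M -> (forall A x, Q A -> M x -> M (A x)) ->
    M = [set 0] \/ M = setT) ->
  closed_ideal Q I -> I <> [set 0] -> irreducible_repr I (@id (bop H)).
Proof.
move=> irrQ [IQ I0 IL IM cI] In0.
have [a Ia a0] : exists2 a, I a & a <> 0.
  apply: contrapT => na; apply: In0; apply/seteqP; split => [x Ix|x ->//].
  by apply: contrapT => x0; apply: na; exists x.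
split; [by []|by exists a|move=> M cM MI].
pose F := [set L : set H | closed_subspace L /\ forall b x, I b -> M x -> L (b x)].
pose N : set H := \bigcap_(L in F) L.
have cN : closed_subspace N.
  split.
  - by move=> L [[L0 _ _] _].
  - move=> c x y Nx Ny L FL; have [[_ LL _] _] := FL.
    by apply: LL; [exact: Nx|exact: Ny].
  - by apply: closed_bigI => L [[_ _ cL] _].
have NQ A x : Q A -> N x -> N (A x).
  move=> QA Nx L [[L0 LL cL] LI]; apply: (Nx [set z | L (A z)]); split.
    split; first by rewrite /= bop0.
      by move=> c y z /= Ly Lz; rewrite bopD bopZ; exact: LL.
    exact: closed_preimage_bop.
  by move=> b y Ib My /=; rewrite -cmul_bopE; apply: LI => //; case: (IM A b QA Ib).
have [N0|NT] := irrQ N cN NQ; last first.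
  right; apply/seteqP; split => // x _.
  have : N x by rewrite NT.
  by apply; split.
pose Z : set H := [set v | forall b, I b -> b v = 0].
have cZ : closed_subspace Z by exact: (closed_subspace_kernels I id).
have MZ x : M x -> Z x.
  move=> Mx b Ib; have : N (b x) by move=> L [_ LI]; exact: LI.
  by rewrite N0.
have ZQ A x : Q A -> Z x -> Z (A x).
  by move=> QA Zx b Ib; rewrite -cmul_bopE; apply: Zx; case: (IM A b QA Ib).
have [Z0|ZT] := irrQ Z cZ ZQ.
  left; apply/seteqP; split => [x /MZ|x ->]; first by rewrite Z0.
  by case: cM.
exfalso; apply: a0; apply: bop_inj => x.
by have /(_ a Ia) : Z x by rewrite ZT.
Qed.

End IrreducibleIdeals.

(** * Limits along windows of the weights *)

Section WindowLimit.
Context {R : realType} {H : hilbertType R} (e : nat -> H).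
Hypothesis e_basis : orthonormal_basis e.
Variables (a : nat -> R) (T : bop H).
Hypothesis Te : forall n, T (e n) = (a n)%:C *: e n.+1.
Variables (w : int -> R) (V : bop H).
Hypothesis Vf : bilateral_shift e w V.
Hypothesis a_words : forall (i : int) L eps, 0 < eps ->
  exists n, forall j, (j < L)%N -> `|a (n + j)%N - w (i + j%:Z)| < eps.

Let windows (N : nat) : exists c : nat, (N <= c)%N /\
  forall k : int, (`|k| <= N)%N -> `|a `|(c%:Z + k)%R|%N - w k| < N.+1%:R^-1.
Proof.
have [|n nP] := @a_words (- N%:Z) N.*2.+1 N.+1%:R^-1; first by rewrite invr_gt0.
exists (n + N)%N; split; first exact: leq_addl.
move=> k kN; have [j [jN jk]] : exists j : nat, (j < N.*2.+1)%N /\ j%:Z = k + N%:Z.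
  by exists `|(k + N%:Z)%R|%N; lia.
have := nP j jN; have -> : - N%:Z + j%:Z = k by rewrite jk addrC addrK.
by have -> : `|((n + N)%:Z + k)%R|%N = (n + j)%N by lia.
Qed.

(** Isometries carrying a long window of the bilateral basis to a place where
    the weights of [T] approximate those of [V]; outside of the window any
    injection of the remaining basis vectors will do. *)
Let window_isometries : exists (c : nat -> nat) (J : nat -> bop H),
  [/\ forall n, (n <= c n)%N,
      forall n k, (`|k| <= n)%N -> `|a `|((c n)%:Z + k)%R|%N - w k| < n.+1%:R^-1,
      forall n x, rnorm (J n x) = rnorm x &
      forall n k, (`|k| <= n)%N -> J n (e (nat_of_int k)) = e `|((c n)%:Z + k)%R|%N].
Proof.
have [c cP] := choice windows.
have /choice[J JP] : forall n, exists J : bop H, (forall x, rnorm (J x) = rnorm x) /\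
    forall k, (`|k| <= n)%N -> J (e (nat_of_int k)) = e `|((c n)%:Z + k)%R|%N.
  move=> n; have nc := (cP n).1.
  pose sigma m := let k := int_of_nat m in
    if (`|k| <= n)%N then `|((c n)%:Z + k)%R|%N else (c n + n + m).+1.
  have sinj : injective sigma.
    move=> i j; rewrite /sigma; case: ifPn => hi; case: ifPn => hj; try lia.
    move=> ij; apply: (can_inj int_of_natK); lia.
  have [J [Je J1]] := injection_isometry e_basis sinj.
  by exists J; split => // k kn; rewrite Je /sigma nat_of_intK kn.
by exists c, J; split => n; [exact: (cP n).1|exact: (cP n).2|
  exact: (JP n).1|exact: (JP n).2].
Qed.

Lemma window_limit : exists q : bop H -> bop H,
  [/\ star_morphism (cstar_generated T) q, q T = V & q (bop_id H) = bop_id H].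
Proof.
have Vsf k := bilateral_shift_cstar e_basis k Vf.
have [c [J [nc ac J1 Je]]] := window_isometries.
have small (eps : R) : 0 < eps -> exists N, forall n, (N <= n)%N -> n.+1%:R^-1 < eps.
  move=> eps0; exists (Num.truncn eps^-1) => n Nn.
  rewrite -[ltRHS]invrK ltf_pV2 ?posrE ?invr_gt0//.
  by rewrite (lt_le_trans (truncnS_gt _))// ler_nat.
have TV : star_intertwines J T V.
  split; apply: (intertwines_basis J1 e_basis) => m; rewrite -(int_of_natK m);
    move: (int_of_nat m) => k; apply/cvg_rnormP => eps /small[N NP];
    exists (N + `|k| + 1)%N => n nk; rewrite subr0.
    have kn : (`|k| <= n)%N by lia.
    have k1n : (`|(k + 1)%R| <= n)%N by lia.
    rewrite Vf bopZ !Je// Te.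
    have -> : `|((c n)%:Z + (k + 1))%R|%N = `|((c n)%:Z + k)%R|%N.+1.
      by have := nc n; lia.
    rewrite -scalerBl -rmorphB rnormZ (basis_rnorm e_basis) mulr1 cabsr.
    by apply: lt_trans (ac _ _ kn) (NP _ _); lia.
  have kn : (`|k| <= n)%N by lia.
  have k1n : (`|(k - 1)%R| <= n)%N by lia.
  rewrite Vsf bopZ !Je//.
  have -> : `|((c n)%:Z + k)%R|%N = `|((c n)%:Z + (k - 1))%R|%N.+1.
    by have := nc n; lia.
  rewrite (shift_cstarS e_basis Te).
  rewrite -scalerBl -rmorphB rnormZ (basis_rnorm e_basis) mulr1 cabsr.
  by apply: lt_trans (ac _ _ k1n) (NP _ _); lia.
have [q [mq qP]] := limit_morphism J1 TV; exists q; split => //.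
  apply: (intertwines_uniq J1 (qP _ _).1 TV.1); exact: cstar_generated_self.
by apply: (intertwines_uniq J1 (qP _ (@cstar_generated_id _ _ T)).1); exact: intertwines_id.
Qed.

Lemma window_kernel_ideal (q : bop H -> bop H) : star_morphism (cstar_generated T) q ->
  closed_ideal (cstar_generated T)
    (cstar_generated T `&` [set A | [set B : bop H | B = 0] (q A)]).
Proof.
move=> mq; have sS := cstar_generated_subalgebra T; have lS := subalgebra_linear sS.
have [S0 SL SM SS cS] := sS; have [qL qM qS] := mq.
split.
- by move=> A [].
- by split => //=; rewrite (star_morphism0 lS mq).
- move=> s A B [SA /= qA] [SB /= qB]; split; first exact: SL.
  by rewrite /= qL// qA qB scaler0 addr0.
- move=> A B SA [SB /= qB]; split; (split; first exact: SM);
    by rewrite /= qM// qB ?cmul0r ?cmul0l.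
- apply: closed_morphism_preimage => //; exact: closed_zero.
Qed.

End WindowLimit.

Section ShiftNotGcr.
Context {R : realType} {H : hilbertType R} (e : nat -> H).
Hypothesis e_basis : orthonormal_basis e.
Variables (alpha beta : R).
Hypotheses (alpha0 : 0 < alpha) (beta0 : 0 < beta) (alpha_beta : alpha != beta).
Variables (a : nat -> R) (T : bop H).
Hypothesis Te : forall n, T (e n) = (a n)%:C *: e n.+1.
Hypothesis a_words : forall (i : int) L eps, 0 < eps ->
  exists n, forall j, (j < L)%N ->
    `|a (n + j)%N - ruler_weight alpha beta (i + j%:Z)| < eps.

(** The limit of the shift along windows reproducing the ruler sequence
    identifies the C*-algebra of the ruler shift with a quotient. *)
Lemma shift_not_gcr : ~ gcr_operator T.
Proof.
have [||V Vf] := @bilateral_shift_exists _ _ _ e_basis (ruler_weight alpha beta)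
  (Num.max alpha beta).
- by rewrite le_max ltW.
- move=> k; rewrite ger0_norm ?(ltW (ruler_weight_gt0 alpha0 beta0 _))// /ruler_weight.
  by case: (ruler _); rewrite le_max lexx ?orbT.
have [q [mq qT qid]] := window_limit e_basis Te Vf a_words.
pose S := cstar_generated T; pose Q := cstar_generated V.
have sS : cstar_subalgebra S := cstar_generated_subalgebra T.
have sQ : cstar_subalgebra Q := cstar_generated_subalgebra V.
have lS := subalgebra_linear sS.
have ST : S T by exact: cstar_generated_self.
have Sid : S (bop_id H) by exact: cstar_generated_id.
have [S0 SL SM SS cS] := sS; have [qL qM qS] := mq.
have qSQ : q @` S = Q.
  apply/seteqP; split.
    have sub : cstar_subalgebra (S `&` [set A | Q (q A)]).
      have [Q0 QL QM QS cQ] := sQ; split.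
      - by split => //=; rewrite (star_morphism0 lS mq).
      - move=> s A B [SA QA] [SB QB]; split; first exact: SL.
        by rewrite /= qL//; exact: QL.
      - move=> A B [SA QA] [SB QB]; split; first exact: SM.
        by rewrite /= qM//; exact: QM.
      - move=> A [SA QA]; split; first exact: SS.
        by rewrite /= qS//; exact: QS.
      - exact: closed_morphism_preimage.
    move=> _ [A SA <-]; apply: (cstar_generated_min sub _ _ SA).2.
      by split => //=; rewrite qT; exact: cstar_generated_self.
    by split => //=; rewrite qid; exact: cstar_generated_id.
  apply: cstar_generated_min.
  - exact: image_subalgebra.
  - by exists T.
  - by exists (bop_id H).
pose K := S `&` [set A | [set B : bop H | B = 0] (q A)].
move=> /(_ K) gT.
have iK : closed_ideal S K by exact: window_kernel_ideal.
have KS : K <> S.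
  move=> KS; have [_ /=] : K (bop_id H) by rewrite KS.
  rewrite qid => /(congr1 (fun B : bop H => B (e 0%N))) /= e0.
  have := basis_rnorm e_basis 0%N; rewrite e0 rnorm0 => /eqP.
  by rewrite eq_sym oner_eq0.
have isq : is_quotient S K Q q.
  split => // A SA; split; first by move=> qA; split.
  by case.
have [I [iI In0 cI]] := gT iK KS (bop H) Q q sQ isq.
apply: In0; apply/seteqP; split => [A IA|A ->]; last by case: iI.
apply: contrapT => A0.
have In0 : I <> [set 0] by move=> I0; apply: A0; rewrite I0 in IA.
have irr := irreducible_ideal
  (ruler_shift_irreducible e_basis Vf alpha0 beta0 alpha_beta) iI In0.
apply: A0; apply: (ruler_shift_no_compact e_basis Vf).
  by case: iI => IQ _ _ _ _; exact: IQ.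
exact: (cI H id irr).
Qed.

End ShiftNotGcr.

(** * Simplicity *)

Section Simplicity.
Context {R : realType} {H : hilbertType R} (e : nat -> H).
Hypothesis e_basis : orthonormal_basis e.
Variables (a : nat -> R) (T : bop H).
Hypothesis Te : forall n, T (e n) = (a n)%:C *: e n.+1.

Lemma zero_shift_simple : (forall n, a n = 0) -> simple_cstar (cstar_generated T).
Proof.
move=> a0; have T0 : T = 0.
  by apply: (basis_bop_eq e_basis) => n; rewrite Te a0 scale0r.
pose C := [set A | exists c : R[i], A = c *: bop_id H].
have star_id : cstar (bop_id H) = bop_id H by exact: adjoint_uniq.
have SC : cstar_generated T `<=` C.
  apply: cstar_generated_min; last by exists 1; rewrite scale1r.
    split.
    - by exists 0; rewrite scale0r.
    - by move=> c A B [x ->] [y ->]; exists (c * x + y); rewrite scalerDl scalerA.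
    - move=> A B [x ->] [y ->]; exists (x * y); rewrite cmulZl cmulZr scalerA.
      by congr (_ *: _); exact: bop_inj.
    - by move=> A [x ->]; exists (Num.conj x); rewrite cstarZ star_id.
    - apply/rnorm_closedP => A HA; exists (dotp (A (e 0%N)) (e 0%N)).
      apply/eqP; rewrite -subr_eq0; apply/eqP/rnorm0_eq0/eqP.
      rewrite eq_le rnorm_ge0 andbT; apply/ler_addgt0Pr => eps eps0; rewrite add0r.
      have eps2 : 0 < eps / 2 by rewrite divr_gt0.
      have [_ [x ->] Ax] := HA _ eps2; set c := dotp _ _.
      have e0 := basis_rnorm e_basis 0%N.
      have cx : cabs (x - c) <= eps / 2.
        have -> : x - c = - dotp ((A - x *: bop_id H) (e 0%N)) (e 0%N).
          rewrite bop_subE bop_scaleE dotpBl dotpZl (basis_dotp e_basis) eqxx mulr1.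
          by rewrite opprB.
        rewrite -lecR -cabsE normrN cabsE lecR (le_trans (dotp_le _ _))// e0 mulr1.
        by rewrite (le_trans (rnorm_bop _ _))// e0 mulr1 ltW.
      apply: rnorm_bop_le => [|v]; first exact: ltW.
      have -> : (A - c *: bop_id H) v = (A - x *: bop_id H) v + (x - c) *: v.
        by rewrite !bop_subE !bop_scaleE scalerBl /=; zmodule.
      rewrite (le_trans (rnormD _ _))// [eps in leRHS]splitr mulrDl lerD//.
        by rewrite (le_trans (rnorm_bop _ _))// ler_wpM2r ?rnorm_ge0// ltW.
      by rewrite rnormZ ler_wpM2r ?rnorm_ge0.
  by exists 0; rewrite T0 scale0r.
move=> I [IS I0 IL IM cI].
have [[A [IA A0]]|nI] := pselect (exists A, I A /\ A <> 0); last first.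
  left; apply/seteqP; split => [A IA|A ->//]; apply: contrapT => A0.
  by apply: nI; exists A.
right; apply/seteqP; split => // B SB.
have [x xE] := SC _ (IS _ IA).
have Iid : I (bop_id H).
  have x0 : x != 0 by apply: contra_notN A0 => /eqP x0; rewrite xE x0 scale0r.
  have := IL x^-1 A 0 IA I0.
  by rewrite addr0 xE scalerA mulVf// scale1r.
have [h _] := IM B _ SB Iid.
by have <- : cmul B (bop_id H) = B by exact: bop_inj.
Qed.

(** In the limit along windows with weights close to [lam], the shift becomes
    a multiple of a unitary. The self-commutator of [T] is therefore in the
    kernel of a morphism which does not vanish on the unit; were it zero, [T]
    would vanish on the whole basis, starting from [T^* e_0 = 0]. *)
Lemma shift_not_simple (lam : R) : lam != 0 ->
  (forall L eps, 0 < eps ->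
    exists n, forall j, (j < L)%N -> `|a (n + j)%N - lam| < eps) ->
  ~ simple_cstar (cstar_generated T).
Proof.
move=> lam0 a_runs simple_S.
have [||V Vf] := @bilateral_shift_exists _ _ _ e_basis (fun=> lam) `|lam| => //.
have [|q [mq qT qid]] := window_limit e_basis Te Vf.
  by move=> i L eps eps0; exact: a_runs.
have sS := cstar_generated_subalgebra T; have lS := subalgebra_linear sS.
have [S0 SL SM SS cS] := sS; have [qL qM qS] := mq.
have ST : cstar_generated T T by exact: cstar_generated_self.
have SsT := SS _ ST.
have [K0|KS] := simple_S _ (window_kernel_ideal mq); last first.
  have [_ /=] : (cstar_generated T `&` [set A | [set B : bop H | B = 0] (q A)]) (bop_id H).
    by rewrite KS; exact: cstar_generated_id.
  rewrite qid => /(congr1 (fun B : bop H => B (e 0%N))) /= e0.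
  have := basis_rnorm e_basis 0%N; rewrite e0 rnorm0 => /eqP.
  by rewrite eq_sym oner_eq0.
have VV : cmul (cstar V) V = cmul V (cstar V).
  have Vsf k := bilateral_shift_cstar e_basis k Vf.
  apply: (basis_bop_eq e_basis) => m; rewrite !cmul_bopE -(int_of_natK m).
  by rewrite Vf bopZ Vsf addrK [in RHS]Vsf bopZ Vf subrK.
have TT : cmul (cstar T) T = cmul T (cstar T).
  apply/eqP; rewrite -subr_eq0; apply/eqP.
  have S1 := SM _ _ SsT ST; have S2 := SM _ _ ST SsT.
  suff : [set 0] (cmul (cstar T) T - cmul T (cstar T)) by [].
  rewrite -K0; split; first exact: (linear_setB lS).
  by rewrite /= (star_morphismB lS mq S1 S2) !qM// qS// qT VV subrr.
have normal x : (cstar T : bop H) x = 0 -> T x = 0.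
  move=> sTx; apply: dotpxx0.
  by rewrite dotp_cstar -cmul_bopE TT cmul_bopE sTx bop0 dotp0r.
have Ten n : T (e n) = 0.
  elim: n => [|n IH]; apply: normal; first by rewrite (shift_cstar0 e_basis Te).
  rewrite (shift_cstarS e_basis Te); move: IH; rewrite Te => /eqP.
  rewrite scaler_eq0 => /orP[/eqP->|/eqP en]; first by rewrite scale0r.
  have := basis_rnorm e_basis n.+1; rewrite en rnorm0 => /eqP.
  by rewrite eq_sym oner_eq0.
have a0 n : a n = 0.
  have := congr1 (dotp^~ (e n.+1)) (Ten n).
  by rewrite Te dotpZl (basis_dotp e_basis) eqxx mulr1 dotp0l => -[].
have [|n /(_ 0%N isT)] := a_runs 1%N `|lam|; first by rewrite normr_gt0.
by rewrite a0 sub0r normrN ltxx.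
Qed.

End Simplicity.

(** * Almost sure behaviour of the weights *)

Lemma card_le_I1P (T : Type) (A : set T) :
  (A #<= `I_1)%card <-> forall x y, A x -> A y -> x = y.
Proof.
split=> [/pcard_leP[f] x y Ax Ay|A1].
  have f0 z : A z -> f z = 0%N.
    by move=> Az; have : (f z < 1)%N by [exact: (@funS _ _ _ _ f z Az)]; case: (f z).
apply: (@inj _ _ _ f); [exact: mem_set|exact: mem_set|].
exact: etrans (f0 x Ax) (esym (f0 y Ay)).
have [[x Ax]|nA] := pselect (exists x, A x); last first.
  have -> : A = set0 by rewrite -subset0 => x Ax; apply: nA; exists x.
  exact: card_ge0.
have -> : A = [set x] by apply/seteqP; split => [y Ay|y ->//]; exact: A1.
by have := @card_set1 T x; rewrite card_eq_le => /andP[].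
Qed.

Section AlmostSure.
Context {R : realType} {d : measure_display} {Omega : measurableType d}
  (P : probability Omega R).

Lemma ae_exists (A : Omega -> Prop) : {ae P, forall w, A w} -> exists w, A w.
Proof.
move=> Aae; apply: contrapT => nA.
have : P.-negligible setT.
  by apply: negligibleS Aae => w _ Aw; apply: nA; exists w.
move/(measure_negligible measurableT) => P0.
by have := etrans (esym (probability_setT P)) P0 => /eqP; rewrite onee_eq0.
Qed.

Lemma ae_has_probability1 (E : set Omega) : {ae P, forall w, E w} -> has_probability P E 1.
Proof.
move=> [N [mN N0 EN]]; exists (~` N), setT; split => //.
- exact: measurableC.
- by move=> w nNw; apply: contrapT => nEw; exact: nNw (EN _ nEw).
- by rewrite probability_setT probability_setC// N0 sube0.
Qed.

Lemma ae_has_probability0 (E : set Omega) : {ae P, forall w, ~ E w} -> has_probability P E 0.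
Proof.
move=> [N [mN N0 EN]]; exists set0, N; split => //.
- by move=> w Ew; apply: EN => /(_ Ew).
- by rewrite measure0.
Qed.

Variable X : nat -> {RV P >-> R}.
Hypotheses (X_indep : mutually_independent X) (X_ident : identically_distributed X).

Let mu := distribution P (X 0%N).

Let mpre n (B : set R) : measurable B -> measurable (X n @^-1` B).
Proof. by move=> mB; rewrite -[X in measurable X]setTI; exact: measurable_funP. Qed.

Let P_pre n (B : set R) : measurable B -> P (X n @^-1` B) = mu B.
Proof. by move=> mB; rewrite /mu -(X_ident n mB). Qed.

(** ** The essential range carries the law *)

(** The complement of the support is a union of open intervals with rational
    ends, each of measure zero. *)
Lemma ae_essran : {ae P, forall w n, essran (X 0%N) (X n w)}.
Proof.
pose I (k : nat) : set R := if (choice.unpickle k : option (rat * rat)) is Some pq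
  then `]ratr pq.1, ratr pq.2[%classic else set0.
have mI k : measurable (I k).
  by rewrite /I; case: choice.unpickle => [pq|//]; exact: measurable_itv.
have nulls n k : {ae P, forall w, mu (I k) = 0%E -> ~ I k (X n w)}.
  have [I0|In0] := pselect (mu (I k) = 0%E); last by apply: aeW => w.
  exists (X n @^-1` I k); split; [exact: mpre|by rewrite P_pre|].
  by move=> w /= nIw; apply: contrapT => h; apply: nIw.
have : {ae P, forall w, forall n k, mu (I k) = 0%E -> ~ I k (X n w)}.
  by apply: ae_foralln => n; apply: ae_foralln => k; exact: nulls.
apply: filterS => w Iw n U oU Ux.
rewrite lt0e; apply/andP; split; last exact: measure_ge0.
apply/eqP => mU0.
have [e /= e0 eU] := (nbhs_ballP _ _).1 (open_nbhs_nbhs (conj oU Ux)).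
set x := X n w in eU *.
have [p] : exists p : rat, x - e < ratr p < x by apply: rat_in_itvoo; rewrite gtrBl.
move=> /andP[p1 p2].
have [q] : exists q : rat, x < ratr q < x + e by apply: rat_in_itvoo; rewrite ltrDl.
move=> /andP[q1 q2].
have IE : I (choice.pickle (p, q)) = `]ratr p, ratr q[%classic by rewrite /I choice.pickleK.
apply: (Iw n (choice.pickle (p, q))); rewrite IE; last by rewrite /= in_itv/= p2.
apply: (subset_measure0 _ _ _ mU0);
  [exact: measurable_itv|exact: measurable_realfun.open_measurable|].
move=> y /=; rewrite in_itv/= => /andP[y1 y2]; apply: eU.
by rewrite /ball /= ltr_distlC; apply/andP; split; lra.
Qed.

Lemma essran_ge0 x : {ae P, forall w, 0 <= X 0%N w} -> essran (X 0%N) x -> 0 <= x.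
Proof.
move=> [N [mN N0 XN]] Ex; rewrite leNgt; apply/negP => x0.
have oU : open [set y : R | y < 0] by exact: open_lt.
have := Ex _ oU x0; rewrite lt0e => /andP[/eqP + _]; apply.
apply: (subset_measure0 _ mN _ N0).
  by apply: mpre; exact: measurable_realfun.open_measurable.
by move=> w /= Xw; apply: XN => /=; apply/negP; rewrite -ltNge.
Qed.

(** ** Every word in the essential range is approximated infinitely often *)

Let cylinder (s : seq nat) (B : nat -> set R) : set Omega :=
  [set w | forall i, i \in s -> B i (X i w)].

Let cylinderE (s : seq nat) (B : nat -> set R) :
  cylinder s B = \bigcap_(i in [set` [fset i in s]%fset]) (X i @^-1` B i).
Proof.
by apply/seteqP; split => w Bw i; have := Bw i; rewrite /= !inE.
Qed.

Let cylinder_measurable (s : seq nat) (B : nat -> set R) :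
  (forall i, measurable (B i)) -> measurable (cylinder s B).
Proof.
move=> mB; rewrite cylinderE; apply: fin_bigcap_measurable => // i _; exact: mpre.
Qed.

Let pr (A : set Omega) : R := fine (P A).
Let prE (A : set Omega) : measurable A -> P A = (pr A)%:E.
Proof. by move=> mA; rewrite /pr fineK// fin_num_measure. Qed.

Let cylinder_prob (s : seq nat) (B : nat -> set R) : uniq s ->
  (forall i, measurable (B i)) -> pr (cylinder s B) = \prod_(i <- s) fine (mu (B i)).
Proof.
move=> us mB; rewrite /pr cylinderE X_indep//.
have -> : (\prod_(i <- [fset i in s]%fset) P (X i @^-1` B i) =
    \prod_(i <- s) (fine (mu (B i)))%:E)%E.
  rewrite (perm_big s)/=; last first.
    by apply: uniq_perm => // [|i]; rewrite ?fset_uniq// inE.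
  by apply: eq_bigr => i _; rewrite P_pre// fineK// fin_num_measure.
by rewrite prodEFin.
Qed.

Section Word.
Variables (u : nat -> R) (L : nat) (eps : R).
Hypotheses (eps0 : 0 < eps) (uE : forall j, essran (X 0%N) (u j)).

Let near j : set R := [set x | `|x - u j| < eps].
Let near_open j : open (near j).
Proof.
have -> : near j = ball (u j) eps by apply/seteqP; split => x; rewrite /near /ball /= distrC.
exact: ball_open.
Qed.
Let near_measurable j : measurable (near j). Proof. exact: measurable_realfun.open_measurable. Qed.

Let p : R := \prod_(0 <= j < L) fine (mu (near j)).
Let p01 : 0 < p <= 1.
Proof.
have mu01 j : 0 < fine (mu (near j)) <= 1.
  have mu0 : (0 < mu (near j))%E.
    apply: (@uE j (near j) (@near_open j)).
    by rewrite /near /= subrr normr0.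
  have mu1 : (mu (near j) <= 1)%E by exact: probability_le1.
  have muf : mu (near j) \is a fin_num by exact: fin_num_measure.
  by rewrite -lee_fin fineK// mu1 andbT fine_gt0// mu0 (le_lt_trans mu1)// ltry.
rewrite /p; elim: L => [|l IH]; first by rewrite big_geq// ltr01 lexx.
rewrite big_nat_recr//=; have /andP[a1 a2] := IH; have /andP[b1 b2] := mu01 l.
by rewrite mulr_gt0//= mulr_ile1// ltW.
Qed.

(** The blocks of indices are disjoint, so that the events are independent. *)
Let match_block m : set Omega :=
  [set w | forall j, (j < L)%N -> near j (X (m * L + j)%N w)].
Let no_match m : set Omega := [set w | forall i, (i < m)%N -> ~ match_block i w].

Let match_cylinder m :
  match_block m = cylinder (iota (m * L) L) (fun i => near (i - m * L)).
Proof.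
apply/seteqP; split => w Mw i.
  by rewrite mem_iota => /andP[i1 i2]; rewrite -{2}(subnKC i1); apply: Mw; lia.
by move=> iL; have := Mw (m * L + i)%N; rewrite mem_iota addKn; apply; lia.
Qed.

Let match_measurable m : measurable (match_block m).
Proof. by rewrite match_cylinder; exact: cylinder_measurable. Qed.

Let no_matchS m : no_match m.+1 = no_match m `\` match_block m.
Proof.
apply/seteqP; split => w.
  by move=> h; split => [i im|]; apply: h; rewrite // ltnS ltnW.
by move=> [h hm] i; rewrite ltnS leq_eqVlt => /orP[/eqP->//|]; exact: h.
Qed.

Let no_match_measurable m : measurable (no_match m).
Proof.
elim: m => [|m IH]; last by rewrite no_matchS; exact: measurableD.
by rewrite (_ : no_match 0 = setT)//; apply/seteqP; split.
Qed.

(** Induction on the number of blocks, with a cylinder on later coordinates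
    carried along, so that only the product rule for cylinders is needed. *)
Let no_match_prob m (s : seq nat) (B : nat -> set R) : uniq s ->
  (forall i, i \in s -> (m * L <= i)%N) -> (forall i, measurable (B i)) ->
  pr (no_match m `&` cylinder s B) = (1 - p) ^+ m * pr (cylinder s B).
Proof.
elim: m s B => [|m IH] s B us sm mB.
  rewrite expr0 mul1r (_ : no_match 0 = setT) ?setTI//.
  by apply/seteqP; split.
pose s' := iota (m * L) L ++ s.
pose B' i := if (i < m.+1 * L)%N then near (i - m * L) else B i.
have mB' i : measurable (B' i) by rewrite /B'; case: ifP.
have us' : uniq s'.
  rewrite cat_uniq iota_uniq us andbT; apply/hasPn => i /sm.
  by rewrite mem_iota mulSn; lia.
have iB' i : i \in iota (m * L) L -> B' i = near (i - m * L).
  by rewrite mem_iota /B' mulSn addnC => /andP[_ ->].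
have sB' i : i \in s -> B' i = B i.
  by move/sm; rewrite /B' ltnNge => ->.
have capE : match_block m `&` cylinder s B = cylinder s' B'.
  rewrite match_cylinder; apply/seteqP; split => w.
    move=> [h1 h2] i; rewrite mem_cat => /orP[ii|ii].
      by rewrite iB'//; exact: h1.
    by rewrite sB'//; exact: h2.
  move=> h; split => i ii.
    by rewrite -iB'//; apply: h; rewrite mem_cat ii.
  by rewrite -sB'//; apply: h; rewrite mem_cat ii orbT.
have capP : pr (cylinder s' B') = p * pr (cylinder s B).
  rewrite !cylinder_prob// /s' big_cat/=; congr (_ * _).
    rewrite /p /index_iota subn0 -[X in iota X]addn0 iotaDl big_map.
    apply: eq_big_seq => j jL; rewrite iB'; last by move: jL; rewrite !mem_iota; lia.
    by rewrite addKn.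
  by apply: eq_big_seq => i /sB'->.
have mC : measurable (cylinder s B) by exact: cylinder_measurable.
have mN := no_match_measurable m.
have -> : no_match m.+1 `&` cylinder s B =
    (no_match m `&` cylinder s B) `\` (no_match m `&` cylinder s' B').
  rewrite no_matchS -capE; apply/seteqP; split => w.
    by move=> [[h1 h2] h3]; split => // -[_ [h4 _]].
  by move=> [[h1 h2] h3]; split => //; split => // h4; apply: h3.
have mNC' : measurable (no_match m `&` cylinder s' B').
  by apply: measurableI => //; exact: cylinder_measurable.
have mNC : measurable (no_match m `&` cylinder s B) by exact: measurableI.
rewrite /pr measureD//; last exact: (le_lt_trans (probability_le1 P mNC) (ltry _)).
rewrite (_ : _ `&` _ `&` _ = no_match m `&` cylinder s' B'); last first.
  by rewrite -capE; apply/seteqP; split => w; [move=> [_]|move=> [h1 [h2 h3]]].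
rewrite fineB ?fin_num_measure// -!/(pr _) !IH//.
- by rewrite capP exprS; ring.
- move=> i; rewrite mem_cat mem_iota => /orP[/andP[]//|/sm].
  by rewrite mulSn; lia.
- by move=> i /sm; rewrite mulSn; lia.
Qed.

Lemma ae_word : {ae P, forall w, exists n, forall j, (j < L)%N -> `|X (n + j)%N w - u j| < eps}.
Proof.
pose never : set Omega := ~` \bigcup_m match_block m.
have mnever : measurable never by apply: measurableC; exact: bigcup_measurable.
exists never; split => //; last first.
  move=> w /= nw [m _ wm]; apply: nw; exists (m * L)%N; exact: wm.
have never_le m : pr never <= (1 - p) ^+ m.
  have -> : (1 - p) ^+ m = pr (no_match m).
    have all_cyl : cylinder [::] (fun=> setT) = setT by apply/seteqP; split.
    have := @no_match_prob m [::] (fun=> setT) isT.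
    rewrite all_cyl setIT => -> //.
    by rewrite /pr probability_setT mulr1.
  rewrite fine_le ?fin_num_measure//; apply: le_measure; rewrite ?inE//.
  by move=> w nw i _ mw; apply: nw; exists i.
rewrite prE//; congr _%:E; apply/eqP; rewrite eq_le; apply/andP; split; last first.
  by rewrite fine_ge0.
apply/ler_addgt0Pr => e0 e00; rewrite add0r.
have /andP[p0 p1] := p01.
have hc : (fun m => (1 - p) ^+ m) @ \oo --> (0 : R).
  by apply: cvg_expr; rewrite ger0_norm; lra.
have /cvgrPdist_lt/(_ _ e00)[N _ NP] := hc.
apply: (le_trans (never_le N)); have := NP N (leqnn N).
by rewrite /= sub0r normrN => /ltW; exact: le_trans (ler_norm _).
Qed.

End Word.

(** Countably many triples [(i, L, 1 / (k + 1))] suffice. *)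
Lemma ae_windows (v : int -> R) : (forall k, essran (X 0%N) (v k)) ->
  {ae P, forall w, forall (i : int) L eps, 0 < eps ->
    exists n, forall j, (j < L)%N -> `|X (n + j)%N w - v (i + j%:Z)| < eps}.
Proof.
move=> vE.
pose good (c : option (int * nat * nat)) (w : Omega) := if c is Some (i, L, k) then
  exists n, forall j, (j < L)%N -> `|X (n + j)%N w - v (i + j%:Z)| < k.+1%:R^-1 else True.
have : {ae P, forall w, forall c : nat, good (choice.unpickle c) w}.
  apply: ae_foralln => c; case: (choice.unpickle c) => [[[i L] k]|]; last exact: aeW.
  by apply: ae_word => //; rewrite invr_gt0.
apply: filterS => w gw i L eps eps0.
pose k := Num.truncn eps^-1.
have := gw (choice.pickle (i, L, k)); rewrite choice.pickleK /= => -[n nP].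
exists n => j /nP/lt_trans; apply.
by rewrite -[ltRHS]invrK ltf_pV2 ?posrE ?invr_gt0// truncnS_gt.
Qed.

End AlmostSure.

Local Open Scope card_scope.

Theorem theorem1p6 (R : realType) (d : measure_display)
  (Omega : measurableType d) (P : probability Omega R)
  (H : hilbertType R) (e : nat -> H) (e_basis : orthonormal_basis e)
  (X : nat -> {RV P >-> R})
  (X_ge0 : forall n, {ae P, forall w, 0 <= X n w})
  (X_bounded : forall n, exists M : R, {ae P, forall w, `|X n w| <= M})
  (X_indep : mutually_independent X)
  (X_ident : identically_distributed X)
  (T : Omega -> bop H) (T_shift : random_weighted_shift e X T) :
  has_probability P [set w | simple_cstar (cstar_generated (T w))]
    (if `[< essran (X 0%N) = [set 0] >] then 1 else 0)
  /\
  has_probability P [set w | gcr_operator (T w)]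
    (if `[< (essran (X 0%N) `\ 0) #<= `I_1 >] then 1 else 0).

Proof.
have E_ae := ae_essran X_ident.
have [x0 Ex0] : exists x, essran (X 0%N) x.
  by have [w Ew] := ae_exists E_ae; exists (X 0%N w).
split; case: asboolP => HE.
- apply: ae_has_probability1; apply: filterS2 E_ae T_shift => w Ew Tw.
  by apply: (zero_shift_simple e_basis Tw) => n; have := Ew n; rewrite HE.
- have [lam Elam lam0] : exists2 lam, essran (X 0%N) lam & lam != 0.
    apply: contrapT => n0; apply: HE.
    have E0 x : essran (X 0%N) x -> x = 0.
      by move=> Ex; apply: contrapT => /eqP x0'; apply: n0; exists x.
    by apply/seteqP; split => [x /E0//|x ->]; rewrite -(E0 _ Ex0).
  have runs := ae_windows X_indep X_ident (v := fun=> lam) (fun=> Elam).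
  apply: ae_has_probability0; apply: filterS2 runs T_shift => w Rw Tw.
  by apply: (shift_not_simple e_basis Tw lam0) => L eps; exact: (Rw 0).
- have [lam lam0 Elam] : exists2 lam : R, lam != 0 &
      forall x, essran (X 0%N) x -> x = 0 \/ x = lam.
    have HE1 := (card_le_I1P _).1 HE.
    have [[lam [Elam lam0]]|n0] := pselect (exists lam, (essran (X 0%N) `\ 0) lam).
      exists lam; first exact/eqP.
      move=> x Ex; have [->|/eqP x0'] := eqVneq x 0; first by left.
      by right; apply: HE1.
    (* all weights vanish, and any nonzero value will do for [lam] *)
    exists 1; first exact: oner_neq0.
    by move=> x Ex; left; apply: contrapT => x0'; apply: n0; exists x.
  apply: ae_has_probability1; apply: filterS2 E_ae T_shift => w Ew Tw.
  by apply: (two_weights_gcr e_basis Tw lam0) => n; exact: Elam.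
- have [alpha [beta [[Ea a0] [Eb b0] ab]]] : exists alpha beta,
      [/\ (essran (X 0%N) `\ 0) alpha, (essran (X 0%N) `\ 0) beta & alpha != beta].
    apply: contrapT => nab; apply: HE; apply/card_le_I1P => x y Ex Ey.
    by apply: contrapT => /eqP xy; apply: nab; exists x, y.
  have pos x : essran (X 0%N) x -> x <> 0 -> 0 < x.
    move=> Ex /eqP x0'; rewrite lt_neqAle eq_sym x0'.
    by apply: essran_ge0 Ex => //; exact: X_ge0.
  have wE k : essran (X 0%N) (ruler_weight alpha beta k).
    by rewrite /ruler_weight; case: (ruler _).
  apply: ae_has_probability0.
  apply: filterS2 (ae_windows X_indep X_ident wE) T_shift => w Rw Tw.
  exact: (shift_not_gcr e_basis (pos _ Ea a0) (pos _ Eb b0) ab Tw Rw).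
Qed.
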